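(* Let $\Gamma$ be a countable discrete group and let $\mathrm{Rad}(\Gamma)$ denote the maximal normal amenable subgroup of $\Gamma$. Then $L(\mathrm{Rad}(\Gamma))$ is the maximal amenable $\Gamma$-invariant von Neumann subalgebra of $L(\Gamma)$; that is, $L(\mathrm{Rad}(\Gamma))$ is an amenable $\Gamma$-invariant von Neumann subalgebra of $L(\Gamma)$, and every amenable $\Gamma$-invariant von Neumann subalgebra $\mathcal{M}\subseteq L(\Gamma)$ satisfies $\mathcal{M}\subseteq L(\mathrm{Rad}(\Gamma))$.
   Context: $\lambda$ is the left regular representation of $\Gamma$ on $\ell^2(\Gamma)$ and $L(\Gamma)=\overline{\mathrm{span}(\lambda(\Gamma))}^{so}\subseteq\mathbb{B}(\ell^2(\Gamma))$ is the group von Neumann algebra, with canonical trace $\tau_0(x)=\langle x\delta_e,\delta_e\rangle$. For a subgroup $H\le\Gamma$, $L(H)$ is identified with the von Neumann subalgebra of $L(\Gamma)$ generated by $\lambda(H)$. Von Neumann subalgebras are unital (they contain the unit of the ambient algebra). A von Neumann subalgebra $\mathcal{M}\subseteq L(\Gamma)$ is $\Gamma$-invariant if $\lambda(s)\mathcal{M}\lambda(s)^*=\mathcal{M}$ for all $s\in\Gamma$. A tracial von Neumann algebra $(\mathcal{M},\tau)$, $\mathcal{M}\subseteq\mathbb{B}(\mathcal{H})$ with $\mathcal{H}$ separable, is amenable if there is a state $\phi$ on $\mathbb{B}(\mathcal{H})$ with $\phi|_{\mathcal{M}}=\tau$ and $\phi(Tm)=\phi(mT)$ for all $m\in\mathcal{M}$,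 $T\in\mathbb{B}(\mathcal{H})$; subalgebras of $L(\Gamma)$ carry the trace $\tau_0|_{\mathcal{M}}$. $\mathrm{Rad}(\Gamma)$, the amenable radical, is the unique largest normal amenable subgroup of $\Gamma$. *)

(* Defs.v *)
From HB Require Import structures.
From mathcomp Require Import all_boot all_order all_algebra.
From mathcomp Require Import complex ring.
From mathcomp Require Import boolp classical_sets functions cardinality fsbigop.
From mathcomp Require Import reals ereal topology normedtype esum.

Set Implicit Arguments.
Unset Strict Implicit.
Unset Printing Implicit Defensive.

Import Order.TTheory GRing.Theory Num.Theory.
Import numFieldNormedType.Exports.

Local Open Scope classical_set_scope.
Local Open Scope ring_scope.

Section amenable_radical.
Context (R : realType) (G : groupType).
Implicit Types (H K N : set G).

(* An invariant mean on l^oo(H).  A bounded function on H is encoded as a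
   function on G that is bounded on H; linearity and positivity force [m f]
   to depend only on the restriction of [f] to H. *)
Definition is_invariant_mean H (m : (G -> R) -> R) : Prop :=
  [/\ forall (a : R) (f1 f2 : G -> R),
        [bounded f1 h | h in H] -> [bounded f2 h | h in H] ->
        m (fun g => a * f1 g + f2 g) = a * m f1 + m f2,
      forall f : G -> R, [bounded f h | h in H] ->
        (forall h, H h -> 0 <= f h) -> 0 <= m f,
      m (fun=> 1) = 1 &
      forall (s : G) (f : G -> R), H s -> [bounded f h | h in H] ->
        m (fun g => f (s^-1 * g)%g) = m f].

Definition amenable_group H : Prop := exists m, is_invariant_mean H m.

Definition normal_subgroup H : Prop :=
  group_closed (mem H) /\ forall g h, H h -> H (h ^ g)%g.

Definition normal_amenable H : Prop := normal_subgroup H /\ amenable_group H.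

Definition is_amenable_radical N : Prop :=
  normal_amenable N /\ forall K, normal_amenable K -> K `<=` N.

(* The largest normal amenable subgroup, as a definite description.  That
   it exists is a theorem, which is neither assumed nor used here. *)
Definition Rad : set G := xget set0 is_amenable_radical.

End amenable_radical.

Section ell2.
Context (R : realType) (G : groupType).
Local Notation C := R[i].
Implicit Types x y : G -> C.

Definition sqmod (z : C) : R := complex.Re z ^+ 2 + complex.Im z ^+ 2.

Definition sqnorm x : \bar R := \esum_(g in [set: G]) (sqmod (x g))%:E.

Definition square_summable : {pred G -> C} :=
  [pred x | `[< (sqnorm x < +oo)%E >]].

Lemma square_summableP x :
  reflect (sqnorm x < +oo)%E (x \in square_summable).
Proof. exact: asboolP. Qed.

Lemma sqmod_ge0 z : 0 <= sqmod z.
Proof. by rewrite addr_ge0 ?sqr_ge0. Qed.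

Lemma square_summable_submod : submod_closed square_summable.
Proof.
have esumZ_le (k : R) (f : G -> R) : 0 <= k -> (forall g, 0 <= f g) ->
    (\esum_(g in [set: G]) (k * f g)%:E <=
     k%:E * \esum_(g in [set: G]) (f g)%:E)%E.
  move=> k0 f0; apply: ge_ereal_sup => _ /= [A finA <-].
  under eq_fsbigr do rewrite EFinM.
  rewrite -ge0_mule_fsumr; last by move=> g; rewrite lee_fin.
  by rewrite lee_wpmul2l ?lee_fin//; apply: ereal_sup_ubound; exists A.
have fin_lty (k : R) (f : \bar R) : (f < +oo -> k%:E * f < +oo \/ f = -oo)%E.
  by case: f => [r _|//|_]; [left; rewrite -EFinM ltry|right].
have sqn_neq x : sqnorm x != -oo%E.
  by rewrite -ltNye (lt_le_trans (ltNyr 0))//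
    esum_ge0// => g _; rewrite lee_fin sqmod_ge0.
split.
  apply/square_summableP; rewrite /sqnorm esum1 ?ltry// => g _.
  by rewrite /sqmod /= expr0n addr0.
move=> a x y /square_summableP xoo /square_summableP yoo.
apply/square_summableP.
pose k : R := 2 * sqmod a.
have k0 : 0 <= k by rewrite mulr_ge0 ?sqmod_ge0.
apply: (@le_lt_trans _ _ (\esum_(g in [set: G])
    ((k * sqmod (x g))%:E + (2 * sqmod (y g))%:E))%E).
  apply: le_esum => g _; rewrite -EFinD lee_fin /k /sqmod.
  rewrite [(a *: x + y) g]/(a * x g + y g).
  case: a {k k0} (x g) (y g) => [a b] [c d] [e f] /=.
  rewrite -subr_ge0 (_ : _ - _ =
    (a * c - b * d - e) ^+ 2 + (a * d + b * c - f) ^+ 2); last by ring.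
  by rewrite addr_ge0 ?sqr_ge0.
rewrite esumD; try by move=> g _; rewrite lee_fin mulr_ge0 ?sqmod_ge0.
apply: lte_add_pinfty.
  apply: le_lt_trans (esumZ_le _ _ k0 (fun g => sqmod_ge0 (x g))) _.
  by case: (fin_lty k _ xoo) => // /eqP; rewrite (negbTE (sqn_neq x)).
apply: le_lt_trans (esumZ_le _ _ _ (fun g => sqmod_ge0 (y g))) _ => //.
by case: (fin_lty 2 _ yoo) => // /eqP; rewrite (negbTE (sqn_neq y)).
Qed.

HB.instance Definition _ :=
  GRing.isSubmodClosed.Build C (G -> C) square_summable square_summable_submod.

Record ell2 := Ell2 { ell2_val :> G -> C; _ : ell2_val \in square_summable }.

HB.instance Definition _ := [isSub for ell2_val].
HB.instance Definition _ := [Choice of ell2 by <:].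
HB.instance Definition _ := [SubChoice_isSubLmodule of ell2 by <:].

Lemma delta_subproof (g : G) :
  (fun h => (h == g)%:R : C) \in square_summable.
Proof.
apply/square_summableP; rewrite /sqnorm.
rewrite (eq_esum (b := fun h => if h \in [set g] then 1%E else 0%E)).
  by rewrite -esum_mkcond esum_set1 ?lee01 ?ltry.
move=> h _; have [->|/eqP ne] := eqVneq h g.
  by rewrite mem_set//= /sqmod /= expr1n expr0n addr0.
by rewrite memNset//= /sqmod /= expr0n addr0.
Qed.

Definition delta (g : G) : ell2 := Ell2 (delta_subproof g).

Lemma lreg_subproof (s : G) (x : ell2) :
  (fun g => x (s^-1 * g)%g) \in square_summable.
Proof.
have /square_summableP xoo := valP x; apply/square_summableP.
apply: le_lt_trans xoo; rewrite /sqnorm.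
rewrite [leRHS](reindex_esum [set: G] [set: G] (fun g => (s^-1 * g)%g))//.
split=> // [g h _ _ /=|g _]; first exact: mulgI.
by exists (s * g)%g => //=; rewrite mulKg.
Qed.

Definition lreg (s : G) (x : ell2) : ell2 := Ell2 (lreg_subproof s x).

Definition l2norm (x : ell2) : R := Num.sqrt (fine (sqnorm x)).

(* The sum of an absolutely summable family: positive part minus negative
   part, separately for the real and the imaginary part. *)
Definition rsum (f : G -> R) : R :=
  fine (\esum_(g in [set: G]) (Num.max (f g) 0)%:E) -
  fine (\esum_(g in [set: G]) (Num.max (- f g) 0)%:E).

Definition csum (f : G -> C) : C :=
  (rsum (fun g => complex.Re (f g)) +i* rsum (fun g => complex.Im (f g)))%C.

Definition inner (x y : ell2) : C := csum (fun g => x g * (y g)^*%C).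

End ell2.

Section operators.
Context (R : realType) (G : groupType).
Local Notation C := R[i].
Local Notation H := (ell2 R G).

(* Operators are plain functions on l^2(G), and an algebra of operators is a
   set of functions contained in [bounded_operator]. *)
Definition bounded_operator : set (H -> H) :=
  [set T | linear T /\
           exists K : R, forall x, l2norm (T x) <= K * l2norm x].

(* The unique bounded [S] with <T x, y> = <x, S y>; it exists whenever [T] is
   bounded. *)
Definition adjoint (T : H -> H) : H -> H :=
  xget 0 [set S | bounded_operator S /\
                  forall x y, inner (T x) y = inner x (S y)].

Definition positive_operator : set (H -> H) :=
  [set T | bounded_operator T /\ forall x, 0 <= inner (T x) x].

Definition sot_closure (A : set (H -> H)) : set (H -> H) :=
  [set T | bounded_operator T /\
     forall (xs : seq H) (e : R), 0 < e ->
       exists2 S, A S & forall x, x \in xs -> l2norm (T x - S x) < e].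

Definition linear_span (A : set (H -> H)) : set (H -> H) :=
  [set T | exists (n : nat) (c : 'I_n -> C) (S : 'I_n -> H -> H),
             (forall i, A (S i)) /\ T = \sum_(i < n) c i *: S i].

Definition von_neumann_algebra (M : set (H -> H)) : Prop :=
  [/\ M `<=` bounded_operator,
      M idfun,
      forall (a : C) S T, M S -> M T -> M (a *: S + T),
      forall S T, M S -> M T -> M (S \o T) &
      (forall T, M T -> M (adjoint T)) /\ sot_closure M `<=` M].

Definition von_neumann_subalgebra (M N : set (H -> H)) : Prop :=
  von_neumann_algebra M /\ M `<=` N.

Definition group_vN : set (H -> H) :=
  sot_closure (linear_span (range (@lreg R G))).

(* The von Neumann subalgebra of L(G) generated by the left translations by
   the elements of K. *)
Definition subgroup_vN (K : set G) : set (H -> H) :=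
  \bigcap_(N in [set N | von_neumann_subalgebra N group_vN /\
                         @lreg R G @` K `<=` N]) N.

Definition trace0 (T : H -> H) : C := inner (T (delta R 1%g)) (delta R 1%g).

Definition G_invariant (M : set (H -> H)) : Prop :=
  forall s : G, [set lreg s \o T \o adjoint (lreg s) | T in M] = M.

(* A state on the algebra of bounded operators; the values of [phi] on other
   functions are irrelevant. *)
Definition is_state (phi : (H -> H) -> C) : Prop :=
  [/\ forall (a : C) S T, bounded_operator S -> bounded_operator T ->
        phi (a *: S + T) = a * phi S + phi T,
      forall T, positive_operator T -> 0 <= phi T &
      phi idfun = 1].

Definition amenable_vN (M : set (H -> H)) : Prop :=
  exists phi : (H -> H) -> C,
    [/\ is_state phi,
        forall m, M m -> phi m = trace0 m &
        forall m T, M m -> bounded_operator T -> phi (T \o m) = phi (m \o T)].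

End operators.

Arguments Rad R G : clear implicits.
Arguments delta R [G] g.
Arguments group_vN R G : clear implicits.
Arguments subgroup_vN R [G] K.

(* Main.v *)
(* Rad(G) is the kernel of the action of G on a minimal G-invariant convex set
   of states of B(l^2 G): a normal amenable subgroup fixes a point of that set,
   and its fixed points form an invariant convex subset.  That the kernel is
   amenable is seen by restricting a state it fixes to the diagonal operators.
   For a normal amenable K, averaging the vector states at delta_k over K shows
   that L(K) is amenable.

   Let M be amenable and G-invariant, and let V_s in M' have range in the closure
   of M delta_1 and satisfy sum_s V_s^* V_s = 1.  The map T |-> sum_s V_s^* T V_s
   is M-bimodular on B(l^2 G) and restricts to the trace-preserving conditional
   expectation from L(G) to M, so composing a hypertrace of M with it gives a
   state phi centralised by M that agrees with the trace tau on all of M L(G).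
   Such states form a G-invariant set; let K0 be a minimal invariant convex
   subset, psi an extreme point of K0, and D_T the diagonal operator with entries
   psi(l_s^-1 T l_s).  By minimality psi(T) = phi(D_T) for some phi in K0, and
   extremality of psi puts D_T in the multiplicative domain of phi.  Comparing
   phi(a l_g^-1 D_T) with phi(l_g^-1 D_T a) for a in M gives
     tau(a l_g^-1) psi(T) = tau(a l_g^-1) psi(l_g^-1 T l_g),
   so tau(a l_g^-1) = 0 unless g fixes psi.  The elements fixing every extreme
   point form a normal amenable subgroup, hence lie in Rad(G), and every a in M
   is supported on Rad(G). *)

Require Import Defs.
From HB Require Import structures.
From mathcomp Require Import all_boot all_order all_algebra.
From mathcomp Require Import complex ring lra.
From mathcomp Require Import boolp classical_sets functions cardinality fsbigop.
From mathcomp Require Import reals ereal topology normedtype esum.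

Set Implicit Arguments.
Unset Strict Implicit.
Unset Printing Implicit Defensive.

Import Order.TTheory GRing.Theory Num.Theory.
Import numFieldNormedType.Exports.

Local Open Scope classical_set_scope.
Local Open Scope ring_scope.

(** The hypertrace given by amenability is controlled on $M$ only, whereas the last step evaluates
    it at [a \o lreg g^-1], usually outside $M$; the $V_s$ close this gap. They arise by normalising
    $A_s = \sqrt{w_s}\, e\, r_s^{-1}$, with $e$ the projection onto the closure of $M\delta_1$, $r$
    the right translations and $w$ strictly positive weights of finite sum, which is where
    countability enters: $Q = \sum_s A_s^* A_s$ is injective, and $V_s$ extends $A_s Q^{-1/2}$ from
    the dense range of $Q^{1/2}$. No topology is put on functionals: limits are taken along finitely
    additive means, and a set counts as compact and convex when it contains the barycentre of each
    family of its points under each mean. Extremality works as follows. On diagonal operators [phi]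
    is a mean on the group, and the orbit of [psi] has barycentre [psi] under it. Every reweighting
    of that mean by a density bounded away from 0 and 1 must then have the same barycentre, so [phi]
    cannot tell the entries of $D_T$ from the constant [psi T]. *)

Lemma minimal_set (T : Type) (P : set (set T)) :
  P !=set0 ->
  (forall F : set (set T), F `<=` P -> total_on F subset -> F !=set0 ->
    P (\bigcap_(X in F) X)) ->
  exists2 A, P A & forall B, P B -> B `<=` A -> B = A.
Proof.
move=> [X0 PX0] chainP.
(* [Zorn_bigcup] yields maximal sets for unions, so it is applied to complements. The empty set is
   adjoined because it is the union of the empty chain, about which [chainP] says nothing. *)
have [|A [A0 maxA]] := @Zorn_bigcup T [set A | A = set0 \/ P (~` A)].
- move=> F FP totF.
  have [F0|nF0] := pselect (exists2 X, F X & P (~` X)); last first.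
    left; rewrite -subset0 => t [X FX Xt].
    by case: (FP _ FX) Xt => [->//|PX] _; case: nF0; exists X.
  right; rewrite setC_bigcup.
  pose F' := [set ~` X | X in F `&` [set X | P (~` X)]].
  suff -> : \bigcap_(X in F) ~` X = \bigcap_(Y in F') Y.
    apply: chainP; first by move=> _ [X [_ PX] <-].
    - move=> _ _ [X [FX _] <-] [Y [FY _] <-].
      by case: (totF _ _ FX FY) => XY; [right|left]; apply: subsetC.
    - by case: F0 => X FX PX; exists (~` X), X.
  apply/seteqP; split=> t tF.
    by move=> _ [X [FX _] <-]; exact: tF.
  move=> X FX Xt; case: (FP _ FX) => [X0'|PX]; first by rewrite X0' in Xt.
  by apply: (tF (~` X)) => //; exists X.
- have PA : P (~` A).
    apply: contrapT => nPA; case: A0 => // A0.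
    apply: (maxA (~` X0)); last by right; rewrite setCK.
    rewrite properEneq; split; last by rewrite A0.
    by apply/eqP => E; apply: nPA; rewrite E setCK.
  exists (~` A) => // B PB BA; apply/seteqP; split=> // t At.
  apply: contrapT => Bt; apply: (maxA (~` B)); last by right; rewrite setCK.
  rewrite properEneq; split; last by rewrite -[A]setCK; apply: subsetC.
  by apply/eqP => E; apply: At; rewrite E.
Qed.

Local Notation "x %:C" := (real_complex_def (Phant _) x) : complex_scope.

(** * Means and complex scalars *)

Section complex_facts.
Context (R : realType).
Implicit Types (z w : R[i]) (r : R).

Lemma complexP z w : complex.Re z = complex.Re w ->
  complex.Im z = complex.Im w ->
  z = w.
Proof. by case: z w => [a b] [c d] /= -> ->. Qed.

Lemma cReD z w : complex.Re (z + w) = complex.Re z + complex.Re w.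
Proof. by case: z w => [a b] []. Qed.
Lemma cImD z w : complex.Im (z + w) = complex.Im z + complex.Im w.
Proof. by case: z w => [a b] []. Qed.
Lemma cReN z : complex.Re (- z) = - complex.Re z. Proof. by case: z. Qed.
Lemma cImN z : complex.Im (- z) = - complex.Im z. Proof. by case: z. Qed.
Lemma cReM z w : complex.Re (z * w) =
  complex.Re z * complex.Re w - complex.Im z * complex.Im w.
Proof. by case: z w => [a b] []. Qed.
Lemma cImM z w : complex.Im (z * w) =
  complex.Re z * complex.Im w + complex.Im z * complex.Re w.
Proof. by case: z w => [a b] []. Qed.
Lemma cReJ z : complex.Re (conjc z) = complex.Re z. Proof. by case: z. Qed.
Lemma cImJ z : complex.Im (conjc z) = - complex.Im z. Proof. by case: z. Qed.
Lemma cRerC r : complex.Re (r%:C)%C = r. Proof. by []. Qed.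
Lemma cImrC r : complex.Im (r%:C)%C = 0. Proof. by []. Qed.
Lemma cRe0 : complex.Re (0 : R[i]) = 0. Proof. by []. Qed.
Lemma cIm0 : complex.Im (0 : R[i]) = 0. Proof. by []. Qed.
Lemma cRe1 : complex.Re (1 : R[i]) = 1. Proof. by []. Qed.
Lemma cIm1 : complex.Im (1 : R[i]) = 0. Proof. by []. Qed.

Definition cE := (cReD, cImD, cReN, cImN, cReM, cImM, cReJ, cImJ, cRerC, cImrC,
  (cRe0, cIm0, cRe1, cIm1)).

Lemma conjcD z w : conjc (z + w) = conjc z + conjc w.
Proof. by apply: complexP; rewrite !cE//; ring. Qed.
Lemma conjcM z w : conjc (z * w) = conjc z * conjc w.
Proof. by apply: complexP; rewrite !cE//; ring. Qed.
Lemma conjcN z : conjc (- z) = - conjc z.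
Proof. by apply: complexP; rewrite !cE. Qed.
Lemma conjc_0 : conjc (0 : R[i]) = 0.
Proof. by apply: complexP; rewrite !cE ?oppr0. Qed.
Lemma conjc_1 : conjc (1 : R[i]) = 1.
Proof. by apply: complexP; rewrite !cE ?oppr0. Qed.

Lemma cge0P z : reflect (0 <= complex.Re z /\ complex.Im z = 0) (0 <= z).
Proof.
rewrite lecE; apply: (iffP andP) => [[/eqP -> ?]//|[? ->]//].
Qed.

Lemma sqmod0 : sqmod (0 : R[i]) = 0.
Proof. by rewrite /sqmod !cE expr0n addr0. Qed.
Lemma sqmod1 : sqmod (1 : R[i]) = 1.
Proof. by rewrite /sqmod !cE expr0n expr1n addr0. Qed.
Lemma sqmod_real r : sqmod (r%:C)%C = r ^+ 2.
Proof. by rewrite /sqmod !cE expr0n addr0. Qed.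
Lemma sqmodM z w : sqmod (z * w) = sqmod z * sqmod w.
Proof. by rewrite /sqmod !cE; ring. Qed.
Lemma sqmodJ z : sqmod (conjc z) = sqmod z.
Proof. by rewrite /sqmod !cE; ring. Qed.
Lemma sqmodN z : sqmod (- z) = sqmod z.
Proof. by rewrite /sqmod !cE; ring. Qed.
Lemma sqmod_eq0 z : sqmod z = 0 -> z = 0.
Proof.
move=> /eqP; rewrite paddr_eq0 ?sqr_ge0// !sqrf_eq0 => /andP[/eqP a /eqP b].
by apply: complexP.
Qed.
Lemma mulJc z : conjc z * z = (sqmod z)%:C%C.
Proof. by apply: complexP; rewrite /sqmod !cE; ring. Qed.
Lemma sqmodD_le z w : sqmod (z + w) <= 2 * sqmod z + 2 * sqmod w.
Proof.
rewrite -subr_ge0 (_ : _ - _ = sqmod (z - w)) ?sqmod_ge0//.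
by rewrite /sqmod !cE; ring.
Qed.
Lemma sqr_Re_le z : complex.Re z ^+ 2 <= sqmod z.
Proof. by rewrite lerDl sqr_ge0. Qed.
Lemma sqr_Im_le z : complex.Im z ^+ 2 <= sqmod z.
Proof. by rewrite lerDr sqr_ge0. Qed.

Lemma complex_affine_eq0 (p q z : R[i]) : p * z = q * z -> p != q -> z = 0.
Proof.
move=> /eqP; rewrite -subr_eq0 -mulrBl mulf_eq0 subr_eq0.
by move=> /orP[/eqP-> /eqP//|/eqP].
Qed.

(** The discriminant bound behind every Cauchy-Schwarz inequality below: for inner products, sums,
    states and positive operators. No sign is assumed for [p], so degenerate forms are covered. *)
Lemma discr_le (p r : R) (q : R[i]) :
  (forall a : R[i], 0 <= p * sqmod a + 2 * complex.Re (a * q) + r) ->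
  sqmod q <= p * r.
Proof.
move=> H.
have r0 : 0 <= r by have := H 0; rewrite sqmod0 mul0r !cE; lra.
(* For [a] a real multiple of [conjc q] the product [a * q] is real, and a real quadratic polynomial
   in [t] remains. *)
have Ht t := H ((t%:C)%C * conjc q).
have {}Ht t : 0 <= p * (t ^+ 2 * sqmod q) + 2 * t * sqmod q + r.
  suff -> : p * (t ^+ 2 * sqmod q) + 2 * t * sqmod q + r =
      p * sqmod ((t%:C)%C * conjc q) +
        2 * complex.Re ((t%:C)%C * conjc q * q) + r by exact: Ht.
  by rewrite /sqmod !cE; ring.
have [q0|q0] := eqVneq (sqmod q) 0.
  rewrite q0 mulr_ge0// leNgt; apply/negP => p0.
  (* If [p < 0], then [p * s = p - r] and [s >= 1] give [p * s ^+ 2 + r <= p < 0], against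
     positivity at [s]. *)
  pose s := 1 + r * (- p)^-1.
  have s1 : 1 <= s by rewrite lerDl mulr_ge0// invr_ge0 oppr_ge0 ltW.
  have := H (s%:C)%C; rewrite (sqmod_eq0 q0) sqmod_real mulr0 !cE.
  have ps : p * s = p - r by rewrite /s; field; rewrite lt_eqF.
  have ss : 0 <= s * (s - 1) by rewrite mulr_ge0// ?subr_ge0//; lra.
  nra.
have q1 : 0 < sqmod q by rewrite lt_neqAle eq_sym q0 sqmod_ge0.
have [p0|p0] := ltP 0 p.
  have := Ht (- p^-1).
  have -> : p * ((- p^-1) ^+ 2 * sqmod q) + 2 * - p^-1 * sqmod q + r =
    r - sqmod q / p by field; rewrite gt_eqF.
  by rewrite subr_ge0 ler_pdivrMr// mulrC.
(* When [p <= 0], the value at this [t] is at most [r - 2 * (r + 1)], which is negative. *)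
have := Ht (- (r + 1) / sqmod q).
have -> : p * ((- (r + 1) / sqmod q) ^+ 2 * sqmod q) +
    2 * (- (r + 1) / sqmod q) * sqmod q + r =
  p * ((r + 1) ^+ 2 / sqmod q) - 2 * (r + 1) + r by field; rewrite gt_eqF.
have : p * ((r + 1) ^+ 2 / sqmod q) <= 0.
  by rewrite mulr_le0_ge0// divr_ge0 ?sqr_ge0// ltW.
lra.
Qed.

End complex_facts.

Section means.
Context (R : realType) (I : Type).
Local Notation C := R[i].

Definition bfun (f : I -> R) := exists B, forall i, `|f i| <= B.
Definition cbfun (f : I -> C) := exists B, forall i, sqmod (f i) <= B.

Record is_mean (nu : (I -> R) -> R) : Prop := IsMean {
  mean_lin : forall a f g, bfun f -> bfun g ->
    nu (fun i => a * f i + g i) = a * nu f + nu g;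
  mean_ge0 : forall f, bfun f -> (forall i, 0 <= f i) -> 0 <= nu f;
  mean1 : nu (fun=> 1) = 1 }.

Definition cmean (nu : (I -> R) -> R) (f : I -> C) : C :=
  (nu (fun i => complex.Re (f i)) +i* nu (fun i => complex.Im (f i)))%C.

Lemma bfun_cst r : bfun (fun=> r).
Proof. by exists `|r|. Qed.

Lemma bfun_lin a f g : bfun f -> bfun g -> bfun (fun i => a * f i + g i).
Proof.
move=> [A Af] [B Bg]; exists (`|a| * A + B) => i.
by rewrite (le_trans (ler_normD _ _))// lerD// normrM ler_wpM2l.
Qed.

Lemma bfunM f g : bfun f -> bfun g -> bfun (fun i => f i * g i).
Proof.
by move=> [A Af] [B Bg]; exists (A * B) => i; rewrite normrM ler_pM.
Qed.

Lemma sqr_le_abs (x b : R) : x ^+ 2 <= b -> `|x| <= b + 1.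
Proof. by move=> xb; rewrite ler_norml; apply/andP; split; nra. Qed.

Lemma bfun_Re f : cbfun f -> bfun (fun i => complex.Re (f i)).
Proof.
move=> [B Bf]; exists (B + 1) => i; apply: sqr_le_abs.
exact: le_trans (sqr_Re_le _) (Bf i).
Qed.

Lemma bfun_Im f : cbfun f -> bfun (fun i => complex.Im (f i)).
Proof.
move=> [B Bf]; exists (B + 1) => i; apply: sqr_le_abs.
exact: le_trans (sqr_Im_le _) (Bf i).
Qed.

Lemma cbfun_real f : bfun f -> cbfun (fun i => (f i)%:C)%C.
Proof.
move=> [B Bf]; exists (B ^+ 2) => i; rewrite sqmod_real.
by have := Bf i; rewrite ler_norml => /andP[]; nra.
Qed.

Lemma cbfun_cst z : cbfun (fun=> z).
Proof. by exists (sqmod z). Qed.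

Lemma cbfunD f g : cbfun f -> cbfun g -> cbfun (fun i => f i + g i).
Proof.
move=> [A Af] [B Bg]; exists (2 * A + 2 * B) => i.
by rewrite (le_trans (sqmodD_le _ _))// lerD// ler_wpM2l.
Qed.

Lemma cbfunM f g : cbfun f -> cbfun g -> cbfun (fun i => f i * g i).
Proof.
by move=> [A Af] [B Bg]; exists (A * B) => i; rewrite sqmodM ler_pM ?sqmod_ge0.
Qed.

Lemma cbfunZ a f : cbfun f -> cbfun (fun i => a * f i).
Proof. by move=> bf; apply: cbfunM => //; exact: cbfun_cst. Qed.

Lemma cbfunJ f : cbfun f -> cbfun (fun i => conjc (f i)).
Proof. by move=> [B Bf]; exists B => i; rewrite sqmodJ. Qed.

Variables (nu : (I -> R) -> R) (nuP : is_mean nu).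

Lemma mean0 : nu (fun=> 0) = 0.
Proof.
have := mean_lin nuP (- 1) (bfun_cst 0) (bfun_cst 0).
rewrite (_ : (fun=> _) = (fun=> 0)); last by apply/funext => i; ring.
by move=> ->; ring.
Qed.

Lemma meanZ a f : bfun f -> nu (fun i => a * f i) = a * nu f.
Proof.
move=> bf; have := mean_lin nuP a bf (bfun_cst 0); rewrite mean0 addr0 => <-.
by congr nu; apply/funext => i; rewrite addr0.
Qed.

Lemma meanD f g : bfun f -> bfun g -> nu (fun i => f i + g i) = nu f + nu g.
Proof.
move=> bf bg; have := mean_lin nuP 1 bf bg; rewrite mul1r => <-.
by congr nu; apply/funext => i; rewrite mul1r.
Qed.

Lemma mean_cst r : nu (fun=> r) = r.
Proof.
transitivity (nu (fun=> r * 1)); first by congr nu; apply/funext => i;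
  rewrite mulr1.
by rewrite meanZ ?(mean1 nuP) ?mulr1//; exact: bfun_cst.
Qed.

Lemma mean_le f g : bfun f -> bfun g -> (forall i, f i <= g i) -> nu f <= nu g.
Proof.
move=> bf bg fg; rewrite -subr_ge0.
have -> : nu g - nu f = nu (fun i => -1 * f i + g i).
  by rewrite (mean_lin nuP)//; ring.
apply: (mean_ge0 nuP); first exact: bfun_lin.
by move=> i; have := fg i; lra.
Qed.

Lemma cmean_lin a f g : cbfun f -> cbfun g ->
  cmean nu (fun i => a * f i + g i) = a * cmean nu f + cmean nu g.
Proof.
move=> bf bg; have [rf imf] := (bfun_Re bf, bfun_Im bf).
have [rg img] := (bfun_Re bg, bfun_Im bg).
apply: complexP; rewrite !cE /=.
- rewrite -addrA -mulNr -[X in _ = _ + X](mean_lin nuP)// -(mean_lin nuP)//.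
    by congr nu; apply/funext => i; rewrite !cE; ring.
  exact: bfun_lin.
- rewrite -addrA -[X in _ = _ + X](mean_lin nuP)// -(mean_lin nuP)//.
    by congr nu; apply/funext => i; rewrite !cE; ring.
  exact: bfun_lin.
Qed.

Lemma cmean_cst z : cmean nu (fun=> z) = z.
Proof. by apply: complexP; rewrite /= mean_cst. Qed.

Lemma cmeanZ a f : cbfun f -> cmean nu (fun i => a * f i) = a * cmean nu f.
Proof.
move=> bf; have := cmean_lin a bf (cbfun_cst 0).
by rewrite cmean_cst addr0 => <-; congr cmean; apply/funext => i; rewrite addr0.
Qed.

Lemma cmeanD f g : cbfun f -> cbfun g ->
  cmean nu (fun i => f i + g i) = cmean nu f + cmean nu g.
Proof.
move=> bf bg; have := cmean_lin 1 bf bg.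
by rewrite mul1r => <-; congr cmean; apply/funext => i; rewrite mul1r.
Qed.

Lemma cmeanB f g : cbfun f -> cbfun g ->
  cmean nu (fun i => f i - g i) = cmean nu f - cmean nu g.
Proof.
move=> bf bg; rewrite addrC -mulN1r -cmean_lin//.
by congr cmean; apply/funext => i; ring.
Qed.

Lemma cmeanJ f : cbfun f ->
  cmean nu (fun i => conjc (f i)) = conjc (cmean nu f).
Proof.
move=> bf; apply: complexP => /=.
  by congr nu; apply/funext => i; rewrite !cE.
rewrite -mulN1r -meanZ; last exact: bfun_Im.
by congr nu; apply/funext => i; rewrite !cE mulN1r.
Qed.

Lemma cmean_ge0 f : cbfun f -> (forall i, 0 <= f i) -> 0 <= cmean nu f.
Proof.
move=> bf f0; apply/cge0P => /=; split.
  by apply: (mean_ge0 nuP); [exact: bfun_Re|move=> i; case/cge0P: (f0 i)].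
rewrite -[RHS]mean0; congr nu; apply/funext => i.
by case/cge0P: (f0 i).
Qed.

(** Positivity of the variance, the mean of [(f - nu f) ^+ 2]. *)
Lemma mean_sqr_le f : bfun f -> nu f ^+ 2 <= nu (fun i => f i ^+ 2).
Proof.
move=> bf; have bff : bfun (fun i => f i * f i) by exact: bfunM.
have := mean_ge0 nuP (f := fun i => (- 2 * nu f) * f i +
  (f i * f i + nu f * nu f)).
have bc := bfun_lin 1 bff (bfun_cst (nu f * nu f)).
have {}bc : bfun (fun i => f i * f i + nu f * nu f).
  by under eq_fun do rewrite -[f _ * f _]mul1r.
rewrite (mean_lin nuP)// meanD//; last exact: bfun_cst.
rewrite mean_cst => H.
suff : 0 <= - 2 * nu f * nu f + (nu (fun i => f i ^+ 2) + nu f * nu f) by nra.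
apply: H; first exact: bfun_lin.
by move=> i; have := sqr_ge0 (f i - nu f); nra.
Qed.

Lemma cmean_sqmod f B : (forall i, sqmod (f i) <= B) -> sqmod (cmean nu f) <= B.
Proof.
move=> fB; have bf : cbfun f by exists B.
have [rf imf] := (bfun_Re bf, bfun_Im bf).
apply: le_trans (lerD (mean_sqr_le rf) (mean_sqr_le imf)) _ => /=.
have brf := bfunM rf rf; have bimf := bfunM imf imf.
rewrite -meanD// -[leRHS]mean_cst; apply: mean_le => //.
- by under eq_fun do rewrite -[_ ^+ 2]mul1r; exact: bfun_lin.
- exact: bfun_cst.
Qed.

End means.
Arguments bfun_cst {R I} r.
Arguments cbfun_cst {R I} z.

Section filter_means.
Context (R : realType) (I : Type).

(** The limit along an ultrafilter refining [F]. It exists for bounded functions because they take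
    values in a compact interval. *)
Lemma filter_mean (F : set_system I) : ProperFilter F ->
  exists2 nu : (I -> R) -> R, is_mean nu &
    forall A f g, F A -> (forall i, A i -> f i = g i) -> nu f = nu g.
Proof.
move=> FF; have [U [UU FU]] := ultraFilterLemma FF.
have PU : ProperFilter U by exact: ultra_proper.
pose nu (f : I -> R) : R := lim (f @ U).
have cvgU (f : I -> R) : bfun f -> f @ U --> nu f.
  move=> [B Bf]; apply/cvg_ex.
  have [|l [_ fl]] := @segment_compact R (- B) B (f @ U) _.
    apply: (@filterE _ U) => i; rewrite /= in_itv/= -ler_norml.
    exact: Bf.
  exists l => V Vl; have [//|UnV] := in_ultra_setVsetC (f @^-1` V) UU.
  by have [? []] := fl (~` V) V UnV Vl.
exists nu; last first.
  move=> A f g FA fg; rewrite /nu; congr (lim _).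
  apply/seteqP; split=> X; rewrite /fmap/= => h.
    by apply: filterS2 h (FU _ FA) => i /= Xi Ai; rewrite -fg.
  by apply: filterS2 h (FU _ FA) => i /= Xi Ai; rewrite fg.
split=> [a f g bf bg|f bf f0|].
- apply/cvg_lim => //; apply: cvgD; last exact: cvgU.
  by apply: cvgM; [exact: cvg_cst|exact: cvgU].
- apply: (limr_ge (cvgP _ (cvgU _ bf))); exact: filterE.
- by apply/cvg_lim => //; exact: cvg_cst.
Qed.

End filter_means.

Section nat_mean.
Context (R : realType).

(** A generalised limit. It has a value at every bounded sequence, so neither Cauchy sequences nor
    subsequences are needed to produce vectors and operators. *)
Definition mean_at_oo (nu : (nat -> R) -> R) : Prop := is_mean nu /\
  forall n f g, (forall k, (n <= k)%N -> f k = g k) -> nu f = nu g.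

Lemma exists_mean_at_oo : exists nu, mean_at_oo nu.
Proof.
have [nu nuP nuF] := filter_mean R (F := \oo) _.
exists nu; split=> // n f g fg; apply: (nuF [set k | (n <= k)%N]) => //.
exact: nbhs_infty_ge.
Qed.

Lemma mean_at_oo_vanish nu (f : nat -> R[i]) B : mean_at_oo nu ->
  (forall n, sqmod (f n) <= B / n.+1%:R) -> cmean nu f = 0.
Proof.
move=> [nuP nuF] fB; apply: sqmod_eq0; apply/eqP.
rewrite eq_le sqmod_ge0 andbT; apply/ler_addgt0Pl => e e0; rewrite addr0.
have B0 : 0 <= B by have := fB 0%N; rewrite divr1; apply: le_trans;
  exact: sqmod_ge0.
pose n := Num.truncn (B / e).
pose g k := if (n <= k)%N then f k else 0.
have -> : cmean nu f = cmean nu g.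
  by rewrite /cmean; congr (_ +i* _)%C; apply: (nuF n) => k nk; rewrite /g nk.
apply: cmean_sqmod => // k; rewrite /g; case: ifP => nk; last
  by rewrite sqmod0 ltW.
apply: le_trans (fB k) _; rewrite ler_pdivrMr ?ltr0n//.
rewrite mulrC -ler_pdivrMr//; apply: le_trans (ltW (truncnS_gt _)) _.
by rewrite ler_nat ltnS.
Qed.

End nat_mean.

(** * Abstract Hilbert spaces *)

Section linear_maps.
Context (R : realType) (V W : lmodType R[i]) (T : V -> W).
Hypothesis linT : linear T.

Lemma lin_0 : T 0 = 0.
Proof. by have := linT (-1) 0 0; rewrite scaler0 addr0 scaleN1r addNr. Qed.
Lemma lin_D x y : T (x + y) = T x + T y.
Proof. by have := linT 1 x y; rewrite !scale1r. Qed.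
Lemma lin_Z a x : T (a *: x) = a *: T x.
Proof. by have := linT a x 0; rewrite lin_0 !addr0. Qed.
Lemma lin_N x : T (- x) = - T x.
Proof. by rewrite -scaleN1r lin_Z scaleN1r. Qed.
Lemma lin_B x y : T (x - y) = T x - T y.
Proof. by rewrite lin_D lin_N. Qed.
Lemma lin_sum I (r : seq I) P (f : I -> V) :
  T (\sum_(i <- r | P i) f i) = \sum_(i <- r | P i) T (f i).
Proof. by apply: (big_morph T); [exact: lin_D|exact: lin_0]. Qed.

End linear_maps.

Section hilbert.
Context (R : realType) (V : lmodType R[i]) (dot : V -> V -> R[i]).
Implicit Types (x y z : V) (a : R[i]) (A : set V).

Local Notation n2 x := (complex.Re (dot x x)).

(** Completeness takes the form of the Riesz representation property [riesz], the form in which it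
    is used; this passes to finite direct sums coordinate by coordinate. *)
Record hilbert : Prop := Hilbert {
  dot_linl : forall a x y z, dot (a *: x + y) z = a * dot x z + dot y z;
  dotC : forall x y, dot x y = conjc (dot y x);
  dot_ge0 : forall x, 0 <= dot x x;
  dot_eq0 : forall x, dot x x = 0 -> x = 0;
  riesz : forall l : V -> R[i],
    (forall a x y, l (a *: x + y) = a * l x + l y) ->
    (exists B, forall x, sqmod (l x) <= B * n2 x) ->
    exists y, forall x, l x = dot x y }.

Hypothesis H : hilbert.

Lemma dot0l z : dot 0 z = 0.
Proof.
have := dot_linl H (-1) 0 0 z; rewrite scaler0 addr0 => ->; ring.
Qed.
Lemma dotDl x y z : dot (x + y) z = dot x z + dot y z.
Proof. by have := dot_linl H 1 x y z; rewrite scale1r mul1r. Qed.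
Lemma dotZl a x z : dot (a *: x) z = a * dot x z.
Proof. by have := dot_linl H a x 0 z; rewrite addr0 dot0l addr0. Qed.
Lemma dotNl x z : dot (- x) z = - dot x z.
Proof. by rewrite -scaleN1r dotZl mulN1r. Qed.
Lemma dotBl x y z : dot (x - y) z = dot x z - dot y z.
Proof. by rewrite dotDl dotNl. Qed.
Lemma dot0r z : dot z 0 = 0.
Proof. by rewrite (dotC H) dot0l conjc_0. Qed.
Lemma dotDr x y z : dot z (x + y) = dot z x + dot z y.
Proof. by rewrite (dotC H) dotDl conjcD -!(dotC H). Qed.
Lemma dotZr a x z : dot z (a *: x) = conjc a * dot z x.
Proof. by rewrite (dotC H) dotZl conjcM -(dotC H). Qed.
Lemma dotNr x z : dot z (- x) = - dot z x.
Proof. by rewrite (dotC H) dotNl conjcN -(dotC H). Qed.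
Lemma dotBr x y z : dot z (x - y) = dot z x - dot z y.
Proof. by rewrite dotDr dotNr. Qed.
Lemma n2_ge0 x : 0 <= n2 x.
Proof. by case/cge0P: (dot_ge0 H x). Qed.
Lemma dotxx x : dot x x = (n2 x)%:C%C.
Proof. by apply: complexP => //=; case/cge0P: (dot_ge0 H x). Qed.
Lemma n2_eq0 x : n2 x = 0 -> x = 0.
Proof. by move=> x0; apply: (dot_eq0 H); rewrite dotxx x0. Qed.
Lemma n2Z a x : n2 (a *: x) = sqmod a * n2 x.
Proof. by rewrite dotZl dotZr dotxx /sqmod !cE; ring. Qed.
Lemma n2N x : n2 (- x) = n2 x.
Proof. by rewrite dotNl dotNr opprK. Qed.
Lemma ReC x y : complex.Re (dot y x) = complex.Re (dot x y).
Proof. by rewrite (dotC H) cE. Qed.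
Lemma n2D x y : n2 (x + y) = n2 x + 2 * complex.Re (dot x y) + n2 y.
Proof. by rewrite dotDl !dotDr !cE (ReC x y); ring. Qed.
Lemma n2D_le x y : n2 (x + y) <= 2 * n2 x + 2 * n2 y.
Proof.
have := n2_ge0 (x - y); rewrite !n2D n2N dotNr cReN; lra.
Qed.
Lemma n2B_le x y : n2 (x - y) <= 2 * n2 x + 2 * n2 y.
Proof. by rewrite -(n2N y) n2D_le. Qed.

Lemma cauchy_schwarz x y : sqmod (dot x y) <= n2 x * n2 y.
Proof.
apply: discr_le => a; have := n2_ge0 (a *: x + y).
by rewrite n2D n2Z dotZl [sqmod a * _]mulrC.
Qed.

Lemma dot_extr x y : (forall z, dot z x = dot z y) -> x = y.
Proof.
move=> xy; apply/eqP; rewrite -subr_eq0; apply/eqP/(dot_eq0 H).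
by rewrite dotBr xy subrr.
Qed.
Lemma dot_extl x y : (forall z, dot x z = dot y z) -> x = y.
Proof.
by move=> xy; apply: dot_extr => z; rewrite (dotC H) xy -(dotC H).
Qed.

Lemma weak_limit I nu (x : I -> V) B : is_mean nu ->
  (forall i, n2 (x i) <= B) ->
  exists2 y, (forall z, dot z y = cmean nu (fun i => dot z (x i))) & n2 y <= B.
Proof.
move=> nuP xB.
have bd z i : sqmod (dot z (x i)) <= B * n2 z.
  rewrite mulrC (le_trans (cauchy_schwarz _ _))// ler_wpM2l ?n2_ge0//.
have [||y yP] := riesz H (l := fun z => cmean nu (fun i => dot z (x i))).
- move=> a u v; rewrite -(cmean_lin nuP); last 2 first.
    by exists (B * n2 u).
    by exists (B * n2 v).
  by congr cmean; apply/funext => i; rewrite (dot_linl H).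
- by exists B => z; apply: (cmean_sqmod nuP).
exists y => //; have := cmean_sqmod nuP (bd y); rewrite yP => yB.
have {yB} : n2 y ^+ 2 <= B * n2 y by rewrite -sqmod_real -dotxx.
have := n2_ge0 y; rewrite le_eqVlt => /orP[/eqP y0 _|y0]; last first.
  by rewrite expr2 ler_pM2r.
(* If [n2 y = 0] the claim is [0 <= B], which needs an index [i]; an empty index set carries no
   mean, since there the constants 0 and 1 coincide. *)
have [[i _]|noI] := pselect (exists i : I, True).
  by rewrite -y0; exact: le_trans (n2_ge0 (x i)) (xB i).
have := mean1 nuP; rewrite (_ : (fun=> 1) = (fun=> 0)).
  by rewrite (mean0 nuP) => /eqP; rewrite eq_sym oner_eq0.
by apply/funext => i; case: noI; exists i.
Qed.

(** For a subspace [A], [orth (orth A)] stands for the closure of [A]; [dense_orth_orth] recovers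
    the approximation. *)
Definition orth A : set V := [set y | forall x, A x -> dot x y = 0].
Definition subspace A := A 0 /\ forall a x y, A x -> A y -> A (a *: x + y).

Section projection.
Variables (A : set V) (subA : subspace A).

Lemma subspaceZ a x : A x -> A (a *: x).
Proof. by case: subA => A0 AD Ax; rewrite -[_ *: _]addr0; apply: AD. Qed.

Lemma subspaceD x y : A x -> A y -> A (x + y).
Proof. by case: subA => A0 AD Ax Ay; rewrite -[x]scale1r; apply: AD. Qed.

Lemma orth_subspace B : subspace (orth B).
Proof.
split=> [x _|a x y xB yB z Bz]; first exact: dot0r.
by rewrite dotDr dotZr xB// yB// mulr0 addr0.
Qed.

Lemma sub_orth_orth x : A x -> orth (orth A) x.
Proof. by move=> Ax y yA; rewrite (dotC H) yA// conjc_0. Qed.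

(** The squared distance from [v] to [a n] exceeds the infimum by less than [n.+1%:R^-1], so moving
    [a n] along [b] cannot gain more than that; [discr_le] turns this into almost orthogonality of
    the residual to [b]. *)
Lemma minimizing_sequence v : exists a : nat -> V,
  [/\ forall n, A (a n), exists B, forall n, n2 (v - a n) <= B &
      forall b n, A b -> sqmod (dot b (v - a n)) <= n2 b / n.+1%:R].
Proof.
have A0 : A 0 by case: subA.
have [d [dle dinf]] : exists d, (forall b, A b -> d <= n2 (v - b)) /\
    forall e, 0 < e -> exists2 b, A b & n2 (v - b) < d + e.
  pose S := [set n2 (v - b) | b in A].
  have S0 : S !=set0 by exists (n2 (v - 0)), 0.
  have lS : lbound S 0 by move=> _ [x _ <-]; exact: n2_ge0.
  have hiS : has_inf S by split=> //; exists 0.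
  exists (inf S); split=> [b Ab|e e0]; first by apply: ge_inf;
    [exists 0|exists b].
  by have [_ [x Ax <-] xd] := inf_adherent e0 hiS; exists x.
have /choice[a aP] n : exists b, A b /\ n2 (v - b) < d + n.+1%:R^-1.
  have e0 : 0 < n.+1%:R^-1 :> R by rewrite invr_gt0 ltr0n.
  by have [b Ab bd] := dinf _ e0; exists b.
exists a; split=> [n||b n Ab]; first by case: (aP n).
  exists (d + 1) => n; case: (aP n) => _ /ltW/le_trans; apply.
  by rewrite lerD2l invf_le1 ?ltr0n// ler1n.
have [Aan an] := aP n.
apply: discr_le => c; have := dle _ (subspaceD Aan (subspaceZ (- c) Ab)).
rewrite (_ : v - (a n + - c *: b) = c *: b + (v - a n)); last first.
  by rewrite opprD scaleNr opprK addrA addrC.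
rewrite (n2D (c *: b)) n2Z dotZl [sqmod c * _]mulrC; move: an.
move: (_^-1) => W; lra.
Qed.

(** The residuals [v - a n] are not shown to converge in norm; their weak limit [u] is orthogonal to
    [A], and [p = v - u]. If [v] lies in [orth (orth A)], then [u = 0], and the mean of the squared
    norms of the residuals is [dot v u] minus the mean of [dot (a n) (v - a n)]. Both vanish, so
    some residual is small. This gives density without norm completeness. *)
Lemma projection_point v : exists p (a : nat -> V),
  [/\ orth (orth A) p, orth A (v - p), forall n, A (a n) &
    orth (orth A) v -> forall e, 0 < e -> exists n, n2 (v - a n) < e].
Proof.
have [a [aA [B aB] ao]] := minimizing_sequence v.
have [nu nuoo] := exists_mean_at_oo R; have [nuP _] := nuoo.
have [u uP _] := weak_limit nuP aB.
have uA : orth A u.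
  move=> b Ab; rewrite uP; apply: (mean_at_oo_vanish (B := n2 b) nuoo) => n.
  exact: ao.
have uu : orth (orth A) (v - u).
  move=> y yA; rewrite dotBr uP.
  rewrite (_ : (fun i => _) = (fun=> dot y v)) ?(cmean_cst nuP) ?subrr//.
  apply/funext => i; rewrite dotBr [dot y (a i)](dotC H) yA ?conjc_0 ?subr0//.
exists (v - u), a; split=> //; first by rewrite subKr.
move=> vA e e0; apply: contrapT => nex.
have u0 : u = 0.
  apply: (dot_eq0 H); have := vA u uA; have := uu u uA.
  by rewrite dotBr => /eqP; rewrite subr_eq0 => /eqP <- ->.
pose f n := dot v (v - a n); pose g n := dot (a n) (v - a n).
have bf : cbfun f.
  exists (n2 v * B) => n; rewrite (le_trans (cauchy_schwarz _ _))//.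
  by rewrite ler_wpM2l ?n2_ge0.
pose D := 2 * n2 v + 2 * B.
have aD n : n2 (a n) <= D.
  have := n2B_le v (v - a n); rewrite subKr => /le_trans; apply.
  by rewrite lerD2l ler_pM2l.
have gB n : sqmod (g n) <= D / n.+1%:R.
  by rewrite (le_trans (ao _ _ (aA n)))// ler_wpM2r// invr_ge0 ler0n.
have bg : cbfun g.
  exists D => n; rewrite (le_trans (gB n))// ler_piMr//.
    exact: le_trans (n2_ge0 _) (aD 0%N).
  by rewrite invf_le1 ?ltr0n// ler1n.
have fg : cmean nu (fun n => f n - g n) = 0.
  rewrite (cmeanB nuP)// (mean_at_oo_vanish nuoo gB) subr0.
  by rewrite /f -uP u0 dot0r.
have : e <= complex.Re (cmean nu (fun n => f n - g n)).
  rewrite /= -[leLHS](mean_cst nuP); apply: (mean_le nuP).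
  - exact: bfun_cst.
  - apply: bfun_Re; have := cbfunD bf (cbfunZ (-1) bg).
    by under eq_fun do rewrite mulN1r.
  - move=> n; rewrite /f /g -dotBl leNgt; apply/negP => lt.
    by apply: nex; exists n.
by rewrite fg cRe0 leNgt e0.
Qed.

Lemma dense_orth_orth v e : orth (orth A) v -> 0 < e ->
  exists2 b, A b & n2 (v - b) < e.
Proof.
move=> vA e0; have [p [a [_ _ aA]]] := projection_point v.
by move=> /(_ vA _ e0)[n]; exists (a n).
Qed.

Lemma orth_decomp p q : orth (orth A) p -> orth A q -> p + q = 0 -> p = 0.
Proof.
move=> pA qA /eqP; rewrite addr_eq0 => /eqP pq; apply: (dot_eq0 H).
by rewrite {1}pq dotNl pA// oppr0.
Qed.

Lemma projection_unique v p q : orth (orth A) p -> orth A (v - p) ->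
  orth (orth A) q -> orth A (v - q) -> p = q.
Proof.
move=> p1 p2 q1 q2; apply/eqP; rewrite -subr_eq0; apply/eqP.
have [_ S1] := orth_subspace A; have [_ S2] := orth_subspace (orth A).
apply: (@orth_decomp _ ((v - p) - (v - q))).
- by rewrite addrC -scaleN1r; apply: S2.
- by rewrite addrC -scaleN1r; apply: S1.
- by rewrite opprB [v - p + _]addrC !addrA subrK subrK subrr.
Qed.

Definition is_projection (P : V -> V) :=
  forall v, orth (orth A) (P v) /\ orth A (v - P v).

Lemma exists_projection : exists P, is_projection P.
Proof.
have /choice[P PP] v : exists p, orth (orth A) p /\ orth A (v - p).
  by have [p [_ [? ? _ _]]] := projection_point v; exists p.
by exists P.
Qed.

Variables (P : V -> V) (PP : is_projection P).

Lemma projection_lin : linear P.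
Proof.
move=> a x y; have [_ S1] := orth_subspace A.
have [_ S2] := orth_subspace (orth A).
have [[x1 x2] [y1 y2]] := (PP x, PP y); have [z1 z2] := PP (a *: x + y).
apply: (projection_unique z1 z2); first exact: S2.
have -> : a *: x + y - (a *: P x + P y) = a *: (x - P x) + (y - P y).
  by rewrite scalerBr opprD addrACA.
exact: S1.
Qed.

Lemma projection_id v : orth (orth A) v -> P v = v.
Proof.
move=> vA; have [p1 p2] := PP v; apply: (projection_unique p1 p2) => //.
by rewrite subrr; case: (orth_subspace A).
Qed.

Lemma projection_mem v : A v -> P v = v.
Proof. by move=> /sub_orth_orth; exact: projection_id. Qed.

Lemma projection_idem v : P (P v) = P v.
Proof. by apply: projection_id; case: (PP v). Qed.

Lemma projection_sa x y : dot (P x) y = dot x (P y).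
Proof.
have [[x1 x2] [y1 y2]] := (PP x, PP y).
have : dot (P x) (y - P y) = 0 by rewrite (dotC H) x1 ?conjc_0.
have : dot (x - P x) (P y) = 0 by rewrite y1.
by rewrite dotBr dotBl => /eqP; rewrite subr_eq0 => /eqP -> /eqP;
  rewrite subr_eq0 => /eqP.
Qed.

Lemma projection_n2 x : n2 (P x) <= n2 x.
Proof.
have [x1 x2] := PP x; have -> : n2 x = n2 ((x - P x) + P x) by rewrite subrK.
by rewrite n2D (x1 _ x2) cRe0 mulr0 addr0 lerDr n2_ge0.
Qed.

(** Invariance of [A] under [T] and its adjoint makes both [orth A] and [orth (orth A)] invariant
    under [T], so [T] maps the decomposition of [x] to that of [T x]. *)
Lemma projection_comm (T T' : V -> V) : linear T ->
  (forall x y, dot (T x) y = dot x (T' y)) ->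
  (forall x, A x -> A (T x)) -> (forall x, A x -> A (T' x)) ->
  forall x, P (T x) = T (P x).
Proof.
move=> linT adjT TA T'A x.
have TO y : orth A y -> orth A (T y).
  by move=> yA z Az; rewrite (dotC H) adjT -(dotC H) yA//; exact: T'A.
have T'O y : orth A y -> orth A (T' y).
  by move=> yA z Az; rewrite -adjT yA//; exact: TA.
have TOO y : orth (orth A) y -> orth (orth A) (T y).
  by move=> yA z Az; rewrite (dotC H) adjT -(dotC H) yA//; exact: T'O.
have [[x1 x2] [y1 y2]] := (PP x, PP (T x)).
apply: (projection_unique y1 y2); first exact: TOO.
by rewrite -lin_B//; exact: TO.
Qed.

End projection.

Lemma form_operator (q : V -> V -> R[i]) B :
  (forall a x y z, q (a *: x + y) z = a * q x z + q y z) ->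
  (forall a x y z, q z (a *: x + y) = conjc a * q z x + q z y) ->
  (forall x y, sqmod (q x y) <= B * n2 x * n2 y) ->
  exists S, [/\ linear S, forall x y, q x y = dot x (S y) &
    forall y, n2 (S y) <= B * n2 y].
Proof.
move=> ql qr qB.
have /choice[S SP] y : exists z, forall x, q x y = dot x z.
  apply: (riesz H) => [a u v|]; first exact: ql.
  by exists (B * n2 y) => x; rewrite mulrAC.
exists S; split=> [a x y|x y|y]; last 2 first.
- by rewrite SP.
- have := qB (S y) y; rewrite SP dotxx sqmod_real mulrAC.
  have := n2_ge0 (S y); rewrite le_eqVlt => /orP[/eqP <- _|y0]; last first.
    by rewrite expr2 ler_pM2r.
  (* Here [n2 (S y) = 0] and [B] has no known sign; [0 <= B * n2 y] is read off the bound on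
     [q y y]. *)
  have [y0|y0] := eqVneq (n2 y) 0; first by rewrite y0 mulr0.
  have y1 : 0 < n2 y by rewrite lt_neqAle eq_sym y0 n2_ge0.
  rewrite pmulr_lge0// -(pmulr_lge0 _ y1) -(pmulr_lge0 _ y1).
  exact: le_trans (sqmod_ge0 _) (qB y y).
- by apply: dot_extr => z; rewrite -SP qr !SP -dotZr dotDr.
Qed.

Lemma adjoint_operator (T : V -> V) B : linear T ->
  (forall x, n2 (T x) <= B * n2 x) ->
  exists S, [/\ linear S, forall x y, dot (T x) y = dot x (S y) &
    forall y, n2 (S y) <= B * n2 y].
Proof.
move=> linT TB; apply: form_operator => [a x y z|a x y z|x y].
- by rewrite linT (dot_linl H).
- by rewrite dotDr dotZr.
- by rewrite (le_trans (cauchy_schwarz _ _))// ler_wpM2r// n2_ge0.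
Qed.

End hilbert.

(** * Absolutely summable families and l^2(G) *)

Section sums.
Context (R : realType) (G : choiceType).
Implicit Types (p q : G -> R) (s : seq G).

Definition sm p := (\esum_(g in [set: G]) (p g)%:E < +oo)%E.
Definition psum p : R := fine (\esum_(g in [set: G]) (p g)%:E).

Lemma esum_bound p B : (forall s, uniq s -> \sum_(g <- s) p g <= B) ->
  (\esum_(g in [set: G]) (p g)%:E <= B%:E)%E.
Proof.
move=> pB; apply: ge_ereal_sup => _ [A [finA _] <-].
by rewrite fsbig_finite//= sumEFin lee_fin pB.
Qed.

Lemma sm_bound p B : (forall s, uniq s -> \sum_(g <- s) p g <= B) -> sm p.
Proof. by move=> /esum_bound/le_lt_trans; apply; rewrite ltry. Qed.

Lemma esum_psum p : (forall g, 0 <= p g) -> sm p ->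
  (\esum_(g in [set: G]) (p g)%:E = (psum p)%:E)%E.
Proof.
move=> p0 sp; rewrite fineK// ge0_fin_numE//.
by apply: esum_ge0 => g _; rewrite lee_fin.
Qed.

Lemma psum_bound p B : (forall g, 0 <= p g) ->
  (forall s, uniq s -> \sum_(g <- s) p g <= B) -> psum p <= B.
Proof.
move=> p0 pB; rewrite -lee_fin -esum_psum//; first exact: esum_bound.
exact: sm_bound pB.
Qed.

Lemma seq_le_psum p s : (forall g, 0 <= p g) -> sm p -> uniq s ->
  \sum_(g <- s) p g <= psum p.
Proof.
move=> p0 sp us; rewrite -lee_fin -esum_psum//; apply: ereal_sup_ubound.
by exists [set` s] => //; rewrite -fsbig_seq// sumEFin.
Qed.

Lemma psum_ge0 p : (forall g, 0 <= p g) -> 0 <= psum p.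
Proof.
by move=> p0; apply: fine_ge0; apply: esum_ge0 => g _; rewrite lee_fin.
Qed.

Lemma sm_le p q : (forall g, p g <= q g) -> sm q -> sm p.
Proof.
by move=> pq; apply: le_lt_trans; apply: le_esum => g _; rewrite lee_fin.
Qed.

Lemma psum_le p q : (forall g, 0 <= p g) -> (forall g, p g <= q g) -> sm q ->
  psum p <= psum q.
Proof.
move=> p0 pq sq; have sp := sm_le pq sq.
rewrite -lee_fin -!esum_psum//; first by apply: le_esum => g _; rewrite lee_fin.
by move=> g; exact: le_trans (p0 g) (pq g).
Qed.

Lemma le_psum p g : (forall g, 0 <= p g) -> sm p -> p g <= psum p.
Proof. by move=> p0 sp; have := seq_le_psum p0 sp (s := [:: g]) isT;
  rewrite big_seq1. Qed.

Lemma smD p q : (forall g, 0 <= p g) -> (forall g, 0 <= q g) -> sm p -> sm q ->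
  sm (fun g => p g + q g).
Proof.
move=> p0 q0 sp sq; rewrite /sm.
under eq_esum do rewrite EFinD.
by rewrite esumD ?lte_add_pinfty// => g _; rewrite lee_fin.
Qed.

Lemma psumD p q : (forall g, 0 <= p g) -> (forall g, 0 <= q g) -> sm p ->
  sm q ->
  psum (fun g => p g + q g) = psum p + psum q.
Proof.
move=> p0 q0 sp sq; apply: EFin_inj; rewrite EFinD -!esum_psum//.
- by rewrite -esumD// => g _; rewrite lee_fin.
- by move=> g; rewrite addr_ge0.
- exact: smD.
Qed.

Lemma smZ k p : (forall g, 0 <= p g) -> 0 <= k -> sm p -> sm (fun g => k * p g).
Proof.
move=> p0 k0 sp; apply: (sm_bound (B := k * psum p)) => s us.
by rewrite -mulr_sumr ler_wpM2l// seq_le_psum.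
Qed.

Lemma psumZ k p : (forall g, 0 <= p g) -> 0 <= k -> sm p ->
  psum (fun g => k * p g) = k * psum p.
Proof.
move=> p0; rewrite le_eqVlt => /orP[/eqP <- _|k0 sp].
  rewrite mul0r; apply/eqP; rewrite eq_le psum_ge0 ?andbT; last first.
    by move=> g; rewrite mul0r.
  apply: psum_bound => [g|s _]; first by rewrite mul0r.
  by rewrite big1// => g _; rewrite mul0r.
have kp0 g : 0 <= k * p g by rewrite mulr_ge0// ltW.
apply/eqP; rewrite eq_le; apply/andP; split.
  by apply: psum_bound => // s us; rewrite -mulr_sumr ler_pM2l// seq_le_psum.
rewrite -ler_pdivlMl//; apply: psum_bound => // s us.
rewrite ler_pdivlMl// mulr_sumr; apply: seq_le_psum => //.
exact: smZ (ltW k0) sp.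
Qed.

Lemma psum_supp p s : (forall g, 0 <= p g) -> uniq s ->
  (forall g, g \notin s -> p g = 0) -> sm p /\ psum p = \sum_(g <- s) p g.
Proof.
move=> p0 us ps.
have ub t : uniq t -> \sum_(g <- t) p g <= \sum_(g <- s) p g.
  move=> ut; rewrite (bigID (mem s)) /= [X in _ + X]big1 ?addr0; last first.
    by move=> g /ps.
  rewrite -big_filter; apply: le_trans (_ : \sum_(g <- [seq g <- s | g \in t]) p
    g <= _).
    rewrite (perm_big [seq g <- s | g \in t]) //=.
    apply: uniq_perm; rewrite ?filter_uniq// => g.
    by rewrite !mem_filter andbC.
  by rewrite big_filter [leRHS](bigID (mem t))/= lerDl sumr_ge0.
have sp := sm_bound ub; split=> //; apply/eqP; rewrite eq_le.
by rewrite psum_bound//= seq_le_psum.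
Qed.

Lemma psum0 : psum (fun=> 0) = 0.
Proof.
have [_ ->] := psum_supp (p := fun=> 0) (s := [::]) (fun=> lexx 0) isT
  (fun _ _ => erefl).
by rewrite big_nil.
Qed.

Lemma sm0 : sm (fun=> 0).
Proof.
by have [] := psum_supp (p := fun=> 0) (s := [::]) (fun=> lexx 0) isT
  (fun _ _ => erefl).
Qed.

Lemma psum_approx p e : (forall g, 0 <= p g) -> sm p -> 0 < e ->
  exists2 s, uniq s & psum (fun g => if g \in s then 0 else p g) < e.
Proof.
move=> p0 sp e0.
have [s us sP] : exists2 s, uniq s & psum p - e / 2 <= \sum_(g <- s) p g.
  apply: contrapT => nP; have : psum p <= psum p - e / 2; last lra.
  apply: psum_bound => // s us; rewrite leNgt; apply/negP => lt; apply: nP.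
  by exists s => //; exact: ltW.
exists s => //.
have s1 g : 0 <= (if g \in s then p g else 0) by case: ifP.
have s2 g : 0 <= (if g \in s then 0 else p g) by case: ifP.
have [|sm1 e1] := psum_supp s1 us; first by move=> g /negPf ->.
have sm2 : sm (fun g => if g \in s then 0 else p g).
  by apply: sm_le sp => g; case: ifP.
have E : psum p = psum (fun g => if g \in s then p g else 0) +
    psum (fun g => if g \in s then 0 else p g).
  rewrite -psumD//; congr psum; apply/funext => g.
  by case: ifP; rewrite ?addr0 ?add0r.
have E2 : \sum_(g <- s) (if g \in s then p g else 0) = \sum_(g <- s) p g.
  by rewrite [LHS]big_seq [RHS]big_seq; apply: eq_bigr => g ->.
by move: sP; rewrite E e1 E2; lra.
Qed.

Lemma psum_eq0 p g : (forall g, 0 <= p g) -> sm p -> psum p = 0 -> p g = 0.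
Proof. by move=> p0 sp e; apply/eqP; rewrite eq_le p0 -e le_psum. Qed.

Lemma psum_bij (e e' : G -> G) p : cancel e e' -> cancel e' e ->
  (forall g, 0 <= p g) -> psum (fun g => p (e g)) = psum p.
Proof.
move=> ee' e'e p0; rewrite /psum; congr fine.
rewrite [RHS](reindex_esum [set: G] [set: G] e)//.
split=> // [g h _ _ /=|g _]; first exact: (can_inj ee').
by exists (e' g).
Qed.

End sums.

Section signed_sums.
Context (R : realType) (G : groupType).
Local Notation C := R[i].

(** Any splitting into summable nonnegative families computes [rsum], not only the one into positive
    and negative parts; linearity of the signed sum follows from that of [psum]. *)
Lemma rsum_split (f p q : G -> R) : (forall g, 0 <= p g) ->
  (forall g, 0 <= q g) ->
  sm p -> sm q -> (forall g, f g = p g - q g) -> rsum f = psum p - psum q.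
Proof.
move=> p0 q0 sp sq fE.
pose u g := Num.max (f g) 0; pose v g := Num.max (- f g) 0.
have u0 g : 0 <= u g by rewrite le_max lexx orbT.
have v0 g : 0 <= v g by rewrite le_max lexx orbT.
have su : sm u.
  by apply: sm_le sp => g; rewrite ge_max p0 andbT fE lerBlDr lerDl.
have sv : sm v.
  by apply: sm_le sq => g; rewrite ge_max q0 andbT fE opprB lerBlDr lerDl.
have E : psum u + psum q = psum v + psum p.
  rewrite -!psumD//; congr psum; apply/funext => g.
  rewrite /u /v; have [f0|f0] := leP 0 (f g).
    by rewrite max_r ?oppr_le0// fE; ring.
  by rewrite max_l ?oppr_ge0 ?ltW// fE; ring.
by rewrite /rsum -/(psum u) -/(psum v); lra.
Qed.

Definition asm (f : G -> R) := sm (fun g => `|f g|).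

Lemma asm_split f : asm f -> exists p q, [/\ (forall g, 0 <= p g),
  (forall g, 0 <= q g), sm p, sm q & (forall g, f g = p g - q g)].
Proof.
move=> sf; exists (fun g => Num.max (f g) 0), (fun g => Num.max (- f g) 0).
split=> [g|g|||g]; rewrite ?le_max ?lexx ?orbT//.
- by apply: sm_le sf => g; rewrite ge_max ler_norm normr_ge0.
- by apply: sm_le sf => g; rewrite ge_max -normrN ler_norm normr_ge0.
- have [f0|f0] := leP 0 (f g); first by rewrite max_r ?oppr_le0// subr0.
  by rewrite max_l ?oppr_ge0 ?ltW// sub0r opprK.
Qed.

Lemma rsum_ge0 (f : G -> R) : (forall g, 0 <= f g) -> sm f -> rsum f = psum f.
Proof.
move=> f0 sf; rewrite (@rsum_split f f (fun=> 0)) ?psum0 ?subr0//.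
- exact: sm0.
- by move=> g; rewrite subr0.
Qed.

Lemma rsumD (f g : G -> R) : asm f -> asm g -> rsum (fun i => f i + g i) =
  rsum f + rsum g.
Proof.
move=> /asm_split[p [q [p0 q0 sp sq fE]]]
  /asm_split[p' [q' [p0' q0' sp' sq' gE]]].
rewrite (rsum_split p0 q0 sp sq fE) (rsum_split p0' q0' sp' sq' gE).
rewrite (@rsum_split _ (fun i => p i + p' i) (fun i => q i + q' i)).
- by rewrite !psumD//; ring.
- by move=> i; rewrite addr_ge0.
- by move=> i; rewrite addr_ge0.
- exact: smD.
- exact: smD.
- by move=> i; rewrite fE gE; ring.
Qed.

Lemma rsumN (f : G -> R) : rsum (fun i => - f i) = - rsum f.
Proof.
rewrite /rsum opprB; congr (_ - _).
by congr fine; apply: eq_esum => g _; rewrite opprK.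
Qed.

Lemma rsumZ a (f : G -> R) : asm f -> rsum (fun i => a * f i) = a * rsum f.
Proof.
wlog a0 : a / 0 <= a => [hw sf|].
  have [a0|a0] := leP 0 a; first exact: hw.
  rewrite -[RHS]opprK -mulNr -hw ?oppr_ge0 ?ltW// -rsumN.
  by congr rsum; apply/funext => i; rewrite mulNr opprK.
move=> /asm_split[p [q [p0 q0 sp sq fE]]].
rewrite (rsum_split p0 q0 sp sq fE).
rewrite (@rsum_split _ (fun i => a * p i) (fun i => a * q i)).
- by rewrite !psumZ//; ring.
- by move=> i; rewrite mulr_ge0.
- by move=> i; rewrite mulr_ge0.
- exact: smZ.
- exact: smZ.
- by move=> i; rewrite fE mulrBr.
Qed.

Lemma asmD (f g : G -> R) : asm f -> asm g -> asm (fun i => f i + g i).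
Proof.
move=> sf sg; apply: sm_le (smD _ _ sf sg) => i //=; exact: ler_normD.
Qed.

Lemma asmZ a (f : G -> R) : asm f -> asm (fun i => a * f i).
Proof.
move=> sf; apply: sm_le (smZ _ (normr_ge0 a) sf) => i //=.
by rewrite normrM.
Qed.

Definition csm (f : G -> C) :=
  asm (fun g => complex.Re (f g)) /\ asm (fun g => complex.Im (f g)).

Lemma csm_lin a (f g : G -> C) : csm f -> csm g -> csm (fun i => a * f i + g i).
Proof.
move=> [f1 f2] [g1 g2]; split.
- under eq_fun do rewrite !cE -addrA -mulNr.
  by apply: asmD; [|apply: asmD => //]; exact: asmZ.
- under eq_fun do rewrite !cE -addrA.
  by apply: asmD; [|apply: asmD => //]; exact: asmZ.
Qed.

Lemma Re_csum (f : G -> C) : complex.Re (csum f) =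
  rsum (fun g => complex.Re (f g)).
Proof. by []. Qed.
Lemma Im_csum (f : G -> C) : complex.Im (csum f) =
  rsum (fun g => complex.Im (f g)).
Proof. by []. Qed.

Lemma csum_lin a (f g : G -> C) : csm f -> csm g ->
  csum (fun i => a * f i + g i) = a * csum f + csum g.
Proof.
move=> [f1 f2] [g1 g2]; apply: complexP.
- rewrite [LHS]Re_csum cReD cReM !Re_csum !Im_csum;
  transitivity (rsum (fun i => complex.Re a * complex.Re (f i) +
      (- complex.Im a * complex.Im (f i) + complex.Re (g i)))).
    by congr rsum; apply/funext => i; rewrite !cE; ring.
  have := asmZ (complex.Re a) f1; have := asmZ (- complex.Im a) f2.
  move=> h1 h2; have := asmD h1 g1 => h3.
  by rewrite rsumD// rsumD// !rsumZ//; ring.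
- rewrite [LHS]Im_csum cImD cImM !Re_csum !Im_csum;
  transitivity (rsum (fun i => complex.Re a * complex.Im (f i) +
      (complex.Im a * complex.Re (f i) + complex.Im (g i)))).
    by congr rsum; apply/funext => i; rewrite !cE; ring.
  have := asmZ (complex.Re a) f2; have := asmZ (complex.Im a) f1.
  move=> h1 h2; have := asmD h1 g2 => h3.
  by rewrite rsumD// rsumD// !rsumZ//; ring.
Qed.

Lemma csumJ (f : G -> C) : csum (fun i => conjc (f i)) = conjc (csum f).
Proof.
apply: complexP; rewrite (cReJ, cImJ) ?Re_csum ?Im_csum -?rsumN; congr rsum;
by apply/funext => i; rewrite (cReJ, cImJ).
Qed.

Lemma csum_real (p : G -> R) : (forall g, 0 <= p g) -> sm p ->
  csum (fun g => (p g)%:C%C) = (psum p)%:C%C.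
Proof.
move=> p0 sp; apply: complexP; rewrite ?Re_csum ?Im_csum; first exact: rsum_ge0.
by rewrite rsum_ge0 ?psum0//; exact: sm0.
Qed.

Lemma csum_re (f : G -> C) : (forall g, 0 <= complex.Re (f g)) ->
  csm f -> complex.Re (csum f) = psum (fun g => complex.Re (f g)).
Proof.
move=> f0 [fs _]; rewrite Re_csum rsum_ge0//.
by apply: sm_le fs => g; exact: ler_norm.
Qed.

(** For each [a] the family [sqmod a * p + 2 * Re (a * f) + r] is pointwise nonnegative; its sum is
    the quadratic expression fed to [discr_le]. It serves for inner products, with [p] and [r]
    squared coordinates, and for sums of inner products over a family of operators, with [p] and [r]
    squared norms. *)
Lemma csum_cauchy_schwarz (p r : G -> R) (f : G -> C) :
  (forall g, 0 <= p g) -> (forall g, 0 <= r g) -> sm p -> sm r ->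
  (forall g, sqmod (f g) <= p g * r g) ->
  csm f /\ sqmod (csum f) <= psum p * psum r.
Proof.
move=> p0 r0 sp sr fpr.
have sf : csm f.
  split; apply: sm_le (smD p0 r0 sp sr) => g /=.
    have := le_trans (sqr_Re_le (f g)) (fpr g); have := p0 g; have := r0 g.
    by rewrite ler_norml => ? ? ?; apply/andP; split; nra.
  have := le_trans (sqr_Im_le (f g)) (fpr g); have := p0 g; have := r0 g.
  by rewrite ler_norml => ? ? ?; apply/andP; split; nra.
split=> //; apply: discr_le => a.
have saf : csm (fun g => a * f g).
  have : csm (fun=> 0) by split; apply: sm_le (@sm0 R G) => g; rewrite normr0.
  by move=> /(csm_lin a sf); under eq_fun do rewrite addr0.
have -> : a * csum f = csum (fun g => a * f g).
  have s0 : csm (fun=> 0) by split; apply: sm_le (@sm0 R G) => g;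
    rewrite normr0.
  have := csum_lin a sf s0.
  rewrite [csum (fun=> 0)](csum_real (p := fun=> 0)) ?psum0;
    [|by []|exact: sm0].
  rewrite addr0 => <-; congr csum; apply/funext => g.
  by rewrite addr0.
have -> : complex.Re (csum (fun g => a * f g)) =
  rsum (fun g => complex.Re (a * f g)).
  by [].
have h1 : asm (fun g => 2 * complex.Re (a * f g)) by apply: asmZ; case: saf.
have h2 : asm (fun g => sqmod a * p g + r g).
  apply: asmD.
    apply: asmZ; apply: sm_le sp => g; by rewrite ger0_norm.
  by apply: sm_le sr => g; rewrite ger0_norm.
have h3 : rsum (fun g => sqmod a * p g + r g) = sqmod a * psum p + psum r.
  rewrite rsum_ge0; last 2 first.
    by move=> g; rewrite addr_ge0// mulr_ge0// sqmod_ge0.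
    apply: smD => // [g|]; first by rewrite mulr_ge0// sqmod_ge0.
    by apply: smZ => //; exact: sqmod_ge0.
  rewrite psumD ?psumZ ?sqmod_ge0// => [g|];
    first by rewrite mulr_ge0// sqmod_ge0.
  by apply: smZ => //; exact: sqmod_ge0.
have -> : psum p * sqmod a + 2 * rsum (fun g => complex.Re (a * f g)) + psum r =
  rsum (fun g => 2 * complex.Re (a * f g) + (sqmod a * p g + r g)).
  by rewrite rsumD// rsumZ ?h3; [ring|case: saf].
have pt g : 0 <= 2 * complex.Re (a * f g) + (sqmod a * p g + r g).
  have := sqr_Re_le (a * f g); rewrite sqmodM.
  have := ler_wpM2l (sqmod_ge0 a) (fpr g) => u1 u2.
  have {u1 u2} := le_trans u2 u1; rewrite mulrA.
  have := mulr_ge0 (sqmod_ge0 a) (p0 g); have := r0 g.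
  move: (sqmod a * p g) (r g) (complex.Re _) => X Y Z Y0 X0 ZXY.
  (* From [Z ^+ 2 <= X * Y] with [X], [Y] nonnegative: the product of [l1] and [l2] would give
     [(X + Y) ^+ 2 < 4 * Z ^+ 2 <= 4 * (X * Y)], against [(X - Y) ^+ 2 >= 0]. *)
  rewrite leNgt; apply/negP => lt.
  have l1 : 0 < X + Y - 2 * Z by lra.
  have l2 : 0 < - (2 * Z + (X + Y)) by lra.
  by have := mulr_gt0 l1 l2; have := sqr_ge0 (X - Y); nra.
rewrite rsum_ge0//; first exact: psum_ge0.
by apply: sm_le (asmD h1 h2) => g; exact: ler_norm.
Qed.

End signed_sums.

Section ell2_hilbert.
Context (R : realType) (G : groupType).
Local Notation C := R[i].
Local Notation H := (ell2 R G).
Implicit Types (x y z : H) (g h : G) (a : C).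

Lemma ell2E a x y g : (a *: x + y) g = a * x g + y g.
Proof. by []. Qed.

Lemma ell2B x y g : (x - y) g = x g - y g.
Proof. by []. Qed.

Lemma ell2_sum I (r : seq I) (f : I -> H) g :
  (\sum_(i <- r) f i) g = \sum_(i <- r) f i g.
Proof. by apply: (big_morph (fun x : H => x g)). Qed.

Lemma ell2_ext x y : (forall g, x g = y g) -> x = y.
Proof. by move=> xy; apply/val_inj/funext. Qed.

Lemma sm_ell2 x : sm (fun g => sqmod (x g)).
Proof. by have /square_summableP := valP x. Qed.

Lemma inner_cs x y : csm (fun g => x g * conjc (y g)) /\
  sqmod (inner x y) <=
    psum (fun g => sqmod (x g)) * psum (fun g => sqmod (y g)).
Proof.
apply: csum_cauchy_schwarz.
- by move=> g; exact: sqmod_ge0.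
- by move=> g; exact: sqmod_ge0.
- exact: sm_ell2.
- exact: sm_ell2.
- by move=> g; rewrite sqmodM sqmodJ.
Qed.

Lemma inner_linl a x y z : inner (a *: x + y) z = a * inner x z + inner y z.
Proof.
have [xz _] := inner_cs x z; have [yz _] := inner_cs y z.
rewrite /inner -csum_lin//; congr csum; apply/funext => g.
by rewrite ell2E mulrDl mulrA.
Qed.

Lemma innerC x y : inner x y = conjc (inner y x).
Proof.
rewrite /inner -csumJ; congr csum; apply/funext => g.
by rewrite conjcM conjcK mulrC.
Qed.

Lemma inner_self x : inner x x = (psum (fun g => sqmod (x g)))%:C%C.
Proof.
rewrite -csum_real; last 2 first.
  by move=> g; exact: sqmod_ge0.
  exact: sm_ell2.
by rewrite /inner; congr csum; apply/funext => g; rewrite mulrC mulJc.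
Qed.

Lemma Re_inner_self x : complex.Re (inner x x) = psum (fun g => sqmod (x g)).
Proof. by rewrite inner_self. Qed.

Lemma rsum_single (f : G -> R) g : (forall h, h != g -> f h = 0) ->
  rsum f = f g.
Proof.
move=> f0.
have s1 h : h \notin [:: g] -> Num.max (f h) 0 = 0.
  by rewrite inE => /f0 ->; rewrite maxxx.
have s2 h : h \notin [:: g] -> Num.max (- f h) 0 = 0.
  by rewrite inE => /f0 ->; rewrite oppr0 maxxx.
have p1 h : 0 <= Num.max (f h) 0 by rewrite le_max lexx orbT.
have p2 h : 0 <= Num.max (- f h) 0 by rewrite le_max lexx orbT.
have [_ e1] := psum_supp p1 (s := [:: g]) isT s1.
have [_ e2] := psum_supp p2 (s := [:: g]) isT s2.
rewrite /rsum -/(psum (fun h => Num.max (f h) 0))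
  -/(psum (fun h => Num.max (- f h) 0)).
rewrite e1 e2 !big_seq1; have [f1|f1] := leP 0 (f g).
  by rewrite max_r ?oppr_le0// subr0.
by rewrite max_l ?oppr_ge0 ?ltW// sub0r opprK.
Qed.

Lemma csum_single (f : G -> C) g : (forall h, h != g -> f h = 0) ->
  csum f = f g.
Proof.
by move=> f0; apply: complexP; rewrite (Re_csum, Im_csum)
  (rsum_single (g := g))// => h /f0 ->.
Qed.

Lemma deltaE g h : delta R g h = (h == g)%:R.
Proof. by []. Qed.

Lemma inner_delta x g : inner x (delta R g) = x g.
Proof.
rewrite /inner (csum_single (g := g)) => [|h hg]; rewrite deltaE.
  by rewrite eqxx conjc_1 mulr1.
by rewrite (negbTE hg) conjc_0 mulr0.
Qed.

Lemma sum_deltaE (c : G -> C) s g : uniq s ->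
  (\sum_(h <- s) c h *: delta R h : H) g = if g \in s then c g else 0.
Proof.
move=> us; have -> : (\sum_(h <- s) c h *: delta R h : H) g =
    \sum_(h <- s) c h * (g == h)%:R by rewrite ell2_sum.
case: ifP => gs.
  rewrite (bigD1_seq g)//= big1 => [|h /negbTE hg];
    first by rewrite eqxx mulr1 addr0.
  by rewrite eq_sym hg mulr0.
rewrite big_seq big1// => h hs.
by case: eqP hs gs => [->->//|]; rewrite mulr0.
Qed.

Definition finpart (s : seq G) x : H := \sum_(g <- s) x g *: delta R g.

Lemma finpartE s x g : uniq s -> finpart s x g = if g \in s then x g else 0.
Proof. exact: sum_deltaE. Qed.

Lemma finpart_approx x e : 0 < e ->
  exists2 s, uniq s &
    complex.Re (inner (x - finpart s x) (x - finpart s x)) < e.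
Proof.
move=> e0; have [s us se] := psum_approx (fun g => sqmod_ge0 (x g)) (sm_ell2 x)
  e0.
exists s => //; rewrite Re_inner_self; apply: le_lt_trans se.
rewrite le_eqVlt; apply/orP; left; apply/eqP; congr psum; apply/funext => g.
by rewrite ell2B finpartE//; case: ifP; rewrite ?subrr ?sqmod0 ?subr0.
Qed.

Lemma lin_delta0 (l : H -> C) B :
  (forall a x y, l (a *: x + y) = a * l x + l y) ->
  (forall x, sqmod (l x) <= B * complex.Re (inner x x)) ->
  (forall g, l (delta R g) = 0) -> forall x, l x = 0.
Proof.
move=> ll lB l0 x; apply: sqmod_eq0; apply/eqP; rewrite eq_le sqmod_ge0 andbT.
have l00 : l 0 = 0 by have := ll (-1) 0 0; rewrite scaler0 addr0 mulN1r addNr.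
have lD u v : l (u + v) = l u + l v by have := ll 1 u v; rewrite scale1r mul1r.
have lf s : l (finpart s x) = 0.
  rewrite /finpart (big_morph l lD l00) big1// => g _.
  by have := ll (x g) (delta R g) 0; rewrite addr0 => ->;
    rewrite l0 l00 mulr0 addr0.
have [B0|B0] := leP B 0.
  apply: le_trans (lB x) _; rewrite mulr_le0_ge0// Re_inner_self psum_ge0// =>
    g.
  exact: sqmod_ge0.
apply/ler_addgt0Pl => e e0; rewrite addr0.
have [s us /ltW se] := finpart_approx x (divr_gt0 e0 B0).
have -> : l x = l (x - finpart s x).
  by have := lD (x - finpart s x) (finpart s x); rewrite subrK lf addr0.
apply: le_trans (lB _) _; rewrite -ler_pdivlMl// mulrC; exact: se.
Qed.

(** The coordinates of the representing vector are forced by the values at [delta R g]. Testing [l]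
    on a finite part [z] of it, whose squared norm is [S], gives [S ^+ 2 <= B * S], hence square
    summability. *)
Lemma ell2_riesz (l : H -> C) :
  (forall a x y, l (a *: x + y) = a * l x + l y) ->
  (exists B, forall x, sqmod (l x) <= B * complex.Re (inner x x)) ->
  exists y, forall x, l x = inner x y.
Proof.
move=> ll [B lB].
have l00 : l 0 = 0 by have := ll (-1) 0 0; rewrite scaler0 addr0 mulN1r addNr.
have lD u v : l (u + v) = l u + l v by have := ll 1 u v; rewrite scale1r mul1r.
have lZ a u : l (a *: u) = a * l u by have := ll a u 0; rewrite addr0 l00 addr0.
pose y g := conjc (l (delta R g)).
have yB s : uniq s -> \sum_(g <- s) sqmod (y g) <= B.
  move=> us; set S := \sum_(g <- s) _.
  pose z : H := \sum_(g <- s) y g *: delta R g.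
  have lz : l z = S%:C%C.
    rewrite /z (big_morph l lD l00).
    under eq_bigr do rewrite lZ mulrC -[l _]conjcK -/(y _) mulJc.
    apply: (big_ind2 (fun u v => u = v%:C%C)) => // _ u _ v -> ->.
    by apply: complexP; rewrite !cE ?addr0.
  have S0 : 0 <= S by apply: sumr_ge0 => g _; exact: sqmod_ge0.
  have zz : complex.Re (inner z z) = S.
    rewrite Re_inner_self.
    have zE g : z g = if g \in s then y g else 0 by exact: sum_deltaE.
    have [|_ ->] := psum_supp (fun g => sqmod_ge0 (z g)) us.
      by move=> g gs; rewrite zE (negbTE gs) sqmod0.
    rewrite big_seq [RHS]big_seq; apply: eq_bigr => g gs.
    by rewrite zE gs.
  have := lB z; rewrite lz zz sqmod_real expr2.
  move: S0; rewrite le_eqVlt => /orP[/eqP <- _|S0]; last by rewrite ler_pM2r.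
  (* Here [S = 0], and [0 <= B] is read off at a unit vector. *)
  have := le_trans (sqmod_ge0 _) (lB (delta R 1%g)); rewrite Re_inner_self.
  have [h hs|_ ->] := psum_supp (fun g => sqmod_ge0 (delta R 1%g g)) (s :=
    [:: 1%g]) isT.
    by move: hs; rewrite inE deltaE => /negbTE ->; rewrite sqmod0.
  by rewrite big_seq1 deltaE eqxx sqmod1 pmulr_lge0.
have ysq : y \in @square_summable R G.
  by apply/square_summableP; exact: (sm_bound yB).
pose Y := Ell2 ysq; exists Y => x; apply/eqP; rewrite -subr_eq0; apply/eqP.
pose D := 2 * B + 2 * complex.Re (inner Y Y).
apply: (@lin_delta0 (fun u => l u - inner u Y) D) => [a u v|u|g].
- by rewrite ll inner_linl; ring.
- apply: le_trans (sqmodD_le _ _) _; rewrite sqmodN /D [leRHS]mulrDl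
  -!(mulrA 2).
  apply: lerD; rewrite ler_pM2l//.
  by have [_] := inner_cs u Y; rewrite -!Re_inner_self mulrC.
- by rewrite innerC inner_delta /= conjcK subrr.
Qed.

Lemma ell2_hilbert : hilbert (@inner R G).
Proof.
split; [exact: inner_linl|exact: innerC| | |exact: ell2_riesz].
- move=> x; apply/cge0P; split; last by rewrite inner_self.
  by rewrite Re_inner_self; apply: psum_ge0 => g; exact: sqmod_ge0.
- move=> x x0; apply: ell2_ext => g; apply: sqmod_eq0.
  apply: (@psum_eq0 _ _ (fun g => sqmod (x g))) => [h||];
    first exact: sqmod_ge0.
    exact: sm_ell2.
  by rewrite -Re_inner_self x0.
Qed.

Lemma l2normE x : l2norm x = Num.sqrt (complex.Re (inner x x)).
Proof. by rewrite Re_inner_self. Qed.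

End ell2_hilbert.

(** * Finite direct sums, for the amplification in the bicommutant theorem *)

Section ffun_hilbert.
Context (R : realType) (V : lmodType R[i]) (dot : V -> V -> R[i]) (n : nat).
Hypothesis H : hilbert dot.
Local Notation W := {ffun 'I_n -> V}.

Definition ffun_dot (x y : W) : R[i] := \sum_i dot (x i) (y i).

Definition ffun_single (i : 'I_n) (v : V) : W :=
  [ffun j => if j == i then v else 0].

Lemma ffun_single_lin i : linear (ffun_single i).
Proof.
by move=> a x y; apply/ffunP => j; rewrite !ffunE; case: ifP;
  rewrite ?scaler0 ?addr0.
Qed.

Lemma ffun_sum_single (x : W) : x = \sum_i ffun_single i (x i).
Proof.
apply/ffunP => j; rewrite sum_ffunE (bigD1 j)//= big1 => [|i ij].
  by rewrite ffunE eqxx addr0.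
by rewrite ffunE eq_sym (negbTE ij).
Qed.

Lemma ffun_dot_single (x : W) i v : ffun_dot x (ffun_single i v) = dot (x i) v.
Proof.
rewrite /ffun_dot (bigD1 i)//= big1 ?addr0 => [|j ji]; rewrite ffunE ?eqxx//.
by rewrite (negbTE ji) (dot0r H).
Qed.

Lemma Re_sum (I : Type) (r : seq I) (f : I -> R[i]) :
  complex.Re (\sum_(i <- r) f i) = \sum_(i <- r) complex.Re (f i).
Proof. by apply: (big_morph (@complex.Re R)); [exact: cReD|exact: cRe0]. Qed.

Lemma ffun_hilbert : hilbert ffun_dot.
Proof.
split.
- move=> a x y z; rewrite /ffun_dot mulr_sumr -big_split;
  apply: eq_bigr => i _ /=.
  by rewrite !ffunE (dot_linl H).
- move=> x y; rewrite /ffun_dot.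
  rewrite (big_morph (@conjc R) (@conjcD R) (@conjc_0 R)).
  by apply: eq_bigr => i _; rewrite (dotC H).
- by move=> x; apply: sumr_ge0 => i _; exact: (dot_ge0 H).
- move=> x x0; apply/ffunP => i; rewrite ffunE; apply: (dot_eq0 H).
  have /eqP := x0; rewrite psumr_eq0 => [/allP/(_ i)|j _]; last
    exact: (dot_ge0 H).
  by rewrite mem_index_enum => /(_ isT) /eqP.
- move=> l ll [B lB].
  have l00 : l 0 = 0 by have := ll (-1) 0 0; rewrite scaler0 addr0 mulN1r addNr.
  have lD u v : l (u + v) = l u + l v by have := ll 1 u v;
    rewrite scale1r mul1r.
  have /choice[y yP] i : exists y, forall v, l (ffun_single i v) = dot v y.
    apply: (riesz H) => [a u v|]; first by rewrite ffun_single_lin ll.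
    exists B => v; apply: le_trans (lB _) _; rewrite ffun_dot_single ffunE eqxx.
    exact: lexx.
  exists [ffun i => y i] => x; rewrite {1}(ffun_sum_single x)
    (big_morph l lD l00).
  by apply: eq_bigr => i _; rewrite ffunE yP.
Qed.

End ffun_hilbert.

(** * Bounded operators and the bicommutant theorem *)

Section operators.
Context (R : realType) (G : groupType).
Local Notation C := R[i].
Local Notation H := (ell2 R G).
Local Notation n2 x := (complex.Re (inner x x)).
Local Notation HH := (@ell2_hilbert R G).
Implicit Types (x y z : H) (S T : H -> H) (A M : set (H -> H)).

Lemma l2norm_le x y (K : R) : 0 <= K -> (l2norm x <= K * l2norm y) =
  (n2 x <= K ^+ 2 * n2 y).
Proof.
move=> K0; have n0 := n2_ge0 HH; rewrite !l2normE -{1}(ger0_norm K0) -sqrtr_sqr.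
by rewrite -sqrtrM ?sqr_ge0// ler_sqrt// mulr_ge0// sqr_ge0.
Qed.

Lemma l2norm_lt x (e : R) : 0 < e -> (l2norm x < e) = (n2 x < e ^+ 2).
Proof.
move=> e0; rewrite l2normE -{1}(ger0_norm (ltW e0)) -sqrtr_sqr.
by rewrite ltr_sqrt// exprn_gt0.
Qed.

Lemma bounded_operatorP T : bounded_operator T <->
  linear T /\ exists2 B, 0 <= B & forall x, n2 (T x) <= B * n2 x.
Proof.
split=> [[lT [K KT]]|[lT [B B0 BT]]]; split=> //.
  exists (`|K| ^+ 2); first exact: sqr_ge0.
  move=> x; rewrite -l2norm_le//; apply: le_trans (KT x) _.
  by rewrite ler_wpM2r ?ler_norm// l2normE sqrtr_ge0.
exists (Num.sqrt B) => x; rewrite l2norm_le ?sqrtr_ge0// sqr_sqrtr//.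
Qed.

Lemma bop_linear T : bounded_operator T -> linear T. Proof. by case. Qed.

Lemma bop_id : bounded_operator (idfun : H -> H).
Proof.
by apply/bounded_operatorP; split=> //; exists 1 => // x; rewrite mul1r.
Qed.

Lemma bop_0 : bounded_operator (0 : H -> H).
Proof.
apply/bounded_operatorP; split; first by move=> a x y; rewrite scaler0 addr0.
by exists 0 => // x; rewrite (dot0l HH) mul0r.
Qed.

Lemma bop_comp S T : bounded_operator S -> bounded_operator T ->
  bounded_operator (S \o T).
Proof.
move=> /bounded_operatorP[lS [B B0 BS]] /bounded_operatorP[lT [D D0 DT]].
apply/bounded_operatorP; split; first by move=> a x y /=; rewrite lT lS.
exists (B * D); first by rewrite mulr_ge0.
by move=> x /=; rewrite (le_trans (BS _))// -mulrA ler_wpM2l.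
Qed.

Lemma bop_comb (a : C) S T : bounded_operator S -> bounded_operator T ->
  bounded_operator (a *: S + T).
Proof.
move=> /bounded_operatorP[lS [B B0 BS]] /bounded_operatorP[lT [D D0 DT]].
apply/bounded_operatorP; split.
  move=> b x y; rewrite -![(a *: S + T) _]/(a *: S _ + T _) lS lT !scalerDr
    !scalerA.
  by rewrite [b * a]mulrC addrACA.
exists (2 * (sqmod a * B) + 2 * D).
  by rewrite addr_ge0// mulr_ge0// mulr_ge0// sqmod_ge0.
move=> x; apply: le_trans (n2D_le HH _ _) _.
rewrite (n2Z HH); have := ler_wpM2l (sqmod_ge0 a) (BS x); have := DT x.
by move: (n2 (S x)) (n2 (T x)) (n2 x) => s t u ? ?; lra.
Qed.

Lemma bop_Z a T : bounded_operator T -> bounded_operator (a *: T).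
Proof. by move=> bT; rewrite -[a *: T]addr0; apply: bop_comb => //;
  exact: bop_0. Qed.
Lemma bop_D S T : bounded_operator S -> bounded_operator T ->
  bounded_operator (S + T).
Proof. by move=> bS bT; rewrite -[S]scale1r; exact: bop_comb. Qed.
Lemma bop_N T : bounded_operator T -> bounded_operator (- T).
Proof. by rewrite -scaleN1r; exact: bop_Z. Qed.
Lemma bop_B S T : bounded_operator S -> bounded_operator T ->
  bounded_operator (S - T).
Proof. by move=> bS bT; apply: bop_D => //; exact: bop_N. Qed.

Lemma adjoint_unique T S S' : (forall x y, inner (T x) y = inner x (S y)) ->
  (forall x y, inner (T x) y = inner x (S' y)) -> S = S'.
Proof.
by move=> TS TS'; apply/funext => y; apply: (dot_extr HH) => x;
  rewrite -TS -TS'.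
Qed.

Lemma adjointP T : bounded_operator T -> bounded_operator (adjoint T) /\
  forall x y, inner (T x) y = inner x (adjoint T y).
Proof.
move=> /bounded_operatorP[lT [B B0 BT]].
have [S [lS TS BS]] := adjoint_operator HH lT BT.
rewrite /adjoint; case: xgetP => [S' _ []//|/(_ S) []].
by split=> //; apply/bounded_operatorP; split=> //; exists B.
Qed.

Lemma adjoint_bop T : bounded_operator T -> bounded_operator (adjoint T).
Proof. by move=> /adjointP[]. Qed.

Lemma adjointE T x y : bounded_operator T ->
  inner (T x) y = inner x (adjoint T y).
Proof. by move=> /adjointP[]. Qed.

Lemma adjointEr T x y : bounded_operator T ->
  inner x (T y) = inner (adjoint T x) y.
Proof. by move=> bT; rewrite innerC adjointE// -innerC. Qed.

Lemma adjoint_eq T S : bounded_operator T ->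
  (forall x y, inner (T x) y = inner x (S y)) -> adjoint T = S.
Proof. by move=> /adjointP[_ h]; exact: adjoint_unique. Qed.

Lemma adjointK T : bounded_operator T -> adjoint (adjoint T) = T.
Proof.
move=> bT; apply: adjoint_eq; first exact: adjoint_bop.
by move=> x y; rewrite adjointEr.
Qed.

Lemma adjoint_comb a S T : bounded_operator S -> bounded_operator T ->
  adjoint (a *: S + T) = conjc a *: adjoint S + adjoint T.
Proof.
move=> bS bT; apply: adjoint_eq => [|x y]; first exact: bop_comb.
rewrite -[(_ + _) x]/(a *: S x + T x) inner_linl !adjointE//.
rewrite -[(_ + _) y]/(conjc a *: adjoint S y + adjoint T y).
by rewrite (dotDr HH) (dotZr HH) conjcK.
Qed.

Lemma adjoint_id : adjoint (idfun : H -> H) = idfun.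
Proof. by apply: adjoint_eq => //; exact: bop_id. Qed.

Definition commutant A : set (H -> H) :=
  [set T | bounded_operator T /\ forall S x, A S -> T (S x) = S (T x)].

Definition star_closed A := forall T, A T -> A (adjoint T).

Lemma commutant_bop A : commutant A `<=` @bounded_operator R G.
Proof. by move=> T []. Qed.

Lemma sub_bicommutant A : A `<=` @bounded_operator R G ->
  A `<=` commutant (commutant A).
Proof. by move=> Ab T AT; split=> [|S x [bS SA]]; [exact: Ab|rewrite SA]. Qed.

Lemma commutantS A M : A `<=` M -> commutant M `<=` commutant A.
Proof. by move=> AM T [bT TM]; split=> // S x /AM; exact: TM. Qed.

Lemma commutant_star A : A `<=` @bounded_operator R G -> star_closed A ->
  star_closed (commutant A).
Proof.
move=> Ab As T [bT TA]; split=> [|S x AS]; first exact: adjoint_bop.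
apply: (dot_extl HH) => z; rewrite -adjointEr// !(adjointE _ _ (Ab _ AS)).
by rewrite -adjointEr// TA//; exact: As.
Qed.

Lemma sot_closure_bicommutant A :
  sot_closure A `<=` commutant (commutant A).
Proof.
move=> T [bT clT]; split=> // S x [bS SA].
have /bounded_operatorP[lS [B B0 BS]] := bS.
apply/eqP; rewrite -subr_eq0; apply/eqP/(n2_eq0 HH)/eqP.
rewrite eq_le (n2_ge0 HH) andbT; apply/ler_addgt0Pl => e e0; rewrite addr0.
pose d := e / (2 + 2 * B).
have d0 : 0 < d by rewrite divr_gt0// ltr_wpDr// mulr_ge0.
have sd0 : 0 < Num.sqrt d by rewrite sqrtr_gt0.
have [U AU Ue] := clT [:: S x; x] _ sd0.
have {}Ue y : y \in [:: S x; x] -> n2 (T y - U y) < d.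
  move=> yxs;  rewrite -[ltRHS](sqr_sqrtr (ltW d0)) -l2norm_lt ?sqrtr_gt0//.
  exact: Ue.
have u1 := Ue (S x) (mem_head _ _).
have u2 := Ue x (mem_last (S x) [:: x]).
have -> : T (S x) - S (T x) = (T (S x) - U (S x)) - S (T x - U x).
  by rewrite (lin_B lS) (SA U)// opprB addrA subrK.
apply: le_trans (n2B_le HH _ _) _.
apply: le_trans (_ : 2 * d + 2 * (B * d) <= _); last first.
  by rewrite mulrA -mulrDl /d mulrCA divff ?mulr1// gt_eqF// ltr_wpDr//
    mulr_ge0.
apply: lerD; rewrite ler_wpM2l//; first exact: ltW.
by apply: le_trans (BS _) _; rewrite ler_wpM2l// ltW.
Qed.

Lemma commutant_vN A : A `<=` @bounded_operator R G -> star_closed A ->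
  von_neumann_algebra (commutant A).
Proof.
move=> Ab As; split.
- exact: commutant_bop.
- by split; first exact: bop_id.
- move=> a S T [bS SA] [bT TA]; split=> [|U x AU]; first exact: bop_comb.
  rewrite -![(a *: S + T) _]/(a *: S _ + T _) SA// TA//.
  by rewrite (bop_linear (Ab _ AU)).
- move=> S T [bS SA] [bT TA]; split=> [|U x AU]; first exact: bop_comp.
  by rewrite /= TA// SA.
- split; first exact: commutant_star.
  move=> T /sot_closure_bicommutant; apply: commutantS.
  exact: sub_bicommutant.
Qed.

Definition star_algebra A := [/\ A `<=` @bounded_operator R G, A idfun,
  forall (a : C) S T, A S -> A T -> A (a *: S + T),
  forall S T, A S -> A T -> A (S \o T) & star_closed A].

Lemma vN_star_algebra M : von_neumann_algebra M -> star_algebra M.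
Proof. by case=> ? ? ? ? []. Qed.

(** Von Neumann's amplification. The projection [P] onto the closure of the orbit [O] of [x] in the
    [n]-fold sum has matrix entries [p i j] in the commutant of [A], so it commutes with the
    diagonal copy of [T]. As [P x = x], the vector [amp T x] lies in the closure of [O], which
    approximates [T] at all entries of [xs] by one [S]. *)
Lemma bicommutant_sot_closure A : star_algebra A ->
  commutant (commutant A) `<=` sot_closure A.
Proof.
case=> Ab A1 AD AM As T [bT TA]; split=> // xs e e0.
pose n := size xs; pose x : {ffun 'I_n -> H} := [ffun i => nth 0 xs (val i)].
have HW := ffun_hilbert n HH.
pose amp S (w : {ffun 'I_n -> H}) : {ffun 'I_n -> H} := [ffun i => S (w i)].
pose O := [set amp S x | S in A].
have A0 : A 0.
  have := AD (-1) idfun idfun A1 A1.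
  by rewrite scaleN1r addNr.
have amp0 : amp 0 x = 0 by apply/ffunP => i; rewrite !ffunE.
have ampD a S S' : amp (a *: S + S') x = a *: amp S x + amp S' x.
  by apply/ffunP => i; rewrite !ffunE.
have subO : subspace O.
  split; first by exists 0.
  by move=> a _ _ [S AS <-] [S' AS' <-]; exists (a *: S + S'); [exact: AD|].
have [P PP] := exists_projection HW subO.
have linP := projection_lin HW PP.
have Pamp S w : A S -> P (amp S w) = amp S (P w).
  move=> AS; have bS := Ab _ AS.
  apply: (projection_comm HW PP (T := amp S) (T' := amp (adjoint S))).
  - by move=> a u v; apply/ffunP => i; rewrite !ffunE (bop_linear bS).
  - by move=> u v; apply: eq_bigr => i _; rewrite !ffunE adjointE.
  - move=> _ [S' AS' <-]; exists (S \o S'); first exact: AM.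
    by apply/ffunP => i; rewrite !ffunE.
  - move=> _ [S' AS' <-]; exists (adjoint S \o S'); first by apply: AM => //;
    exact: As.
    by apply/ffunP => i; rewrite !ffunE.
pose p i j v := P (ffun_single j v) i.
have pA i j : commutant A (p i j).
  split; last first.
    move=> S v AS; have := Pamp S (ffun_single j v) AS.
    have -> : amp S (ffun_single j v) = ffun_single j (S v).
      apply/ffunP => k; rewrite !ffunE; case: ifP => // _.
      exact: lin_0 (bop_linear (Ab _ AS)).
    by rewrite /p => ->; rewrite ffunE.
  apply/bounded_operatorP; split.
    by move=> a u v; rewrite /p ffun_single_lin linP !ffunE.
  exists 1 => // v; rewrite mul1r /p.
  have -> : n2 v = complex.Re (ffun_dot (@inner R G) (ffun_single j v)
    (ffun_single j v)).
    by rewrite (ffun_dot_single HH) ffunE eqxx.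
  apply: le_trans (projection_n2 HW PP _); rewrite /ffun_dot Re_sum.
  by rewrite (bigD1 i)//= lerDl sumr_ge0// => k _; exact: n2_ge0 HH _.
have PE w i : P w i = \sum_j p i j (w j).
  rewrite {1}(ffun_sum_single w) (lin_sum linP) sum_ffunE.
  by apply: eq_bigr => j _.
have Px : P x = x.
  apply: (projection_mem HW PP); exists idfun => //.
  by apply/ffunP => i; rewrite !ffunE.
have PTx : P (amp T x) = amp T x.
  apply/ffunP => i; rewrite PE ffunE -{2}Px PE (lin_sum (bop_linear bT)).
  by apply: eq_bigr => j _; rewrite ffunE TA.
have Tx : orth (@ffun_dot _ _ (@inner R G) n)
  (orth (@ffun_dot _ _ (@inner R G) n) O) (amp T x).
  by rewrite -PTx; case: (PP (amp T x)).
have e2 : 0 < e ^+ 2 by rewrite exprn_gt0.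
have [_ [S AS <-] Se] := dense_orth_orth HW subO Tx e2.
exists S => // v vxs; rewrite l2norm_lt//; apply: le_lt_trans Se.
have iv : (index v xs < n)%N by rewrite index_mem.
rewrite /ffun_dot Re_sum (bigD1 (Ordinal iv))//= !ffunE /= nth_index// lerDl.
by apply: sumr_ge0 => k _; exact: n2_ge0 HH _.
Qed.

Lemma bicommutant_theorem A : star_algebra A ->
  sot_closure A = commutant (commutant A).
Proof.
move=> sA; apply/seteqP; split; first exact: sot_closure_bicommutant.
exact: bicommutant_sot_closure.
Qed.

Lemma vN_bicommutant M : von_neumann_algebra M ->
  commutant (commutant M) `<=` M.
Proof.
move=> vM; have [_ _ _ _ [_ clM]] := vM; rewrite -bicommutant_theorem//.
exact: vN_star_algebra.
Qed.

End operators.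

(** * Left and right translations *)

Section regular_representations.
Context (R : realType) (G : groupType).
Local Notation C := R[i].
Local Notation H := (ell2 R G).
Local Notation n2 x := (complex.Re (inner x x)).
Local Notation HH := (@ell2_hilbert R G).
Local Notation delta := (delta R).
Local Notation lreg := (@lreg R G).
Implicit Types (x y z : H) (S T : H -> H) (A M : set (H -> H)) (g h s t : G)
  (K : set G).

Lemma csum_bij (e e' : G -> G) (f : G -> C) : cancel e e' -> cancel e' e ->
  csum (fun g => f (e g)) = csum f.
Proof.
move=> ee' e'e.
have rb (u : G -> R) : rsum (fun g => u (e g)) = rsum u.
  rewrite /rsum; congr (_ - _).
    apply: (psum_bij (p := fun g => Num.max (u g) 0) ee' e'e) => g.
    by rewrite le_max lexx orbT.
  apply: (psum_bij (p := fun g => Num.max (- u g) 0) ee' e'e) => g.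
  by rewrite le_max lexx orbT.
by apply: complexP; rewrite (Re_csum, Im_csum) (rb (fun g => _ (f g))).
Qed.

Lemma lregE s x g : lreg s x g = x (s^-1 * g)%g. Proof. by []. Qed.

Lemma rreg_subproof s (x : H) : (fun g => x (g * s)%g) \in @square_summable R G.
Proof.
apply/square_summableP; rewrite /sqnorm.
rewrite (_ : \esum_(g in _) _ = sqnorm x); first exact/square_summableP/valP.
rewrite /sqnorm [RHS](reindex_esum [set: G] [set: G] (fun g => (g * s)%g))//.
split=> // [g h _ _ /=|g _]; first exact: mulIg.
by exists (g * s^-1)%g => //=; rewrite mulgVK.
Qed.

Definition rreg s x : H := Ell2 (rreg_subproof s x).

Lemma rregE s x g : rreg s x g = x (g * s)%g. Proof. by []. Qed.

Lemma lreg_lin s : linear (lreg s).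
Proof. by move=> a x y; apply: ell2_ext => g; rewrite lregE !ell2E. Qed.
Lemma rreg_lin s : linear (rreg s).
Proof. by move=> a x y; apply: ell2_ext => g; rewrite rregE !ell2E. Qed.

Lemma lreg_inner s x y : inner (lreg s x) y = inner x (lreg s^-1 y).
Proof.
rewrite /inner -[RHS](@csum_bij (fun g => s^-1 * g)%g (fun g => s * g)%g).
- by congr csum; apply/funext => g; rewrite !lregE invgK mulVKg.
- exact: mulVKg.
- exact: mulKg.
Qed.
Lemma rreg_inner s x y : inner (rreg s x) y = inner x (rreg s^-1 y).
Proof.
rewrite /inner -[RHS](@csum_bij (fun g => g * s)%g (fun g => g * s^-1)%g).
- by congr csum; apply/funext => g; rewrite !rregE mulgK.
- exact: mulgK.
- exact: mulgVK.
Qed.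

Lemma lreg_lreg s t x : lreg s (lreg t x) = lreg (s * t)%g x.
Proof. by apply: ell2_ext => g; rewrite !lregE invgM mulgA. Qed.
Lemma rreg_rreg s t x : rreg s (rreg t x) = rreg (s * t)%g x.
Proof. by apply: ell2_ext => g; rewrite !rregE mulgA. Qed.
Lemma lreg_1 x : lreg 1 x = x.
Proof. by apply: ell2_ext => g; rewrite lregE invg1 mul1g. Qed.
Lemma rreg_1 x : rreg 1 x = x.
Proof. by apply: ell2_ext => g; rewrite rregE mulg1. Qed.
Lemma lregK s x : lreg s^-1 (lreg s x) = x.
Proof. by rewrite lreg_lreg mulVg lreg_1. Qed.
Lemma lregVK s x : lreg s (lreg s^-1 x) = x.
Proof. by rewrite lreg_lreg mulgV lreg_1. Qed.
Lemma rregK s x : rreg s^-1 (rreg s x) = x.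
Proof. by rewrite rreg_rreg mulVg rreg_1. Qed.
Lemma lreg_rreg s t x : lreg s (rreg t x) = rreg t (lreg s x).
Proof. by apply: ell2_ext => g; rewrite !lregE !rregE lregE mulgA. Qed.

Lemma n2_lreg s x : n2 (lreg s x) = n2 x.
Proof. by rewrite lreg_inner lregK. Qed.
Lemma n2_rreg s x : n2 (rreg s x) = n2 x.
Proof. by rewrite rreg_inner rregK. Qed.

Lemma bop_lreg s : bounded_operator (lreg s).
Proof.
apply/bounded_operatorP; split; first exact: lreg_lin.
by exists 1 => // x; rewrite n2_lreg mul1r.
Qed.
Lemma bop_rreg s : bounded_operator (rreg s).
Proof.
apply/bounded_operatorP; split; first exact: rreg_lin.
by exists 1 => // x; rewrite n2_rreg mul1r.
Qed.

Lemma adjoint_lreg s : adjoint (lreg s) = lreg s^-1.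
Proof. by apply: adjoint_eq; [exact: bop_lreg|exact: lreg_inner]. Qed.
Lemma adjoint_rreg s : adjoint (rreg s) = rreg s^-1.
Proof. by apply: adjoint_eq; [exact: bop_rreg|exact: rreg_inner]. Qed.

Lemma lreg_delta s g : lreg s (delta g) = delta (s * g)%g.
Proof.
apply: ell2_ext => h; rewrite lregE !deltaE; congr (_%:R); congr nat_of_bool.
by apply/eqP/eqP => [<-|->]; rewrite ?mulVKg ?mulKg.
Qed.
Lemma rreg_delta s g : rreg s (delta g) = delta (g * s^-1)%g.
Proof.
apply: ell2_ext => h; rewrite rregE !deltaE; congr (_%:R); congr nat_of_bool.
by apply/eqP/eqP => [<-|->]; rewrite ?mulgK ?mulgVK.
Qed.

Lemma n2_delta g : n2 (delta g) = 1.
Proof. by rewrite inner_delta deltaE eqxx. Qed.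

Lemma bop_ext_delta S T : bounded_operator S -> bounded_operator T ->
  (forall g, S (delta g) = T (delta g)) -> S = T.
Proof.
move=> bS bT ST; apply/funext => x; apply/eqP; rewrite -subr_eq0; apply/eqP.
have bD := bop_B bS bT; have /bounded_operatorP[lD [B B0 DB]] := bD.
apply: (dot_extl HH) => y; rewrite (dot0l HH).
apply: (@lin_delta0 R G (fun x => inner ((S - T) x) y) (B * n2 y)) =>
  [a u v|u|g].
- by rewrite lD inner_linl.
- apply: le_trans (cauchy_schwarz HH _ _) _; rewrite mulrAC.
  by rewrite ler_wpM2r ?(n2_ge0 HH).
- by rewrite -[(S - T) _]/(S _ - T _) ST subrr (dot0l HH).
Qed.

(* The commutant of the right translations: a posteriori the group von Neumann
   algebra itself. *)
Definition left_operators : set (H -> H) := commutant (range rreg).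

Lemma left_operators_bop : left_operators `<=` @bounded_operator R G.
Proof. exact: commutant_bop. Qed.

Lemma star_closed_rreg : star_closed (range rreg).
Proof. by move=> _ [s _ <-]; rewrite adjoint_rreg; exists s^-1%g. Qed.

Lemma left_operators_vN : von_neumann_algebra left_operators.
Proof.
apply: commutant_vN; last exact: star_closed_rreg.
by move=> _ [s _ <-]; exact: bop_rreg.
Qed.

Lemma left_operators_star : star_closed left_operators.
Proof. by have [_ _ _ _ []] := left_operators_vN. Qed.

Lemma left_lreg s : left_operators (lreg s).
Proof.
by split=> [|_ x [t _ <-]]; [exact: bop_lreg|exact: lreg_rreg].
Qed.

Lemma left_operators_comp S T : left_operators S -> left_operators T ->
  left_operators (S \o T).
Proof. by have [_ _ _ h _] := left_operators_vN; exact: h. Qed.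

Lemma left_rreg T s x : left_operators T -> T (rreg s x) = rreg s (T x).
Proof. by case=> _ -> //; exists s. Qed.

Lemma left_delta T g : left_operators T ->
  T (delta g) = rreg g^-1 (T (delta 1%g)).
Proof. by move=> LT; rewrite -left_rreg// rreg_delta invgK mul1g. Qed.

Lemma left_deltaE T g h : left_operators T ->
  T (delta g) h = T (delta 1%g) (h * g^-1)%g.
Proof. by move=> LT; rewrite left_delta. Qed.

Lemma flip_subproof (x : H) :
  (fun g => conjc (x g^-1%g)) \in @square_summable R G.
Proof.
apply/square_summableP; rewrite /sqnorm.
rewrite (_ : \esum_(g in _) _ = sqnorm x); first exact/square_summableP/valP.
rewrite /sqnorm [RHS](reindex_esum [set: G] [set: G] (fun g => g^-1)%g)//.
  by apply: eq_esum => g _; rewrite sqmodJ.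
split=> // [g h _ _ /=|g _]; first exact: invg_inj.
by exists g^-1%g => //=; rewrite invgK.
Qed.

(* The modular conjugation [J] of L(G): [J (T delta_1) = T^* delta_1]. *)
Definition flip x : H := Ell2 (flip_subproof x).

Lemma flipE x g : flip x g = conjc (x g^-1%g). Proof. by []. Qed.

Lemma flipK x : flip (flip x) = x.
Proof. by apply: ell2_ext => g; rewrite !flipE invgK conjcK. Qed.

Lemma inner_flip x y : inner (flip x) (flip y) = inner y x.
Proof.
rewrite /inner -[RHS](@csum_bij (fun g => g^-1)%g (fun g => g^-1)%g).
- by congr csum; apply/funext => g; rewrite !flipE conjcK mulrC.
- exact: invgK.
- exact: invgK.
Qed.

Lemma flip_left T : left_operators T -> adjoint T (delta 1%g) =
  flip (T (delta 1%g)).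
Proof.
move=> LT; have bT := left_operators_bop LT; apply: ell2_ext => g.
rewrite -inner_delta -adjointEr// innerC flipE; congr conjc.
by rewrite inner_delta left_deltaE// mul1g.
Qed.

(** Traciality of [trace0]: the two sides are its values at $TT^*$ and $T^*T$. *)
Lemma n2_adjoint_delta T : left_operators T ->
  n2 (adjoint T (delta 1%g)) = n2 (T (delta 1%g)).
Proof. by move=> LT; rewrite flip_left// inner_flip. Qed.

Lemma trace0_left T g : left_operators T ->
  inner (T (delta g)) (delta g) = trace0 T.
Proof.
by move=> LT; rewrite left_delta// rreg_inner invgK rreg_delta mulgV.
Qed.

Section translations_of_a_subgroup.
Variable K : set G.
Hypothesis groupK : group_closed (mem K).

Lemma group1K : K 1%g. Proof. by case: groupK; rewrite inE. Qed.
Lemma groupVK s : K s -> K s^-1%g.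
Proof.
by move=> Ks; have := @group_closedV _ _ groupK s; rewrite !inE; apply.
Qed.
Lemma groupMK s t : K s -> K t -> K (s * t)%g.
Proof.
by move=> Ks Kt; have := @group_closedM _ _ groupK s t; rewrite !inE; apply.
Qed.

Local Notation LK := (lreg @` K).

Lemma LK_bop : LK `<=` @bounded_operator R G.
Proof. by move=> _ [s _ <-]; exact: bop_lreg. Qed.

Lemma LK_star : star_closed LK.
Proof.
by move=> _ [s Ks <-]; rewrite adjoint_lreg; exists s^-1%g => //;
  exact: groupVK.
Qed.

Lemma bicommutant_LK_vN : von_neumann_algebra (commutant (commutant LK)).
Proof.
apply: commutant_vN; first exact: commutant_bop.
by apply: commutant_star; [exact: LK_bop|exact: LK_star].
Qed.

Lemma bicommutant_left : commutant (commutant LK) `<=` left_operators.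
Proof.
apply: commutantS => _ [s _ <-]; split; first exact: bop_rreg.
by move=> _ x [t _ <-]; rewrite lreg_rreg.
Qed.

(** The Fourier series of [T] need not converge strongly, so membership is tested against an [A] in
    the commutant. The matrix coefficients of [T \o A] and [A \o T] at [h], [g] are sums over the
    group, matched term by term after substituting $g k^{-1} h$ for $k$ in the second. The term at
    [k] vanishes unless $gk^{-1}$ lies in [K], and then [A] commutes with that translation, which
    identifies its two coefficients. *)
Lemma left_supported_bicommutant T : left_operators T ->
  (forall g, ~ K g -> T (delta 1%g) g = 0) -> commutant (commutant LK) T.
Proof.
move=> LT TK; have bT := left_operators_bop LT; split=> // A x [bA AK].
suff E : T \o A = A \o T :> (H -> H) by exact: (congr1 (fun f => f x) E).
apply: bop_ext_delta => [||h]; [exact: bop_comp|exact: bop_comp|].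
apply: ell2_ext => g /=; rewrite -[LHS]inner_delta -[RHS]inner_delta.
rewrite [LHS](adjointE _ _ bT) [RHS](adjointE _ _ bA).
rewrite /inner -[RHS](@csum_bij (fun k => g * (k^-1 * h))%g
  (fun k => h * (k^-1 * g))%g).
- congr csum; apply/funext => k.
  have TE : adjoint T (delta g) k = conjc (T (delta h) (g * (k^-1 * h))%g).
    rewrite -inner_delta -adjointEr// innerC inner_delta.
    by rewrite left_deltaE// [in RHS]left_deltaE// mulgA mulgK.
  have [Kgk|Kgk] := pselect (K (g * k^-1)%g); last first.
    have T0 : T (delta h) (g * (k^-1 * h))%g = 0.
      by rewrite left_deltaE// mulgA mulgK TK.
    by rewrite TE T0 !conjc_0 mulr0 mul0r.
  rewrite TE conjcK mulrC; congr (_ * _).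
  rewrite -inner_delta adjointE// -[delta k]/(delta k).
  have -> : delta k = lreg (g * k^-1)^-1 (delta g).
    by rewrite lreg_delta invgM invgK mulgVK.
  rewrite -adjointE// -lreg_inner -AK; last by exists (g * k^-1)%g.
  by rewrite lreg_delta adjointE// innerC inner_delta mulgA.
- by move=> k; rewrite !invgM !invgK !mulgA mulgV mul1g mulgVK.
- by move=> k; rewrite !invgM !invgK !mulgA mulgV mul1g mulgVK.
Qed.

Lemma linear_span_min A (P : set (H -> H)) : A `<=` P -> P 0 ->
  (forall (a : C) S T, P S -> P T -> P (a *: S + T)) -> linear_span A `<=` P.
Proof.
move=> AP P0 PD _ [n [c [S [AS ->]]]].
apply: (big_ind P) => // [U V PU PV|i _].
  by rewrite -[U]scale1r; exact: PD.
by rewrite -[_ *: _]addr0; apply: PD => //; exact: AP.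
Qed.

Lemma linear_span_comb A (a : C) S T : linear_span A S -> linear_span A T ->
  linear_span A (a *: S + T).
Proof.
move=> [n [c [S' [AS ->]]]] [m [d [T' [AT ->]]]].
exists (n + m)%N, (fun i : 'I_(n + m) => match fintype.split i with inl j =>
  a * c j | inr j => d j end),
  (fun i : 'I_(n + m) => match fintype.split i with inl j => S' j |
    inr j => T' j end); split.
  by move=> i; case: fintype.split.
rewrite big_split_ord /= scaler_sumr; congr (_ + _); apply: eq_bigr => i _.
  by rewrite -[lshift _ _]/(unsplit (inl i)) unsplitK scalerA.
by rewrite -[rshift _ _]/(unsplit (inr i)) unsplitK.
Qed.

Lemma linear_span_0 A : linear_span A 0.
Proof.
exists 0%N, (fun=> 0), (fun=> 0); split; first by case.
by rewrite big_ord0.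
Qed.

Lemma sub_linear_span A : A `<=` linear_span A.
Proof.
move=> S AS; exists 1%N, (fun=> 1), (fun=> S); split=> //.
by rewrite big_ord1 scale1r.
Qed.

Lemma linear_span_LK_bop : linear_span LK `<=` @bounded_operator R G.
Proof.
apply: linear_span_min; [exact: LK_bop|exact: bop_0|].
by move=> a S T; exact: bop_comb.
Qed.

Lemma linear_span_LK_star_algebra : star_algebra (linear_span LK).
Proof.
split.
- exact: linear_span_LK_bop.
- apply: sub_linear_span; exists 1%g; first exact: group1K.
  by apply/funext => x; rewrite lreg_1.
- by move=> a S T; exact: linear_span_comb.
- move=> S T spS; move: S spS T.
  apply: linear_span_min => [_ [s Ks <-]|T spT|a S S' IS IS' T spT].
  + apply: linear_span_min => [_ [t Kt <-]||a T T' IT IT'].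
    * apply: sub_linear_span; exists (s * t)%g; first exact: groupMK.
      by apply/funext => x; rewrite /= lreg_lreg.
    * have -> : lreg s \o 0 = 0 :> (H -> H) by apply/funext => x;
      exact: lin_0 (lreg_lin s).
      exact: linear_span_0.
    * have -> : lreg s \o (a *: T + T') = a *: (lreg s \o T) + (lreg s \o T').
        by apply/funext => x; exact: lreg_lin.
      exact: linear_span_comb.
  + exact: linear_span_0.
  + by apply: (linear_span_comb a (IS T spT) (IS' T spT)).
- suff h : linear_span LK `<=` [set T | bounded_operator T /\
  linear_span LK (adjoint T)].
    by move=> T /h[].
  apply: linear_span_min => [_ [s Ks <-]||a S T [bS sS] [bT sT]].
  + split; first exact: bop_lreg.
    apply: sub_linear_span; rewrite adjoint_lreg; exists s^-1%g => //.
    exact: groupVK.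
  + split; first exact: bop_0.
    rewrite (_ : adjoint 0 = 0); first exact: linear_span_0.
    by apply: adjoint_eq => [|x y]; [exact: bop_0|rewrite (dot0l HH)
      (dot0r HH)].
  + split; first exact: bop_comb.
    by rewrite adjoint_comb//; exact: linear_span_comb.
Qed.

Lemma commutant_linear_span : commutant (linear_span LK) = commutant LK.
Proof.
apply/seteqP; split=> [|T [bT TK]]; first
  exact: commutantS (@sub_linear_span _).
split=> // S x spS; move: S spS x.
apply: linear_span_min => [S SK x|x|a S S' IS IS' x]; first exact: TK.
  by rewrite (lin_0 (bop_linear bT)).
by rewrite (bop_linear bT) IS IS'.
Qed.

Lemma sot_closure_LK : sot_closure (linear_span LK) = commutant (commutant LK).
Proof.
rewrite bicommutant_theorem ?commutant_linear_span//.
exact: linear_span_LK_star_algebra.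
Qed.

End translations_of_a_subgroup.
End regular_representations.

(** * States, and the algebra of a normal amenable subgroup *)

Section states.
Context (R : realType) (G : groupType).
Local Notation C := R[i].
Local Notation H := (ell2 R G).
Local Notation n2 x := (complex.Re (inner x x)).
Local Notation HH := (@ell2_hilbert R G).
Implicit Types (x y z : H) (S T : H -> H).
Variables (phi : (H -> H) -> C) (sphi : is_state phi).

Lemma state_lin a S T : bounded_operator S -> bounded_operator T ->
  phi (a *: S + T) = a * phi S + phi T.
Proof. by case: sphi => h _ _; exact: h. Qed.

Lemma state_0 : phi 0 = 0.
Proof.
have := state_lin (-1) (@bop_0 R G) (@bop_0 R G).
by rewrite scaler0 addr0 mulN1r addNr.
Qed.

Lemma stateZ a T : bounded_operator T -> phi (a *: T) = a * phi T.
Proof.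
by move=> bT; rewrite -[a *: T]addr0 state_lin//;
  [rewrite state_0 addr0|exact: bop_0].
Qed.

Lemma stateB S T : bounded_operator S -> bounded_operator T ->
  phi (S - T) = phi S - phi T.
Proof. by move=> bS bT; rewrite addrC -scaleN1r state_lin// mulN1r addrC. Qed.

Lemma positive_adjoint_comp T : bounded_operator T ->
  positive_operator (adjoint T \o T).
Proof.
move=> bT; split=> [|x /=]; first by apply: bop_comp => //; exact: adjoint_bop.
by rewrite -adjointEr ?(dot_ge0 HH)//.
Qed.

Lemma state_ge0 T : bounded_operator T -> 0 <= phi (adjoint T \o T).
Proof. by case: sphi => _ h _ bT; apply: h; exact: positive_adjoint_comp. Qed.

Lemma state_expand a S T : bounded_operator S -> bounded_operator T ->
  0 <= (sqmod a)%:C%C * phi (adjoint S \o S) + conjc a * phi (adjoint S \o T) +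
    (a * phi (adjoint T \o S) + phi (adjoint T \o T)).
Proof.
move=> bS bT; have bST := bop_comb a bS bT; have := state_ge0 bST.
have aS := adjoint_bop bS; have aT := adjoint_bop bT.
have -> : adjoint (a *: S + T) \o (a *: S + T) =
   (sqmod a)%:C%C *: (adjoint S \o S) + (conjc a *: (adjoint S \o T) +
      (a *: (adjoint T \o S) + (adjoint T \o T))).
  rewrite adjoint_comb//; apply/funext => x.
  rewrite -[LHS]/(conjc a *: adjoint S (a *: S x + T x) +
    adjoint T (a *: S x + T x)).
  rewrite (bop_linear aS) (bop_linear aT) scalerDr scalerA mulJc -addrA.
  by [].
have [b1 b2] := (bop_comp aS bS, bop_comp aS bT).
have [b3 b4] := (bop_comp aT bS, bop_comp aT bT).
have b5 := bop_comb a b3 b4; have b6 := bop_comb (conjc a) b2 b5.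
by rewrite (state_lin _ b1 b6) (state_lin _ b2 b5) (state_lin _ b3 b4) addrA.
Qed.

(** Polarisation: [state_expand] is real at [a = 1] and at the imaginary unit, which fixes the
    imaginary and the real part. *)
Lemma state_herm S T : bounded_operator S -> bounded_operator T ->
  phi (adjoint S \o T) = conjc (phi (adjoint T \o S)).
Proof.
move=> bS bT.
have /cge0P[_ s0] := state_ge0 bS; have /cge0P[_ t0] := state_ge0 bT.
have [i [i0 i1]] : exists i : C, complex.Re i = 0 /\ complex.Im i = 1.
  by exists (Complex 0 1).
have /cge0P[_] := state_expand 1 bS bT; have /cge0P[_] := state_expand i bS bT.
rewrite !cE s0 t0 i0 i1 => h1 h2.
by apply: complexP; rewrite !cE; lra.
Qed.

Lemma state_cauchy_schwarz S T : bounded_operator S -> bounded_operator T ->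
  sqmod (phi (adjoint T \o S)) <=
    complex.Re (phi (adjoint S \o S)) * complex.Re (phi (adjoint T \o T)).
Proof.
move=> bS bT; apply: discr_le => a.
have /cge0P[_ s0] := state_ge0 bS.
have /cge0P[+ _] := state_expand a bS bT.
by rewrite (state_herm bS bT) !cE s0; lra.
Qed.

Lemma state_comp_le S T : bounded_operator S -> bounded_operator T ->
  sqmod (phi (T \o S)) <=
    complex.Re (phi (adjoint S \o S)) * complex.Re (phi (T \o adjoint T)).
Proof.
move=> bS bT; have := state_cauchy_schwarz bS (adjoint_bop bT).
by rewrite adjointK.
Qed.

Lemma state_norm T B : bounded_operator T -> (forall x, n2 (T x) <= B * n2 x) ->
  complex.Re (phi (adjoint T \o T)) <= B.
Proof.
move=> bT TB; have aT := adjoint_bop bT.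
have bTT := bop_comp aT bT.
have [_ h p1] := sphi.
have : 0 <= phi (B%:C%C *: idfun - (adjoint T \o T)).
  apply: h; split=> [|x].
    by apply: bop_B => //; apply: bop_Z; exact: bop_id.
  rewrite -[X in inner X x]/(B%:C%C *: x - adjoint T (T x)).
  rewrite (dotBl HH) (dotZl HH) -adjointEr// (dotxx HH x) (dotxx HH (T x)).
  move: (TB x); move: (n2 x) (n2 (T x)) => u v uv.
  by apply/cge0P; rewrite !cE; split; [lra|ring].
rewrite stateB//; last by apply: bop_Z; exact: bop_id.
rewrite stateZ ?p1 ?mulr1; last exact: bop_id.
by move=> /cge0P[+ _]; rewrite !cE; lra.
Qed.

Lemma state_sqmod T B : bounded_operator T ->
  (forall x, n2 (T x) <= B * n2 x) ->
  sqmod (phi T) <= B.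
Proof.
move=> bT TB; have := state_cauchy_schwarz bT (@bop_id R G).
have [_ _ p1] := sphi.
rewrite adjoint_id -[idfun \o T]/T -[idfun \o idfun]/(idfun : H -> H) p1 mulr1.
by move=> /le_trans; apply; exact: state_norm.
Qed.

Lemma state_null_comp S T : bounded_operator S -> bounded_operator T ->
  phi (adjoint T \o T) = 0 -> phi (S \o T) = 0.
Proof.
move=> bS bT T0; apply: sqmod_eq0; apply/eqP; rewrite eq_le sqmod_ge0 andbT.
by apply: le_trans (state_comp_le bT bS) _; rewrite T0 cRe0 mul0r.
Qed.

Lemma state_null_compr S T : bounded_operator S -> bounded_operator T ->
  phi (T \o adjoint T) = 0 -> phi (T \o S) = 0.
Proof.
move=> bS bT T0; apply: sqmod_eq0; apply/eqP; rewrite eq_le sqmod_ge0 andbT.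
by apply: le_trans (state_comp_le bS bT) _; rewrite T0 cRe0 mulr0.
Qed.

End states.

Section subgroup_algebra.
Context (R : realType) (G : groupType).
Local Notation C := R[i].
Local Notation H := (ell2 R G).
Local Notation n2 x := (complex.Re (inner x x)).
Local Notation HH := (@ell2_hilbert R G).
Implicit Types (x y z : H) (S T : H -> H) (K : set G).

Lemma group_closed_setT : group_closed (mem [set: G]).
Proof. by split=> [|? ? _ _]; rewrite inE. Qed.

Lemma group_vN_bicommutant : group_vN R G =
  commutant (commutant (range (@lreg R G))).
Proof. exact: sot_closure_LK group_closed_setT. Qed.

Lemma group_vN_left : group_vN R G `<=` @left_operators R G.
Proof. by rewrite group_vN_bicommutant; exact: bicommutant_left. Qed.

(** The bicommutant is one of the algebras in the intersection, and each of the others contains it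
    because it equals its own bicommutant. *)
Lemma subgroup_vN_bicommutant K : group_closed (mem K) ->
  subgroup_vN R K = commutant (commutant (@lreg R G @` K)).
Proof.
move=> gK; apply/seteqP; split.
  move=> T; apply; split; last first.
    by apply: sub_bicommutant; exact: LK_bop.
  split; first exact: bicommutant_LK_vN.
  rewrite group_vN_bicommutant; apply: commutantS; apply: commutantS.
  by move=> _ [s _ <-]; exists s.
move=> T KT N [[vN _] KN]; apply: (vN_bicommutant vN).
by apply: commutantS KT; exact: commutantS.
Qed.

Lemma subgroup_vN_subalgebra K : group_closed (mem K) ->
  von_neumann_subalgebra (subgroup_vN R K) (group_vN R G).
Proof.
move=> gK; rewrite subgroup_vN_bicommutant//; split;
  first exact: bicommutant_LK_vN.
rewrite group_vN_bicommutant; apply: commutantS; apply: commutantS.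
by move=> _ [s _ <-]; exists s.
Qed.

Lemma subgroup_vN_invariant K : normal_subgroup K ->
  G_invariant (subgroup_vN R K).
Proof.
move=> [gK nK]; rewrite subgroup_vN_bicommutant// => s.
have conj t T : commutant (commutant (@lreg R G @` K)) T ->
    commutant (commutant (@lreg R G @` K)) (lreg t \o T \o lreg t^-1).
  move=> [bT TK]; split.
    by apply: bop_comp (@bop_lreg _ _ _); apply: bop_comp => //;
      exact: bop_lreg.
  move=> A x [bA AK] /=.
  have cA : commutant (@lreg R G @` K) (lreg t^-1 \o A \o lreg t).
    split; first by apply: bop_comp (@bop_lreg _ _ _); apply: bop_comp => //;
      exact: bop_lreg.
    move=> _ y [k Kk <-] /=; rewrite lreg_lreg.
    have -> : lreg (t * k) y = lreg (t * k * t^-1) (lreg t y)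
      by rewrite lreg_lreg mulgVK.
    rewrite AK; last first.
      by exists (t * k * t^-1)%g => //; have := nK t^-1%g k Kk;
        rewrite conjgE invgK mulgA.
    by rewrite !lreg_lreg !mulgA mulVg mul1g.
  have := TK _ (lreg t^-1 x) cA; rewrite /= lregVK => ->.
  by rewrite lregVK.
apply/seteqP; split=> [_ [T KT <-]|T KT].
  by rewrite adjoint_lreg; exact: conj.
exists (lreg s^-1 \o T \o lreg s).
  by have := conj s^-1%g T KT; rewrite invgK.
by rewrite adjoint_lreg; apply/funext => x /=; rewrite !lregVK.
Qed.

Lemma bounded_on (K : set G) (f : G -> R) : bfun f -> [bounded f h | h in K].
Proof.
move=> [B fB]; exists B; split=> [|M BM h _]; first exact: num_real.
exact: le_trans (fB h) (ltW BM).
Qed.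

Lemma invariant_mean_is_mean K m : @is_invariant_mean R G K m -> is_mean m.
Proof.
move=> [lin pos one _]; split=> [a f g bf bg|f bf f0|//].
- by apply: lin; exact: bounded_on.
- by apply: pos; [exact: bounded_on|move=> h _; exact: f0].
Qed.

Lemma diagonal_bound T : bounded_operator T ->
  cbfun (fun s => inner (T (delta R s)) (delta R s)).
Proof.
move=> /bounded_operatorP[_ [B B0 TB]]; exists B => s.
apply: le_trans (cauchy_schwarz HH _ _) _; rewrite n2_delta mulr1.
by have := TB (delta R s); rewrite n2_delta mulr1.
Qed.

Lemma linear_span_ind (A : set (H -> H)) (P : (H -> H) -> Prop) :
  A `<=` @bounded_operator R G -> P 0 -> (forall S, A S -> P S) ->
  (forall (a : C) S T, bounded_operator S -> bounded_operator T ->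
    P S -> P T -> P (a *: S + T)) -> forall S, linear_span A S -> P S.
Proof.
move=> Ab P0 PA PD S spS.
suff [] : bounded_operator S /\ P S by [].
move: S spS; apply: linear_span_min => [S AS||a S T [bS PS] [bT PT]].
- by split; [exact: Ab|exact: PA].
- by split; first exact: bop_0.
- by split; [exact: bop_comb|exact: PD].
Qed.

Lemma subgroup_vN_amenable K : group_closed (mem K) -> amenable_group R K ->
  amenable_vN (subgroup_vN R K).
Proof.
move=> gK [m mK]; have mm := invariant_mean_is_mean mK.
rewrite subgroup_vN_bicommutant//.
pose phi (T : H -> H) := cmean m (fun s => inner (T (delta R s)) (delta R s)).
have sphi : is_state phi.
  split=> [a S T bS bT|T [bT T0]|].
  - rewrite /phi -cmean_lin//; try exact: diagonal_bound.
    by congr cmean; apply/funext => s; rewrite -inner_linl.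
  - by apply: cmean_ge0 => //; exact: diagonal_bound.
  - rewrite /phi (_ : (fun s => _) = (fun=> 1)); first exact: cmean_cst.
    by apply/funext => s; rewrite inner_delta deltaE eqxx.
have phi_left T : left_operators T -> phi T = trace0 T.
  move=> LT; rewrite /phi (_ : (fun s => _) = (fun=> trace0 T));
    first exact: cmean_cst.
  by apply/funext => s; rewrite trace0_left.
have phi_conj k T : K k -> bounded_operator T ->
  phi (lreg k \o T \o lreg k^-1) = phi T.
  move=> Kk bT; rewrite /phi.
  rewrite (_ : (fun s => _) =
    fun s => inner (T (delta R (k^-1 * s)%g)) (delta R (k^-1 * s)%g)); last
      first.
    by apply/funext => s /=; rewrite lreg_inner !lreg_delta.
  have [_ _ _ inv] := mK; rewrite /cmean; congr (_ +i* _)%C.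
    apply: (inv k (fun s => complex.Re (inner (T (delta R s)) (delta R s)))) =>
      //.
    by apply: bounded_on; apply: bfun_Re; exact: diagonal_bound.
  apply: (inv k (fun s => complex.Im (inner (T (delta R s)) (delta R s)))) =>
    //.
  by apply: bounded_on; apply: bfun_Im; exact: diagonal_bound.
have phi_span S T : bounded_operator T -> linear_span (@lreg R G @` K) S ->
    phi (T \o S) = phi (S \o T).
  move=> bT; move: S; apply: linear_span_ind =>
    [||_ [k Kk <-]|a S S' bS bS' IS IS'].
  - exact: LK_bop.
  - have -> : T \o 0 = 0 :> (H -> H) by apply/funext => x;
    exact: lin_0 (bop_linear bT).
    by [].
  - have := phi_conj k (T \o lreg k) Kk.
    move=> <-; last by apply: bop_comp => //; exact: bop_lreg.
    by congr phi; apply/funext => x /=; rewrite lregVK.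
  - have -> : T \o (a *: S + S') = a *: (T \o S) + (T \o S').
      by apply/funext => x; exact: bop_linear bT _ _ _.
    rewrite -[(a *: S + S') \o T]/(a *: (S \o T) + (S' \o T)).
    by rewrite !(state_lin sphi) ?IS ?IS'//; exact: bop_comp.
exists phi; split=> // [T /(bicommutant_left (K := K))|S T KS bT];
  first exact: phi_left.
have LS := bicommutant_left KS; have bS := left_operators_bop LS.
apply/eqP; rewrite -subr_eq0; apply/eqP/sqmod_eq0/eqP.
rewrite eq_le sqmod_ge0 andbT; apply/ler_addgt0Pl => e e0; rewrite addr0.
have aT := adjoint_bop bT.
pose B := complex.Re (phi (T \o adjoint T)) + complex.Re (phi (adjoint T \o T)).
have B1 : 0 <= complex.Re (phi (T \o adjoint T)).
  by have /cge0P[] := state_ge0 sphi aT; rewrite adjointK.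
have B2 : 0 <= complex.Re (phi (adjoint T \o T)).
  by have /cge0P[] := state_ge0 sphi bT.
have B0 : 0 < 2 * B + 1 by rewrite ltr_wpDl// mulr_ge0// addr_ge0.
pose d := e / (2 * B + 1); have d0 : 0 < d by rewrite divr_gt0.
(* Centrality passes from the span to its strong closure by approximating at the single vector
   [delta R 1%g]. With [X = S - U], both $X^*X$ and $XX^*$ have [phi]-value the squared norm of
   [X (delta R 1%g)], since [phi] is the trace on left operators; Cauchy-Schwarz then bounds
   [phi (T \o X)] and [phi (X \o T)], whatever the norm of [U]. *)
have := KS; rewrite -sot_closure_LK// =>
  -[_ /(_ [:: delta R 1%g] (Num.sqrt d))].
rewrite sqrtr_gt0 => /(_ d0)[U spU /(_ _ (mem_head _ _))].
rewrite l2norm_lt ?sqrtr_gt0// sqr_sqrtr ?(ltW d0)// => Ud.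
have KU : commutant (commutant (@lreg R G @` K)) U.
  rewrite -(@commutant_linear_span _ _ K); apply: sub_bicommutant => //.
  exact: linear_span_LK_bop.
have LU := bicommutant_left KU; have bU := left_operators_bop LU.
pose X := S - U.
have LX : left_operators X.
  have [_ _ h _ _] := @left_operators_vN R G.
  by have := h (-1) _ _ LU LS; rewrite addrC scaleN1r.
have bX := left_operators_bop LX; have aX := adjoint_bop bX.
have eX : n2 (X (delta R 1%g)) < d by [].
have -> : phi (T \o S) - phi (S \o T) = phi (T \o X) - phi (X \o T).
  have -> : T \o X = (T \o S) - (T \o U).
    by apply/funext => x; exact: lin_B (bop_linear bT) _ _.
  have -> : X \o T = (S \o T) - (U \o T) by [].
  rewrite !(stateB sphi); do ?exact: bop_comp.
  by rewrite (phi_span U)//; ring.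
have e1 : complex.Re (phi (adjoint X \o X)) = n2 (X (delta R 1%g)).
  rewrite phi_left; last by apply: left_operators_comp => //;
    exact: left_operators_star.
  by rewrite /trace0 -[(_ \o X) _]/(adjoint X (X _)) -adjointEr.
have e2 : complex.Re (phi (X \o adjoint X)) = n2 (X (delta R 1%g)).
  rewrite phi_left; last by apply: left_operators_comp => //;
    exact: left_operators_star.
  by rewrite /trace0 -[(X \o _) _]/(X (adjoint X _)) adjointE//
    n2_adjoint_delta.
have i1 := state_comp_le sphi bX bT; have i2 := state_comp_le sphi bT bX.
rewrite e1 in i1; rewrite e2 in i2.
apply: le_trans (sqmodD_le _ _) _; rewrite sqmodN.
have : (2 * B + 1) * n2 (X (delta R 1%g)) <= e.
  by rewrite -ler_pdivlMl// mulrC ltW.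
have := n2_ge0 HH (X (delta R 1%g)).
by move: i1 i2; rewrite /B; move: (n2 _) => u; nra.
Qed.

End subgroup_algebra.

(** * Square roots and extension of operators *)

Section operator_bounds.
Context (R : realType) (V : lmodType R[i]) (dot : V -> V -> R[i]).
Hypothesis HV : hilbert dot.
Local Notation n2 x := (complex.Re (dot x x)).
Implicit Types (x y z : V) (S T : V -> V) (c d : R).

(** Operator norm at most [c]. The sign of [c] is part of the notion so that such bounds can be
    added, multiplied and enlarged. *)
Definition opn T c := 0 <= c /\ forall x, n2 (T x) <= c ^+ 2 * n2 x.

Lemma minkowski u v c d N : 0 <= c -> 0 <= d -> 0 <= N ->
  n2 u <= c ^+ 2 * N -> n2 v <= d ^+ 2 * N -> n2 (u + v) <= (c + d) ^+ 2 * N.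
Proof.
move=> c0 d0 N0 uc vd; rewrite (n2D HV).
have h := le_trans (sqr_Re_le _) (cauchy_schwarz HV u v).
have h2 : n2 u * n2 v <= (c * d * N) ^+ 2.
  apply: le_trans (ler_pM (n2_ge0 HV _) (n2_ge0 HV _) uc vd) _.
  by rewrite le_eqVlt; apply/orP; left; apply/eqP; ring.
have {h h2} h := le_trans h h2.
have cdN : 0 <= c * d * N by rewrite !mulr_ge0.
have : complex.Re (dot u v) <= c * d * N.
  rewrite leNgt; apply/negP => lt.
  have : (c * d * N) ^+ 2 < complex.Re (dot u v) ^+ 2 by rewrite ltrXn2r//
    nnegrE ?(le_trans cdN (ltW lt)).
  by rewrite ltNge h.
by move: uc vd; move: (n2 u) (n2 v) (complex.Re _) => a b e ? ? ?; nra.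
Qed.

Lemma opnD S T c d : opn S c -> opn T d -> opn (fun x => S x + T x) (c + d).
Proof.
move=> [c0 Sc] [d0 Td]; split=> [|x]; first exact: addr_ge0.
by apply: minkowski => //; exact: n2_ge0 HV _.
Qed.

Lemma opn_comp S T c d : opn S c -> opn T d -> opn (fun x => S (T x)) (c * d).
Proof.
move=> [c0 Sc] [d0 Td]; split=> [|x]; first exact: mulr_ge0.
apply: le_trans (Sc _) _; rewrite exprMn -(mulrA (c ^+ 2)).
by apply: ler_wpM2l; [exact: sqr_ge0|exact: Td].
Qed.

Lemma opnZ T c (r : R) : 0 <= r -> opn T c ->
  opn (fun x => r%:C%C *: T x) (r * c).
Proof.
move=> r0 [c0 Tc]; split=> [|x]; first exact: mulr_ge0.
rewrite (n2Z HV) sqmod_real exprMn -(mulrA (r ^+ 2)).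
by apply: ler_wpM2l; [exact: sqr_ge0|exact: Tc].
Qed.

Lemma opn_le T c d : opn T c -> c <= d -> opn T d.
Proof.
move=> [c0 Tc] cd; have d0 := le_trans c0 cd; split=> // x.
by apply: le_trans (Tc x) _; rewrite ler_wpM2r ?(n2_ge0 HV)// lerXn2r.
Qed.

Lemma opn_small T : (forall e, 0 < e -> opn T e) -> forall x, T x = 0.
Proof.
move=> h x; apply: (n2_eq0 HV); apply/eqP; rewrite eq_le (n2_ge0 HV) andbT.
apply/ler_addgt0Pl => e e0; rewrite addr0.
have n0 := n2_ge0 HV x; pose N := n2 x + 1.
have N0 : 0 < N by rewrite ltr_wpDl.
have [|_ /(_ x) le1] := h (Num.sqrt (e / N));
  first by rewrite sqrtr_gt0 divr_gt0.
apply: le_trans le1 _; rewrite sqr_sqrtr; last by rewrite ltW// divr_gt0.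
rewrite mulrAC ler_pdivrMr// ler_pM2l// lerDl; exact: ler01.
Qed.

(** Cauchy-Schwarz for the positive form [dot (T u) v], taken at [x] and [T x], replaces spectral
    theory: it bounds [n2 (T x) ^+ 2] by [n2 x * n2 (T x)]. *)
Lemma psd_contraction T : linear T -> (forall x y, dot (T x) y = dot x (T y)) ->
  (forall x, 0 <= complex.Re (dot (T x) x) <= n2 x) -> opn T 1.
Proof.
move=> lT saT posT; split=> // x; rewrite expr1n mul1r.
have cs u v : sqmod (dot (T u) v) <=
    complex.Re (dot (T u) u) * complex.Re (dot (T v) v).
  apply: discr_le => a; have /andP[+ _] := posT (a *: u + v).
  rewrite lT (dotDl HV) !(dotDr HV) !(dotZl HV) !(dotZr HV).
  have -> : dot (T v) u = conjc (dot (T u) v) by rewrite saT -(dotC HV).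
  have /(congr1 (@complex.Im R)) : dot (T u) u = conjc (dot (T u) u).
    by rewrite {1}saT -(dotC HV).
  move: (dot (T u) u) (dot (T u) v) (dot (T v) v) => p q r.
  rewrite cImJ => p0; rewrite !cE /sqmod; move: p0.
  by move: (complex.Im p) (complex.Im q) (complex.Re a) (complex.Im a) => *;
    nra.
have := cs x (T x); rewrite {1}(dotxx HV (T x)) sqmod_real.
have /andP[p1 p2] := posT x; have /andP[q1 q2] := posT (T x).
have t0 := n2_ge0 HV (T x).
move=> h; have {}h : n2 (T x) ^+ 2 <= n2 x * n2 (T x).
  by apply: le_trans h _; apply: ler_pM.
move: t0; rewrite le_eqVlt => /orP[/eqP <-|t0]; first exact: n2_ge0.
by move: h; rewrite expr2 ler_pM2r.
Qed.

End operator_bounds.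

Section square_root.
Context (R : realType) (V : lmodType R[i]) (dot : V -> V -> R[i]).
Hypothesis HV : hilbert dot.
Local Notation n2 x := (complex.Re (dot x x)).
Local Notation opn := (opn dot).
Implicit Types (x y z : V) (S T : V -> V).

Section iteration.
Variables (A : V -> V) (linA : linear A).
Hypothesis saA : forall x y, dot (A x) y = dot x (A y).
Hypothesis opnA : opn A 1.

(* Riesz-Nagy iteration for [Y = 1 - sqrt (1 - A)], dominated in norm by the
   same iteration on scalars with [A = 1]. *)
Fixpoint rn k : V -> V := if k is k'.+1 then
  fun x => (2^-1)%:C%C *: (A x + rn k' (rn k' x)) else fun=> 0.
Fixpoint rns k : R := if k is k'.+1 then 2^-1 * (1 + rns k' * rns k') else 0.

Lemma rns_bounds k : 0 <= rns k <= 1 /\ rns k <= rns k.+1.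
Proof.
elim: k => [|k [/andP[h0 h1] h2]] /=; first by rewrite lexx ler01; split=> //;
  lra.
by move: h0 h1 h2; move=> /=; move: (rns k) => u ? ? ?; split;
  [apply/andP; split|]; nra.
Qed.

Lemma rn_lin k : linear (rn k).
Proof.
elim: k => [|k ih] a x y /=; first by rewrite scaler0 addr0.
rewrite linA !ih scalerA mulrC -scalerA -scalerDr; congr (_ *: _).
by rewrite scalerDr addrACA.
Qed.

Lemma rn_sa k x y : dot (rn k x) y = dot x (rn k y).
Proof.
elim: k x y => [|k ih] x y /=; first by rewrite (dot0l HV) (dot0r HV).
rewrite (dotZl HV) (dotZr HV) (dotDl HV) (dotDr HV) saA !ih; congr (_ * _).
by apply: complexP; rewrite !cE// oppr0.
Qed.

Lemma rn_comm B k : linear B -> (forall x, B (A x) = A (B x)) ->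
  forall x, B (rn k x) = rn k (B x).
Proof.
move=> lB BA; elim: k => [|k ih] x /=; first exact: lin_0.
by rewrite (lin_Z lB) (lin_D lB) BA !ih.
Qed.

Lemma rn_opn k : opn (rn k) (rns k).
Proof.
elim: k => [|k ih] /=.
  by split=> // x; rewrite (dot0l HV) expr0n mul0r.
apply: (opnZ HV); first by rewrite invr_ge0.
by apply: (opnD HV) opnA _; exact: opn_comp.
Qed.

Lemma rnA k x : rn k (A x) = A (rn k x).
Proof. by rewrite (rn_comm (B := A)). Qed.

Lemma rn_rn k l x : rn k (rn l x) = rn l (rn k x).
Proof.
by apply: rn_comm => [|y]; [exact: rn_lin|exact: rnA].
Qed.

(** The iterates commute, so the difference of consecutive squares factors as difference times sum;
    the scalar iteration satisfies the same identity, and the norm bounds multiply. *)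
Lemma rn_step k : opn (fun x => rn k.+1 x - rn k x) (rns k.+1 - rns k).
Proof.
elim: k => [|k ih].
  rewrite subr0; split=> [|x]; first by case: (rns_bounds 1) => /andP[].
  rewrite subr0; exact: (rn_opn 1).2.
rewrite [rns k.+2 - _](_ : _ = 2^-1 *
  ((rns k.+1 - rns k) * (rns k.+1 + rns k))); last first.
  have E2 : rns k.+2 = 2^-1 * (1 + rns k.+1 * rns k.+1) by [].
  have E1 : rns k.+1 = 2^-1 * (1 + rns k * rns k) by [].
  by rewrite E2 [X in _ - X = _]E1; ring.
have i2 : 0 <= 2^-1 :> R by rewrite invr_ge0.
have [h0 h1] := opnZ HV i2 (opn_comp ih (opnD HV (rn_opn k.+1) (rn_opn k))).
split=> // x.
rewrite [rn k.+2 x - rn k.+1 x](_ : _ =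
  (2^-1)%:C%C *: (rn k.+1 (rn k.+1 x + rn k x) - rn k (rn k.+1 x + rn k x))).
  exact: h1.
have ES j y : rn j.+1 y = (2^-1)%:C%C *: (A y + rn j (rn j y)) by [].
rewrite [in LHS](ES k.+1 x) [X in _ - X = _]ES.
rewrite -scalerBr; congr (_ *: _).
rewrite !(lin_D (rn_lin _)) [rn k (rn k.+1 x)]rn_rn opprD addrACA subrr add0r.
by rewrite opprD [RHS]addrA addrK.
Qed.

Lemma rn_diff k l : (k <= l)%N -> opn (fun x => rn l x - rn k x)
  (rns l - rns k).
Proof.
move=> /subnK <-; elim: (l - k)%N => [|m [h0 h1]].
  rewrite subrr; split=> // x.
  by rewrite subrr (dot0l HV) expr0n mul0r.
rewrite addSn; have [s0 s1] := opnD HV (rn_step (m + k)) (conj h0 h1).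
rewrite addrA subrK in s0; split=> // x.
have := s1 x; rewrite addrA subrK addrA subrK; exact.
Qed.

Lemma rns_limit : exists2 L, (forall k, rns k <= L) &
  forall e, 0 < e -> exists k, L - rns k < e.
Proof.
have hS : has_sup (range rns).
  by split; [exists (rns 0), 0%N|exists 1 => _ [k _ <-];
    case: (rns_bounds k) => /andP[]].
exists (sup (range rns)) => [k|e e0].
  by apply: ub_le_sup; [case: hS|exists k].
by have [_ [k _ <-] h] := sup_adherent e0 hS; exists k; lra.
Qed.

Lemma opn_weak_limit nu T (f : nat -> V -> V) k c : mean_at_oo nu -> 0 <= c ->
  (forall x, exists B, forall n, n2 (f n x) <= B) ->
  (forall x z, dot z (T x) = cmean nu (fun n => dot z (f n x))) ->
  (forall n, (k <= n)%N -> opn (f n) c) -> opn T c.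
Proof.
move=> [nuP nuF] c0 fB Tf fc; split=> // x.
have n0 := n2_ge0 HV (T x).
have : sqmod (dot (T x) (T x)) <= n2 (T x) * (c ^+ 2 * n2 x).
  rewrite [X in sqmod X]Tf; set F := fun n => _.
  have -> : cmean nu F = cmean nu (fun n => if (k <= n)%N then F n else 0).
    by rewrite /cmean; congr (_ +i* _)%C; apply: (nuF k) => n ->.
  apply: (cmean_sqmod nuP) => n; case: ifP => kn; last first.
    rewrite sqmod0; apply: mulr_ge0 => //.
    by apply: mulr_ge0; [exact: sqr_ge0|exact: n2_ge0 HV _].
  apply: le_trans (cauchy_schwarz HV _ _) _; rewrite ler_wpM2l//.
  exact: (fc n kn).2.
rewrite (dotxx HV (T x)) sqmod_real.
move: n0; rewrite le_eqVlt => /orP[/eqP <- _|t0]; last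
  by rewrite expr2 ler_pM2l.
by apply: mulr_ge0; [exact: sqr_ge0|exact: n2_ge0 HV _].
Qed.

(** [Y] is defined as a weak limit, which products do not respect. The bound [L - rns k] on the norm
    of [Y - rn k] upgrades this to norm convergence, so the fixed point equation survives. In the
    commutation clause the adjoint [B'] moves [B] across the inner product before the weak limit is
    taken. *)
Lemma rn_limit : exists Y, [/\ linear Y, opn Y 1,
  forall x y, dot (Y x) y = dot x (Y y),
  forall x, Y x + Y x = A x + Y (Y x) &
  forall B B', (forall x y, dot (B x) y = dot x (B' y)) -> linear B ->
    (forall x, B (A x) = A (B x)) -> forall x, B (Y x) = Y (B x)].
Proof.
have [nu nuoo] := exists_mean_at_oo R; have [nuP nuF] := nuoo.
have opn1 k : opn (rn k) 1.
  by apply: (opn_le HV (rn_opn k)); case: (rns_bounds k) => /andP[].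
have rnB x k : n2 (rn k x) <= n2 x.
  by have [_ /(_ x)] := opn1 k; rewrite expr1n mul1r.
have /choice[Y YP] x : exists y, forall z,
  dot z y = cmean nu (fun k => dot z (rn k x)).
  by have [y yP _] := weak_limit HV nuP (rnB x); exists y.
have bz z x : cbfun (fun k => dot z (rn k x)).
  exists (n2 z * n2 x) => k; apply: le_trans (cauchy_schwarz HV _ _) _.
  by rewrite ler_wpM2l ?(n2_ge0 HV).
have linY : linear Y.
  move=> a x y; apply: (dot_extr HV) => z.
  rewrite (dotDr HV) (dotZr HV) !YP -(cmean_lin nuP)//.
  by congr cmean; apply/funext => k; rewrite rn_lin (dotDr HV) (dotZr HV).
have comm B B' : (forall x y, dot (B x) y = dot x (B' y)) -> linear B ->
    (forall x, B (A x) = A (B x)) -> forall x, B (Y x) = Y (B x).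
  move=> BB' lB BA x; apply: (dot_extr HV) => z.
  rewrite (dotC HV) BB' -(dotC HV) !YP.
  congr cmean; apply/funext => k.
  by rewrite -(rn_comm _ lB BA) (dotC HV) -BB' -(dotC HV).
have saY x y : dot (Y x) y = dot x (Y y).
  rewrite (dotC HV) !YP -(cmeanJ nuP)//.
  by congr cmean; apply/funext => k; rewrite -(dotC HV) rn_sa.
have [L Lub Llub] := rns_limit.
have L0 : 0 <= L by have := Lub 0%N.
have Ydiff k : opn (fun x => Y x - rn k x) (L - rns k).
  have kL : 0 <= L - rns k by rewrite subr_ge0.
  apply: (opn_weak_limit (f := fun n x => rn n x - rn k x) (k := k) nuoo kL).
  - move=> x; exists (2 * n2 x + 2 * n2 x) => n.
    by apply: le_trans (n2B_le HV _ _) _; rewrite lerD// ler_wpM2l.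
  - move=> x z; rewrite (dotBr HV) YP -[dot z (rn k x)](cmean_cst nuP).
    rewrite -(cmeanB nuP)//; last exact: cbfun_cst.
    by congr cmean; apply/funext => n; rewrite (dotBr HV).
  - move=> n kn; apply: (opn_le HV (rn_diff kn)).
    by rewrite lerD2r.
have opnY : opn Y 1.
  apply: (opn_weak_limit (f := rn) (k := 0) nuoo ler01) => //.
  by move=> x; exists (n2 x).
exists Y; split=> // x; apply/eqP; rewrite -subr_eq0; apply/eqP; move: x.
apply: (opn_small HV) => e e0.
(* Replacing [Y] by its iterates costs four terms of norm at most [d]; the factor 8 leaves a
   margin. *)
have e8 : 0 < e / 8%:R by rewrite divr_gt0// ltr0n.
have [k kL] := Llub _ e8.
pose d := L - rns k.
have d0 : 0 <= d by rewrite subr_ge0.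
have Yk := Ydiff k.
have YSk : opn (fun x => Y x - rn k.+1 x) d.
  by apply: (opn_le HV (Ydiff k.+1)); rewrite lerD2l lerN2;
    case: (rns_bounds k).
have dle : 8%:R * d <= e by rewrite mulrC -ler_pdivlMr ?ltr0n// ltW.
have h1 := opnD HV YSk YSk.
have h2 := opn_comp opnY Yk.
have h3 := opn_comp Yk (opn1 k).
have h4 := opnD HV h2 h3.
have N1 : opn (fun x => - (x : V)) 1.
  by split=> // x; rewrite (n2N HV) expr1n mul1r.
have [h50 h51] := opnD HV h1 (opn_comp N1 h4).
split=> [|x]; first exact: ltW.
have le : d + d + 1 * (1 * d + d * 1) <= e by lra.
have [_ h6] := opn_le HV (conj h50 h51) le.
have -> : Y x + Y x - (A x + Y (Y x)) = Y x - rn k.+1 x + (Y x - rn k.+1 x) +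
  - (Y (Y x - rn k x) + (Y (rn k x) - rn k (rn k x))); last exact: h6.
have rnE : rn k.+1 x + rn k.+1 x = A x + rn k (rn k x).
  rewrite /= -scalerDl [X in X *: _](_ : _ = 1) ?scale1r//.
  by apply: complexP; rewrite !cE; [field|rewrite addr0].
rewrite (lin_B linY) [Y (Y x) - _ + _]addrA subrK.
rewrite [X in _ = X + _]addrACA -[X in _ = _ + _ + X + _]opprD rnE opprB.
rewrite [- (A x + rn _ _)]opprD -[RHS]addrA
  [X in _ = _ + X](_ : _ = - A x - Y (Y x)).
  by rewrite -opprD.
by rewrite addrA subrK.
Qed.

End iteration.
(** With [Y] the limit for [A = 1 - Q], the equation [2 Y = A + Y Y] says that [S = 1 - Y] squares
    to [Q]. The constant 4 is the crude bound for the square of a difference of two contractions. *)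
Lemma psd_sqrt (Q : V -> V) : linear Q ->
  (forall x y, dot (Q x) y = dot x (Q y)) ->
  (forall x, 0 <= complex.Re (dot (Q x) x) <= n2 x) ->
  exists S, [/\ linear S, forall x, n2 (S x) <= 4%:R * n2 x,
    forall x y, dot (S x) y = dot x (S y), forall x, S (S x) = Q x &
    forall B B', (forall x y, dot (B x) y = dot x (B' y)) -> linear B ->
      (forall x, B (Q x) = Q (B x)) -> forall x, B (S x) = S (B x)].
Proof.
move=> lQ saQ posQ; pose A x := x - Q x.
have lA : linear A by move=> a x y; rewrite /A lQ opprD addrACA -scalerBr.
have saA x y : dot (A x) y = dot x (A y).
  by rewrite /A (dotBl HV) (dotBr HV) saQ.
have posA x : 0 <= complex.Re (dot (A x) x) <= n2 x.
  rewrite /A (dotBl HV); move: (posQ x); move: (dot x x) (dot (Q x) x) => p q.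
  by rewrite !cE => /andP[? ?]; apply/andP; split; lra.
have [Y [lY [_ opY] saY eY cY]] := rn_limit lA saA
  (psd_contraction HV lA saA posA).
exists (fun x => x - Y x); split.
- by move=> a x y; rewrite lY opprD addrACA -scalerBr.
- move=> x; apply: le_trans (n2B_le HV _ _) _; have := opY x.
  by rewrite expr1n mul1r; move: (n2 x) (n2 (Y x)) => u v; lra.
- by move=> x y; rewrite (dotBl HV) (dotBr HV) saY.
- move=> x; rewrite (lin_B lY) opprB addrA.
  have : x - (Y x + Y x - Y (Y x)) = Q x by rewrite eY addrK /A opprB addrC
    subrK.
  by move=> <-; rewrite opprB opprD !addrA [x - Y x + _]addrAC.
- move=> B B' BB' lB BQ x; rewrite (lin_B lB) (cY B B')//.
  by move=> z; rewrite /A (lin_B lB) BQ.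
Qed.

Lemma dense_range_eq0 S T T' : (forall x y, dot (T x) y = dot x (T' y)) ->
  (forall x y, dot (S x) y = dot x (S y)) -> (forall x, S x = 0 -> x = 0) ->
  (forall x, T (S x) = 0) -> forall x, T x = 0.
Proof.
move=> TT' saS injS TS x; apply: (dot_extl HV) => y; rewrite (dot0l HV) TT'.
rewrite (injS (T' y)) ?(dot0r HV)//; apply: (dot_extr HV) => z.
by rewrite -saS -TT' TS (dot0l HV) (dot0r HV).
Qed.

Lemma dense_range S v e : linear S ->
  (forall x y, dot (S x) y = dot x (S y)) -> (forall x, S x = 0 -> x = 0) ->
  0 < e -> exists x, n2 (v - S x) < e.
Proof.
move=> lS saS injS e0; pose O := range S.
have subO : subspace O.
  split; first by exists 0; rewrite ?(lin_0 lS).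
  by move=> a _ _ [x _ <-] [y _ <-]; exists (a *: x + y); rewrite ?lS.
have OO : orth dot (orth dot O) v.
  move=> y yO; rewrite (injS y) ?(dot0l HV)//; apply: (dot_extr HV) => z.
  by rewrite -saS (dot0r HV) yO//; exists z.
by have [_ [x _ <-] h] := dense_orth_orth HV subO OO e0; exists x.
Qed.

(** [T] plays the role of [A] composed with the unbounded inverse of [S]. An injective self-adjoint
    [S] has dense range, and [T v] is the generalised weak limit of [A (x n)] for vectors with
    [S (x n)] tending to [v]. *)
Lemma operator_extension S A : linear S -> linear A ->
  (forall x y, dot (S x) y = dot x (S y)) -> (forall x, S x = 0 -> x = 0) ->
  (forall x, n2 (A x) <= n2 (S x)) ->
  exists T, [/\ linear T, forall x, n2 (T x) <= 4%:R * n2 x &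
    forall x, T (S x) = A x].
Proof.
move=> lS lA saS injS AS.
have [nu nuoo] := exists_mean_at_oo R; have [nuP nuF] := nuoo.
have approx v e : 0 < e -> exists x, n2 (v - S x) < e by exact: dense_range.
have /choice[x xP] v : exists x : nat -> V, forall n,
  n2 (v - S (x n)) <= n.+1%:R^-1.
  have /choice[x xP] n : exists y, n2 (v - S y) < n.+1%:R^-1.
    by apply: approx; rewrite invr_gt0 ltr0n.
  by exists x => n; exact: ltW.
have inv1 n : n.+1%:R^-1 <= 1 :> R by rewrite invf_le1 ?ltr0n// ler1n.
have AxB v n : n2 (A (x v n)) <= 2 * n2 v + 2.
  apply: le_trans (AS _) _.
  have -> : S (x v n) = v - (v - S (x v n)) by rewrite subKr.
  apply: le_trans (n2B_le HV _ _) _; have := le_trans (xP v n) (inv1 n).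
  by move: (n2 (v - _)) (n2 v) => p q; lra.
have /choice[T TP] v : exists y, forall z,
  dot z y = cmean nu (fun n => dot z (A (x v n))).
  by have [y yP _] := weak_limit HV nuP (AxB v); exists y.
(* The one estimate on [T]: the extension property, linearity and boundedness all follow by
   comparing [T v] with suitable [A y]. In the tail, [A (x v n) - A y] is dominated by
   [S (x v n) - S y], which is close to [v - S y]. *)
have Tdiff v y : n2 (T v - A y) <= 2 * n2 (v - S y).
  set u := T v - A y; have u0 := n2_ge0 HV u.
  have hk k : sqmod (dot u u) <= n2 u * (2 * n2 (v - S y) + 2 * k.+1%:R^-1).
    pose F n := dot u (A (x v n)) - dot u (A y).
    have E : dot u u = cmean nu F.
      rewrite /F (cmeanB nuP); last exact: cbfun_cst.
        by rewrite (cmean_cst nuP) -TP -(dotBr HV).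
      exists (n2 u * (2 * n2 v + 2)) => n.
      apply: le_trans (cauchy_schwarz HV _ _) _.
      by apply: ler_wpM2l => //; exact: AxB.
    rewrite [X in sqmod X]E.
    have -> : cmean nu F = cmean nu (fun n => if (k <= n)%N then F n else 0).
      by rewrite /cmean; congr (_ +i* _)%C; apply: (nuF k) => n ->.
    have k0 : 0 <= k.+1%:R^-1 :> R by rewrite invr_ge0 ler0n.
    have r0 : 0 <= n2 u * (2 * n2 (v - S y) + 2 * k.+1%:R^-1).
      apply: mulr_ge0 => //; apply: addr_ge0; apply: mulr_ge0 => //.
      exact: n2_ge0 HV _.
    apply: (cmean_sqmod nuP) => n; case: ifP => kn; last by rewrite sqmod0.
    rewrite /F -(dotBr HV) -(lin_B lA).
    apply: le_trans (cauchy_schwarz HV _ _) _; apply: ler_wpM2l => //.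
    apply: le_trans (AS _) _; rewrite (lin_B lS).
    have -> : S (x v n) - S y = (v - S y) - (v - S (x v n)).
      by rewrite opprB [RHS]addrC addrA subrK.
    apply: le_trans (n2B_le HV _ _) _; apply: lerD => //;
      apply: ler_wpM2l => //.
    by apply: le_trans (xP v n) _; rewrite lef_pV2 ?posrE ?ltr0n// ler_nat.
  move: u0; rewrite le_eqVlt => /orP[/eqP <-|u0].
    by apply: mulr_ge0 => //; exact: n2_ge0 HV _.
  apply/ler_addgt0Pl => e e0.
  have [k ke] : exists k, k.+1%:R^-1 < e / 2 :> R.
    exists (Num.truncn (e / 2)^-1); rewrite invf_plt ?posrE ?ltr0n ?divr_gt0//.
    exact: truncnS_gt.
  have := hk k; rewrite (dotxx HV u) sqmod_real expr2 ler_pM2l//.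
  move=> /le_trans; apply; move: ke; move: (_^-1) (n2 _) => p q.
  by lra.
have TS y : T (S y) = A y.
  apply/eqP; rewrite -subr_eq0; apply/eqP/(n2_eq0 HV)/eqP.
  rewrite eq_le (n2_ge0 HV) andbT; apply: le_trans (Tdiff _ _) _.
  by rewrite subrr (dot0l HV) mulr0.
have small u : (forall e, 0 < e -> n2 u <= e) -> u = 0.
  move=> h; apply/(n2_eq0 HV)/eqP; rewrite eq_le (n2_ge0 HV) andbT.
  by apply/ler_addgt0Pl => e e0; rewrite addr0; exact: h.
exists T; split=> // [a u v|v].
  apply/eqP; rewrite -subr_eq0; apply/eqP/small => e e0.
  (* Each of the two differences below has squared norm at most [4 * (1 + sqmod a) * (e / c)], and
     [n2B_le] doubles both. *)
  pose c := 16%:R * (1 + sqmod a).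
  have c0 : 0 < c by rewrite mulr_gt0 ?ltr0n// ltr_wpDr ?sqmod_ge0.
  have [p up] := approx u _ (divr_gt0 e0 c0).
  have [q vq] := approx v _ (divr_gt0 e0 c0).
  have -> : T (a *: u + v) - (a *: T u + T v) =
     (T (a *: u + v) - A (a *: p + q)) - (a *: (T u - A p) + (T v - A q)).
    rewrite lA scalerBr addrACA -opprD opprB addrA subrK.
    by [].
  apply: le_trans (n2B_le HV _ _) _.
  have h1 := Tdiff (a *: u + v) (a *: p + q).
  have h2 := n2D_le HV (a *: (T u - A p)) (T v - A q).
  have h3 := n2D_le HV (a *: (u - S p)) (v - S q).
  have E : a *: u + v - S (a *: p + q) = a *: (u - S p) + (v - S q).
    by rewrite lS scalerBr opprD addrACA.
  rewrite E in h1; rewrite !(n2Z HV) in h2 h3.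
  have h4 := Tdiff u p; have h5 := Tdiff v q; have a0 := sqmod_ge0 a.
  have h4' := ler_wpM2l a0 h4.
  have up' := ler_wpM2l a0 (ltW up).
  have : e / c * c = e by rewrite divfK ?gt_eqF.
  rewrite {2}/c; move: up vq up' h1 h2 h3 h4 h5 h4' a0.
  move: (e / c) (n2 _) (n2 (_ + _)) (n2 (_ + _)) (n2 (T u - _)) (n2 (T v - _))
    (n2 (u - _)) (n2 (v - _)) (sqmod a).
  by move=> f t1 t2 t3 t4 t5 t6 t7 s *; lra.
apply/ler_addgt0Pl => e e0.
(* The estimates combine to [n2 (T v) <= 4%:R * n2 v + 8%:R * n2 (v - S p)]. *)
have e8 : 0 < e / 8%:R by rewrite divr_gt0// ltr0n.
have [p vp] := approx v _ e8.
have -> : T v = (T v - A p) + A p by rewrite subrK.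
apply: le_trans (n2D_le HV _ _) _; have h1 := Tdiff v p; have h2 := AS p.
have h3 : n2 (S p) <= 2 * n2 v + 2 * n2 (v - S p).
  have -> : S p = v - (v - S p) by rewrite subKr.
  by rewrite [X in 2 * n2 (v - X)]subKr; exact: n2B_le.
move: vp h1 h2 h3.
by move: (n2 (v - _)) (n2 (T v - _)) (n2 (A p)) (n2 (S p)) (n2 v) => *; lra.
Qed.

End square_root.

Lemma summable_weights (R : realType) (G : choiceType) : countable [set: G] ->
  exists w : G -> R, [/\ forall g, 0 < w g, sm w & psum w <= 1].
Proof.
move=> /countable_injP[f finj].
pose w (g : G) : R := 2^-1 ^+ (f g).+1.
have w0 g : 0 < w g by rewrite exprn_gt0// invr_gt0.
have wB (s : seq G) : uniq s -> \sum_(g <- s) w g <= 1.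
  move=> us.
  pose t := [seq f g | g <- s].
  have ut : uniq t by rewrite map_inj_in_uniq// => g h _ _ /finj; apply;
    rewrite inE.
  have -> : \sum_(g <- s) w g = \sum_(n <- t) 2^-1 ^+ n.+1 by rewrite big_map.
  have : forall N (r : seq nat), uniq r -> {in r, forall n, (n < N)%N} ->
      \sum_(n <- r) 2^-1 ^+ n.+1 <= 1 - 2^-1 ^+ N :> R.
    elim=> [|N ih] r ur rN.
      case: r ur rN => [|n r] _ rN; first by rewrite big_nil expr0 subrr.
      by have := rN n (mem_head _ _).
    have half : 2^-1 ^+ N = 2 * 2^-1 ^+ N.+1 :> R by rewrite exprS mulrA mulfV
      ?mul1r.
    have p0 : 0 < 2^-1 ^+ N.+1 :> R by rewrite exprn_gt0// invr_gt0.
    have [Nr|Nr] := boolP (N \in r).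
      rewrite (perm_big _ (perm_to_rem Nr)) big_cons /=.
      have h : {in rem N r, forall n, (n < N)%N}.
        move=> n; rewrite mem_rem_uniq// !inE => /andP[nN nr].
        by rewrite ltn_neqAle nN -ltnS rN.
      move: (ih _ (rem_uniq _ ur) h) half p0.
      by move: (\sum_(n <- _) _) (_ ^+ N) (_ ^+ N.+1) => a b c; lra.
    have h : {in r, forall n, (n < N)%N}.
      move=> n nr; rewrite ltn_neqAle -ltnS rN// andbT.
      by apply: contraNneq Nr => <-.
    move: (ih r ur h) half p0.
    by move: (\sum_(n <- _) _) (_ ^+ N) (_ ^+ N.+1) => a b c; lra.
  move=> /(_ (\max_(n <- t) n).+1 t ut) h; apply: le_trans (h _) _.
    by move=> n nt; rewrite ltnS; exact: leq_bigmax_seq.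
  by rewrite gerBl exprn_ge0// invr_ge0.
exists w; split=> //; first exact: sm_bound wB.
by apply: psum_bound => // g; exact: ltW.
Qed.

(** * A hypertrace extending the trace *)

Section operator_families.
Context (R : realType) (G : groupType).
Local Notation C := R[i].
Local Notation H := (ell2 R G).
Local Notation n2 x := (complex.Re (inner x x)).
Local Notation HH := (@ell2_hilbert R G).
Implicit Types (x y z : H) (S T : H -> H) (A : G -> H -> H).

Definition square_summable_family A := (forall s, bounded_operator (A s)) /\
  exists2 B, 0 <= B & forall x, sm (fun s => n2 (A s x)) /\
    psum (fun s => n2 (A s x)) <= B * n2 x.

Lemma family_csm A T x y : square_summable_family A -> bounded_operator T ->
  csm (fun s => inner (T (A s x)) (A s y)) /\
  sqmod (csum (fun s => inner (T (A s x)) (A s y))) <=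
    psum (fun s => n2 (T (A s x))) * psum (fun s => n2 (A s y)).
Proof.
move=> [bA [B B0 AB]] /bounded_operatorP[_ [D D0 TD]].
have n0 z := n2_ge0 HH z.
apply: csum_cauchy_schwarz => // [||s].
- apply: sm_le (smZ _ D0 (AB x).1) => s //; exact: TD.
- by case: (AB y).
- exact: cauchy_schwarz HH _ _.
Qed.

Lemma family_operator_exists A T : square_summable_family A ->
  bounded_operator T ->
  exists P, bounded_operator P /\
    forall x y, inner (P x) y = csum (fun s => inner (T (A s x)) (A s y)).
Proof.
move=> fA bT; have [bA [B B0 AB]] := fA.
have /bounded_operatorP[lT [D D0 TD]] := bT.
have n0 z := n2_ge0 HH z.
pose q x y := csum (fun s => inner (T (A s x)) (A s y)).
have qB x y : sqmod (q x y) <= (D * B * B) * n2 x * n2 y.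
  apply: le_trans (family_csm x y fA bT).2 _.
  have -> : D * B * B * n2 x * n2 y = (D * (B * n2 x)) * (B * n2 y) by ring.
  have [s1 p1] := AB x; have [s2 p2] := AB y.
  apply: ler_pM => //; try by apply: psum_ge0.
  apply: le_trans (_ : D * psum (fun s => n2 (A s x)) <= _); last
    exact: ler_wpM2l.
  rewrite -psumZ//; by apply: psum_le => //; exact: smZ.
have ql a x y z : q (a *: x + y) z = a * q x z + q y z.
  rewrite /q -csum_lin; try exact: (family_csm _ _ fA bT).1.
  congr csum; apply/funext => s.
  by rewrite (bop_linear (bA s)) lT inner_linl.
have qr a x y z : q z (a *: x + y) = conjc a * q z x + q z y.
  rewrite /q -csum_lin; try exact: (family_csm _ _ fA bT).1.
  congr csum; apply/funext => s.
  by rewrite (bop_linear (bA s)) (dotDr HH) (dotZr HH).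
have [S [lS qS SB]] := form_operator HH ql qr qB.
have bS : bounded_operator S.
  by apply/bounded_operatorP; split=> //; exists (D * B * B) => //;
    rewrite !mulr_ge0.
exists (adjoint S); split; first exact: adjoint_bop.
by move=> x y; rewrite -adjointEr// -qS.
Qed.

(** The operator $\sum_s A_s^* T A_s$, determined weakly by its sesquilinear form. *)
Definition family_operator A T : H -> H :=
  xget 0 [set P | bounded_operator P /\
    forall x y, inner (P x) y = csum (fun s => inner (T (A s x)) (A s y))].

Lemma family_operatorP A T : square_summable_family A -> bounded_operator T ->
  bounded_operator (family_operator A T) /\
  forall x y, inner (family_operator A T x) y =
    csum (fun s => inner (T (A s x)) (A s y)).
Proof.
move=> fA bT; have [P PP] := family_operator_exists fA bT.
by rewrite /family_operator; case: xgetP => [P' _ //|/(_ P)].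
Qed.

Variables (A : G -> H -> H) (fA : square_summable_family A).
Local Notation Phi := (family_operator A).

Lemma family_bop T : bounded_operator T -> bounded_operator (Phi T).
Proof. by move=> bT; case: (family_operatorP fA bT). Qed.

Lemma family_opE T x y : bounded_operator T ->
  inner (Phi T x) y = csum (fun s => inner (T (A s x)) (A s y)).
Proof. by move=> bT; case: (family_operatorP fA bT). Qed.

Lemma family_op_lin a S T : bounded_operator S -> bounded_operator T ->
  Phi (a *: S + T) = a *: Phi S + Phi T.
Proof.
move=> bS bT; have bST := bop_comb a bS bT; apply/funext => x;
  apply: (dot_extl HH) => y.
rewrite family_opE// -[(a *: Phi S + Phi T) x]/(a *: Phi S x + Phi T x)
  inner_linl.
rewrite !family_opE// -csum_lin; try by apply: (family_csm _ _ fA _).1.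
congr csum; apply/funext => s.
by rewrite -inner_linl.
Qed.

Lemma family_op_positive T : positive_operator T -> positive_operator (Phi T).
Proof.
move=> [bT T0]; split=> [|x]; first exact: family_bop.
rewrite family_opE//; apply/cge0P; split.
  rewrite csum_re; last exact: (family_csm _ _ fA bT).1.
    by apply: psum_ge0 => s; case/cge0P: (T0 (A s x)).
  by move=> s; case/cge0P: (T0 (A s x)).
have Ti s : complex.Im (inner (T (A s x)) (A s x)) =
  0 by case/cge0P: (T0 (A s x)).
by rewrite Im_csum (rsum_single (g := 1%g)).
Qed.

Lemma family_op_compr T m : bounded_operator T -> bounded_operator m ->
  (forall s x, A s (m x) = m (A s x)) -> Phi (T \o m) = Phi T \o m.
Proof.
move=> bT bm Am; have bTm := bop_comp bT bm.
apply/funext => x; apply: (dot_extl HH) => y /=; rewrite !family_opE//.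
by congr csum; apply/funext => s; rewrite Am.
Qed.

Lemma family_op_compl T m : bounded_operator T -> bounded_operator m ->
  (forall s x, A s (adjoint m x) = adjoint m (A s x)) ->
    Phi (m \o T) = m \o Phi T.
Proof.
move=> bT bm Am; have bTm := bop_comp bm bT.
apply/funext => x; apply: (dot_extl HH) => y /=;
  rewrite [RHS]adjointE// !family_opE//.
by congr csum; apply/funext => s; rewrite Am -adjointE.
Qed.

Lemma family_op_self_adjoint : forall x y,
  inner (Phi idfun x) y = inner x (Phi idfun y).
Proof.
move=> x y; have b1 := @bop_id R G.
rewrite [RHS]innerC !family_opE// -csumJ; congr csum; apply/funext => s.
by rewrite -innerC.
Qed.

Lemma family_op_diag x :
  complex.Re (inner (Phi idfun x) x) = psum (fun s => n2 (A s x)).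
Proof.
have b1 := @bop_id R G; rewrite family_opE// csum_re//.
- by move=> s; exact: n2_ge0 HH _.
- exact: (family_csm _ _ fA b1).1.
Qed.

End operator_families.

(** * The frame in the commutant and the conditional expectation onto M *)

Section frame.
Context (R : realType) (G : groupType).
Local Notation C := R[i].
Local Notation H := (ell2 R G).
Local Notation n2 x := (complex.Re (inner x x)).
Local Notation HH := (@ell2_hilbert R G).
Local Notation d1 := (delta R (1%g : G)).
Implicit Types (x y z : H) (S T : H -> H).
Variables (M : set (H -> H)) (vM : von_neumann_algebra M).
Hypothesis ML : M `<=` @left_operators R G.

Let O := [set a d1 | a in M].
Local Notation orthO := (orth (@inner R G) (orth (@inner R G) O)).

Let Mb a : M a -> bounded_operator a.
Proof. by move=> /ML; exact: left_operators_bop. Qed.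

Let Mstar a : M a -> M (adjoint a).
Proof. by have [_ _ _ _ [h _]] := vM; exact: h. Qed.

Let Mid : M idfun. Proof. by case: vM. Qed.

Lemma cyclic_subspace : subspace O.
Proof.
have [_ _ MD _ _] := vM; split.
  exists 0 => //; have := MD (-1) _ _ Mid Mid.
  by rewrite scaleN1r addNr.
by move=> c _ _ [a Ma <-] [b Mb' <-]; exists (c *: a + b) => //; exact: MD.
Qed.

Variables (e : H -> H) (eP : is_projection (@inner R G) O e).

Lemma cyc_bop : bounded_operator e.
Proof.
apply/bounded_operatorP; split; first exact: (projection_lin HH eP).
by exists 1 => // x; rewrite mul1r; exact: (projection_n2 HH eP x).
Qed.

Lemma cyc_sa x y : inner (e x) y = inner x (e y).
Proof. exact: (projection_sa HH eP x y). Qed.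

Lemma cyc_idem x : e (e x) = e x.
Proof. exact: (projection_idem HH eP x). Qed.

Lemma cyc_mem x : orthO (e x). Proof. by case: (eP x). Qed.

Lemma cyc_M a : M a -> e (a d1) = a d1.
Proof. by move=> Ma; apply: (projection_mem HH eP); exists a. Qed.

Lemma cyc_delta : e d1 = d1. Proof. exact: (cyc_M Mid). Qed.

Lemma cyc_commutant : commutant M e.
Proof.
split=> [|a x Ma]; first exact: cyc_bop.
have [_ _ _ MM _] := vM.
apply: (projection_comm HH eP (T' := adjoint a)).
- exact: bop_linear (Mb Ma).
- by move=> u v; rewrite adjointE//; exact: Mb.
- by move=> _ [b Mb' <-]; exists (a \o b) => //; exact: MM.
- by move=> _ [b Mb' <-]; exists (adjoint a \o b) => //; apply: MM => //;
  exact: Mstar.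
Qed.

Lemma cyc_eq u v : orthO u -> orthO v ->
  (forall a, M a -> inner (a d1) u = inner (a d1) v) -> u = v.
Proof.
move=> uO vO uv; apply/eqP; rewrite -subr_eq0; apply/eqP; apply: (dot_eq0 HH).
have [_ S2] := orth_subspace HH (orth (@inner R G) O).
have wO : orthO (u - v) by have := S2 (-1) _ _ vO uO; rewrite scaleN1r addrC.
apply: wO => _ [a Ma <-].
by rewrite (dotBr HH) uv// subrr.
Qed.

(** [V s] is characterised by [V s (S x) = A s x], with [S] the square root of [Q], and identities
    between bounded operators are checked on the dense range of [S]. The [A s] commute with [M]
    because [e] and the right translations do; hence so does [Q], then [S], then [V s]. *)
Lemma exists_frame : countable [set: G] -> exists V : G -> H -> H,
  [/\ square_summable_family V, forall s, commutant M (V s),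
    forall s x, e (V s x) = V s x & family_operator V idfun = idfun].
Proof.
move=> cG; have [w [w0 sw w1]] := summable_weights R cG.
have n0 z := n2_ge0 HH z.
pose A s x := (Num.sqrt (w s))%:C%C *: e (rreg s^-1 x).
have bA s : bounded_operator (A s).
  apply: (@bop_Z _ _ _ (e \o rreg s^-1)); apply: bop_comp; first exact: cyc_bop.
  exact: bop_rreg.
have cA s : commutant M (A s).
  split=> // a x Ma; rewrite /A -(left_rreg _ _ (ML Ma)) (cyc_commutant).2//.
  by rewrite (lin_Z (bop_linear (Mb Ma))).
have An s x : n2 (A s x) <= w s * n2 x.
  rewrite (n2Z HH) sqmod_real sqr_sqrtr; last exact: ltW.
  apply: ler_wpM2l; first exact: ltW.
  by apply: le_trans (projection_n2 HH eP _) _; rewrite n2_rreg.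
have fA : square_summable_family A.
  split=> //; exists 1 => // x.
  have h (s : G) : n2 (A s x) <= n2 x * w s by rewrite mulrC.
  have sx := smZ (fun s => ltW (w0 s)) (n0 x) sw.
  split; first exact: sm_le h sx.
  apply: le_trans (psum_le _ h sx) _ => //.
  by rewrite psumZ// ?mul1r => [|s]; [rewrite ler_piMr|exact: ltW].
have b1 := @bop_id R G.
pose Q := family_operator A idfun.
have bQ : bounded_operator Q by exact: family_bop.
have [_ [B0 _ AB]] := fA.
have posQ x : 0 <= complex.Re (inner (Q x) x) <= n2 x.
  rewrite family_op_diag//; apply/andP; split; first exact: psum_ge0.
  have h (s : G) : n2 (A s x) <= n2 x * w s by rewrite mulrC.
  have sx := smZ (fun s => ltW (w0 s)) (n0 x) sw.
  apply: le_trans (psum_le _ h sx) _ => //.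
  by rewrite psumZ// => [|s]; [rewrite ler_piMr|exact: ltW].
have [S [lS SB saS SQ cS]] :=
  psd_sqrt HH (bop_linear bQ) (family_op_self_adjoint fA) posQ.
have bS : bounded_operator S by apply/bounded_operatorP; split=> //;
  exists 4%:R.
have nS x : n2 (S x) = psum (fun s => n2 (A s x)).
  by rewrite -saS SQ family_op_diag.
have AS s x : n2 (A s x) <= n2 (S x).
  by rewrite nS; apply: (@le_psum _ _ (fun s => n2 (A s x))) => //;
    case: (AB x).
have injS x : S x = 0 -> x = 0.
  move=> Sx; apply: ell2_ext => g; rewrite -inner_delta.
  have A0 : A g x = 0.
    apply/(n2_eq0 HH)/eqP; rewrite eq_le n0 andbT; apply: le_trans (AS g x) _.
    by rewrite Sx (dot0l HH).
  (* The coordinate [x g] is the inner product of [rreg g x] with [d1], and [e] fixes [d1]; so the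
     kernels of the [A s] have trivial intersection. The weights being nonzero, [e] of the translate
     vanishes along with [A]. *)
  have : e (rreg g^-1^-1 x) = 0.
    have A1 : A g^-1%g x = 0.
      apply/(n2_eq0 HH)/eqP; rewrite eq_le n0 andbT; apply: le_trans (AS _ x) _.
      by rewrite Sx (dot0l HH).
    apply/eqP; move/eqP: A1; rewrite scaler_eq0 =>
      /orP[|//] /eqP/(congr1 (@complex.Re R)).
    by rewrite cRerC => /eqP; rewrite sqrtr_eq0 leNgt w0.
  rewrite invgK => /(congr1 (fun z => inner z d1)).
  by rewrite cyc_sa cyc_delta rreg_inner rreg_delta invgK mul1g (dot0l HH).
have /choice[V VP] s : exists T, [/\ linear T, forall x,
  n2 (T x) <= 4%:R * n2 x &
    forall x, T (S x) = A s x].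
  exact: (operator_extension HH lS (bop_linear (bA s)) saS injS (AS s)).
have bV s : bounded_operator (V s).
  by case: (VP s) => lV nV _; apply/bounded_operatorP; split=> //; exists 4%:R.
have VS s x : V s (S x) = A s x by case: (VP s).
have eq0 T : bounded_operator T -> (forall x, T (S x) = 0) -> forall x, T x = 0.
  by move=> bT; apply: (dense_range_eq0 HH (T' := adjoint T)) => // x y;
    rewrite adjointE.
have cV s : commutant M (V s).
  split=> // a x Ma; have ba := Mb Ma.
  have Sa y : S (a y) = a (S y).
    rewrite (cS a (adjoint a))//; first by move=> u v; rewrite adjointE.
      exact: bop_linear.
    move=> z; rewrite /Q -[LHS]/((a \o family_operator A idfun) z).
    rewrite -family_op_compl//; last first.
      by move=> t u; rewrite (cA t).2//; exact: Mstar.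
    rewrite -[RHS]/((family_operator A idfun \o a) z) -family_op_compr// => t u.
    by rewrite (cA t).2.
  apply/eqP; rewrite -subr_eq0; apply/eqP.
  apply: (eq0 ((V s \o a) - (a \o V s))) => [|y]; first by apply: bop_B;
    exact: bop_comp.
  rewrite -[LHS]/(V s (a (S y)) - a (V s (S y))) -Sa !VS (cA s).2//.
  exact: subrr.
have eV s x : e (V s x) = V s x.
  apply/eqP; rewrite -subr_eq0; apply/eqP.
  apply: (eq0 ((e \o V s) - V s)) => [|y].
    by apply: bop_B => //; apply: bop_comp => //; exact: cyc_bop.
  rewrite -[LHS]/(e (V s (S y)) - V s (S y)) !VS /A.
  by rewrite (lin_Z (bop_linear cyc_bop)) cyc_idem subrr.
have fV : square_summable_family V.
  split=> //; exists 4%:R => // x.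
  have h (F : seq G) : uniq F -> \sum_(s <- F) n2 (V s x) <= 4%:R * n2 x.
    move=> uF; apply/ler_addgt0Pl => ep ep0.
    pose N : R := (size F)%:R; have N0 : 0 <= N by rewrite ler0n.
    (* With [S y] near [x], the finite sum is at most [4%:R * n2 x + (4%:R + 8%:R * N) * n2 (x - S
       y)]; [y] is chosen after [F], so the dependence on its size [N] is harmless. *)
    have c0 : 0 < 4%:R + 8%:R * N by rewrite ltr_wpDr ?mulr_ge0.
    have [y xy] := dense_range HH x lS saS injS (divr_gt0 ep0 c0).
    have h1 s : n2 (V s x) <= 2 * n2 (A s y) + 8%:R * n2 (x - S y).
      have -> : V s x = A s y + V s (x - S y).
        by rewrite (lin_B (bop_linear (bV s))) VS addrC subrK.
      apply: le_trans (n2D_le HH _ _) _; rewrite lerD2l.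
      have [_ nV _] := VP s; have := nV (x - S y).
      by move: (n2 (V s (x - S y))) (n2 (x - S y)) => p q; lra.
    apply: le_trans (ler_sum _ (fun s _ => h1 s)) _.
    have aff (f : G -> R) c : \sum_(s <- F) (2 * f s + c) =
      2 * (\sum_(s <- F) f s) + N * c.
      by rewrite big_split /= -mulr_sumr big_const_seq count_predT iter_addr_0
        /N (mulr_natl c).
    rewrite (aff (fun s => n2 (A s y))).
    have h2 : \sum_(s <- F) n2 (A s y) <= n2 (S y).
      by rewrite nS; apply: seq_le_psum => //; case: (AB y).
    have h3 := n2B_le HH x (x - S y); rewrite subKr in h3.
    have h4 : n2 (x - S y) * (4%:R + 8%:R * N) <=
      ep by rewrite -ler_pdivlMr// ltW.
    move: h2 h3 h4.
    by move: (\sum_(s <- F) _) (n2 (S y)) (n2 (x - S y)) (n2 x) => p q r u *;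
      lra.
  by split; [exact: sm_bound h|exact: psum_bound].
exists V; split=> //; apply/funext => x.
have bP : bounded_operator (family_operator V idfun) by exact: family_bop.
apply/eqP; rewrite -subr_eq0; apply/eqP.
apply: (eq0 (family_operator V idfun - idfun)) => [|y]; first exact: bop_B.
rewrite -[LHS]/(family_operator V idfun (S y) - S y).
(* One more application of [S] turns both sides into the form of [Q]: $\langle V_sSy, V_sSz\rangle =
   \langle A_sy, A_sz\rangle$ for each [s]. *)
apply: injS; apply: (dot_extl HH) => z; rewrite (dot0l HH) saS (dotBl HH).
rewrite saS SQ -family_op_self_adjoint// !family_opE//.
apply/eqP; rewrite subr_eq0; apply/eqP; congr csum; apply/funext => s.
by rewrite !VS.
Qed.

Lemma commutant_M_star B : commutant M B -> commutant M (adjoint B).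
Proof. exact: commutant_star Mb Mstar _. Qed.

Lemma rreg_commutant s : commutant M (rreg s).
Proof.
by split=> [|a x Ma]; [exact: bop_rreg|rewrite left_rreg//; exact: ML].
Qed.

Lemma commutant_comp B D : commutant M B -> commutant M D ->
  commutant M (B \o D).
Proof.
move=> [bB BM] [bD DM]; split=> [|a x Ma]; first exact: bop_comp.
by rewrite /= DM// BM.
Qed.

(** [flip] is antiunitary and exchanges [a d1] with [adjoint a d1], so it preserves [O], its
    complement and its closure. *)
Lemma cyc_flip x : orthO x -> orthO (flip x).
Proof.
move=> xO y yO; rewrite -(flipK y) inner_flip innerC xO ?conjc_0// =>
  _ [a Ma <-].
rewrite -(flipK (a d1)) inner_flip innerC -flip_left; last exact: ML.
by rewrite yO ?conjc_0//; exists (adjoint a) => //; exact: Mstar.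
Qed.

Lemma cyc_inner a x : M a -> inner (a d1) (e x) = inner (a d1) x.
Proof. by move=> Ma; rewrite -cyc_sa cyc_M. Qed.

(** The counterpart of [flip_left] for the commutant of [M]. It needs the projection [e], since only
    inner products with the vectors [a d1] are under control: there [B] can be moved past [a]. *)
Lemma cyc_adjoint_flip B : commutant M B -> e (adjoint B d1) = flip (e (B d1)).
Proof.
move=> [bB BM]; apply: cyc_eq; [exact: cyc_mem|by apply: cyc_flip;
  exact: cyc_mem|].
move=> a Ma; rewrite cyc_inner// -adjointE// BM// adjointE; last exact: Mb.
rewrite -[a d1 in RHS]flipK inner_flip -flip_left; last exact: ML.
by rewrite cyc_sa cyc_M//; exact: Mstar.
Qed.

(** Put [u = e (B d1)]. Tested against [a d1], both sides become the inner product of [a d1] with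
    [X (b u)]. On the left, [B] crosses over as its adjoint, which produces [flip u]; the remaining
    vector is [W d1], which is [flip] of [adjoint W d1], and the two flips cancel at the price of
    exchanging the arguments. *)
Lemma compression_comm1 X B b : left_operators X -> commutant M B -> M b ->
  e (B (e (X (b d1)))) = e (X (e (B (b d1)))).
Proof.
move=> LX cB Mb'; have bX := left_operators_bop LX; have [bB BM] := cB.
apply: cyc_eq; try exact: cyc_mem.
move=> a Ma; rewrite !cyc_inner// (BM b)// (cyc_commutant.2 b)//.
have cB' := commutant_M_star cB; have [bB' BM'] := cB'.
rewrite [LHS]adjointEr// -[LHS]cyc_sa (BM' a)// (cyc_commutant.2 a)//.
rewrite (cyc_adjoint_flip cB); have ba := Mb Ma.
rewrite adjointE//; move: (e (B d1)) => u.
pose W := adjoint a \o X \o b.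
have LW : left_operators W.
  apply: left_operators_comp; last exact: ML.
  by apply: left_operators_comp => //; apply: ML; exact: Mstar.
have -> : adjoint a (X (b d1)) = flip (adjoint W d1).
  by rewrite (flip_left LW) flipK.
rewrite inner_flip -(adjointEr _ _ (left_operators_bop LW)).
by rewrite (adjointE _ _ ba).
Qed.

(* [e] compresses L(G) to M, stated as commutation with the commutant of M. *)
Lemma compression_comm X B x : left_operators X -> commutant M B ->
  e (X (e (B (e x)))) = e (B (e (X (e x)))).
Proof.
move=> LX cB; have bX := left_operators_bop LX; have [bB _] := cB.
have LX' := left_operators_star LX; have cB' := commutant_M_star cB.
apply: cyc_eq; try exact: cyc_mem.
move=> b Mb'; rewrite !cyc_inner//.
rewrite (adjointEr _ _ bX) -cyc_sa (adjointEr _ _ bB) -cyc_sa.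
rewrite [RHS](adjointEr _ _ bB) -[RHS]cyc_sa [RHS](adjointEr _ _ bX)
  -[RHS]cyc_sa.
by rewrite compression_comm1.
Qed.

Section frame_expectation.
Variables (V : G -> H -> H) (fV : square_summable_family V).
Hypothesis cV : forall s, commutant M (V s).
Hypothesis eV : forall s x, e (V s x) = V s x.
Hypothesis V1 : family_operator V idfun = idfun.
Local Notation Psi := (family_operator V).

(** In each term the range condition [eV] lets [X] be replaced by its compression by [e], which
    [compression_comm] moves through [V s \o D]; what remains is the sum of the $V_s^*V_s$, which is
    the identity. *)
Lemma frame_compression X D x : left_operators X -> commutant M D ->
  Psi X (D (e x)) = D (e (X (e x))).
Proof.
move=> LX cD; have bX := left_operators_bop LX; have b1 := @bop_id R G.
apply: (dot_extl HH) => y; rewrite family_opE//.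
have -> : D (e (X (e x))) = Psi idfun (D (e (X (e x)))) by rewrite V1.
rewrite family_opE//; congr csum; apply/funext => s.
have /= h := compression_comm x LX (commutant_comp (cV s) cD).
by rewrite -(eV s y) -!cyc_sa -h eV.
Qed.

Lemma frame_delta X : left_operators X -> Psi X d1 = e (X d1).
Proof.
move=> LX; have c1 : commutant M idfun by split=> //; exact: bop_id.
by have := frame_compression d1 LX c1; rewrite /= cyc_delta.
Qed.

(** By the bicommutant theorem it suffices to commute with each [B] in the commutant of [M]. This is
    checked at the vectors [rreg g^-1 d1], to which [frame_compression] applies both with and
    without [B], as right translations also commute with [M]. *)
Lemma frame_mem X : left_operators X -> M (Psi X).
Proof.
move=> LX; have bX := left_operators_bop LX; have bP := family_bop fV bX.
apply: (vN_bicommutant vM); split=> // B x cB; have [bB _] := cB.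
suff E : Psi X \o B = B \o Psi X :> (H -> H)
  by exact: (congr1 (fun f => f x) E).
apply: bop_ext_delta => [||g]; [exact: bop_comp|exact: bop_comp|].
have -> : delta R g = rreg g^-1 (e d1) by rewrite cyc_delta rreg_delta invgK
  mul1g.
have cr := rreg_commutant g^-1.
have h1 := frame_compression d1 LX (commutant_comp cB cr).
have h2 := frame_compression d1 LX cr.
by rewrite -[LHS]/(Psi X ((B \o rreg g^-1) (e d1))) h1 /= h2.
Qed.

End frame_expectation.

End frame.

Section improved_hypertrace.
Context (R : realType) (G : groupType).
Local Notation H := (ell2 R G).
Local Notation HH := (@ell2_hilbert R G).
Local Notation d1 := (delta R (1%g : G)).

Lemma trace_extending_hypertrace (M : set (H -> H)) : countable [set: G] ->
  von_neumann_algebra M -> M `<=` @left_operators R G -> amenable_vN M ->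
  exists phi, [/\ is_state phi,
    forall m T, M m -> bounded_operator T -> phi (T \o m) = phi (m \o T) &
    forall a X, M a -> left_operators X -> phi (a \o X) = trace0 (a \o X)].
Proof.
move=> cG vM ML [phi [sphi phiM phiC]].
have [e eP] := exists_projection HH (cyclic_subspace vM).
have [V [fV cV eV V1]] := exists_frame vM ML eP cG.
have Mb a : M a -> bounded_operator a by move=> /ML; exact: left_operators_bop.
have Mstar a : M a -> M (adjoint a) by have [_ _ _ _ [h _]] := vM; exact: h.
have fr m T : M m -> bounded_operator T ->
    family_operator V (T \o m) = family_operator V T \o m.
  move=> Mm bT; apply: (family_op_compr fV) => //; first exact: Mb.
  by move=> s x; rewrite (cV s).2.
have fl m T : M m -> bounded_operator T ->
    family_operator V (m \o T) = m \o family_operator V T.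
  move=> Mm bT; apply: (family_op_compl fV) => //; first exact: Mb.
  by move=> s x; rewrite (cV s).2//; exact: Mstar.
have [phil phip phi1] := sphi.
exists (fun T => phi (family_operator V T)); split.
- split=> [a S T bS bT|T pT|]; last by rewrite V1.
    by rewrite (family_op_lin fV)// phil//; exact: family_bop fV _ _.
  by apply: phip; exact: family_op_positive fV _ _.
- by move=> m T Mm bT; rewrite fr// fl// phiC//; exact: family_bop fV _ _.
- move=> a X Ma LX; have bX := left_operators_bop LX.
  rewrite fl// phiM; last first.
    by have [_ _ _ MM _] := vM; apply: MM => //;
      exact: (frame_mem vM ML eP fV cV eV V1 LX).
  rewrite /trace0 -[LHS]/(inner (a (family_operator V X d1)) d1).
  rewrite (frame_delta vM ML eP fV cV eV V1 LX).
  rewrite -[RHS]/(inner (a (X d1)) d1) !(adjointE _ _ (Mb _ Ma)).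
  by rewrite (cyc_sa eP) (cyc_M eP)//; exact: Mstar.
Qed.

End improved_hypertrace.

(** * Extreme states *)

Section mean_convexity.
Context (R : realType) (J : Type).
Local Notation C := R[i].
Implicit Types (X : set (J -> C)) (b : J -> R).

(* Closure under all means, ultralimits included, plays the role of
   "compact and convex" and makes any topology on functionals unnecessary. *)
Definition mean_convex X := forall (I : Type) (nu : (I -> R) -> R)
  (F : I -> J -> C),
  is_mean nu -> (forall i, X (F i)) -> X (fun j => cmean nu (fun i => F i j)).

Definition uniformly_bounded b X := forall p j, X p -> sqmod (p j) <= b j.

Lemma mean_convex_bigcap (F : set (set (J -> C))) :
  (forall X, F X -> mean_convex X) -> mean_convex (\bigcap_(X in F) X).
Proof. by move=> FX I nu P nuP PX X XF; apply: FX => // i; exact: PX. Qed.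

(** The compactness argument: points chosen in the members of the chain have a limit along an
    ultrafilter containing the tails, and it lies in each member. *)
Lemma chain_bigcap_neq0 (F : set (set (J -> C))) :
  F !=set0 -> total_on F subset -> (forall X, F X -> X !=set0) ->
  (forall X, F X -> mean_convex X) -> \bigcap_(X in F) X !=set0.
Proof.
move=> [X1 FX1] totF F0 Fc.
pose tails : set_system (set (J -> C)) :=
  [set A | exists2 X0, F X0 & forall X, F X -> X `<=` X0 -> A X].
have PF : ProperFilter tails.
  apply: Build_ProperFilter_ex => [A [X0 FX0 XA]|].
    by exists X0; apply: XA.
  split; first by exists X1.
  - move=> A B [X FX XA] [Y FY YB]; have [XY|YX] := totF _ _ FX FY.
      exists X => // Z FZ ZX; split; first exact: XA.
      by apply: YB => //; exact: subset_trans XY.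
    exists Y => // Z FZ ZY; split; last exact: YB.
    by apply: XA => //; exact: subset_trans YX.
  - by move=> A B AB [X FX XA]; exists X => // Z FZ ZX; apply: AB; exact: XA.
have [nu nuP nuF] := filter_mean R PF.
have /choice[p pP] X : exists q, F X -> X q.
  have [FX|nFX] := pselect (F X); last by exists (fun=> 0).
  by have [q Xq] := F0 _ FX; exists q.
exists (fun j => cmean nu (fun X => p X j)) => X0 FX0.
(* Off the tail below [X0] the choice is reset to a point of [X0], so that every value lies in [X0];
   the mean, seeing only the tail, is unchanged. *)
pose q X := if pselect (F X /\ X `<=` X0) is left _ then p X else p X0.
rewrite (_ : (fun j => _) = fun j => cmean nu (fun X => q X j)).
  apply: Fc => // X; rewrite /q; case: pselect => [[FX XX0]|_]; last exact: pP.
  exact: (XX0 _ (pP _ FX)).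
apply/funext => j; rewrite /cmean; congr (_ +i* _)%C;
apply: (nuF [set X | F X /\ X `<=` X0]); do ?[by exists X0];
by move=> X FX; rewrite /q; case: pselect.
Qed.

Definition segment (t : R) (p q : J -> C) : J -> C :=
  fun j => t%:C%C * p j + (1 - t)%:C%C * q j.

Definition extreme X : set (J -> C) := [set p | X p /\
  forall q q' t, 0 < t < 1 -> X q -> X q' -> segment t q q' = p -> q = p].

(* [sep] lists coordinates whose real parts separate the points of [X]. *)
Lemma exists_extreme X b (sep : J -> Prop) : X !=set0 -> mean_convex X ->
  uniformly_bounded b X ->
  (forall p q, X p -> X q -> (forall j, sep j ->
    complex.Re (p j) = complex.Re (q j)) ->
    p = q) ->
  extreme X !=set0.
Proof.
move=> X0 cX bX sepX.
pose face F := [/\ F !=set0, F `<=` X, mean_convex F &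
  forall q q' t, 0 < t < 1 -> X q -> X q' -> F (segment t q q') -> F q].
have [||F [F0 FX cF fF] minF] := @minimal_set _ face.
- by exists X; split.
- move=> S SP totS S0; split.
  + apply: chain_bigcap_neq0 => // Y SY; by case: (SP _ SY).
  + by have [Y SY] := S0 => p /(_ _ SY); case: (SP _ SY) => _ YX _ _; exact: YX.
  + by apply: mean_convex_bigcap => Y /SP[].
  + move=> q q' t t01 Xq Xq' Sq Y SY; have [_ _ _ h] := SP _ SY.
    exact: (h q q' t) t01 Xq Xq' (Sq _ SY).
have Fbound j : has_sup [set complex.Re (p j) | p in F].
  split; first by have [p Fp] := F0; exists (complex.Re (p j)), p.
  exists (b j + 1) => _ [p Fp <-].
  apply: le_trans (ler_norm _) _; apply: sqr_le_abs.
  by apply: le_trans (sqr_Re_le _) _; apply: bX; exact: FX.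
have const j : exists s, forall p, F p -> complex.Re (p j) = s.
  pose s := sup [set complex.Re (p j) | p in F].
  have le_s p : F p -> complex.Re (p j) <= s.
    by move=> Fp; apply: ub_le_sup; [case: (Fbound j)|exists p].
  exists s; suff <- : [set p | F p /\ complex.Re (p j) = s] = F by move=> p [].
  apply: minF; last by move=> p [].
  split; last 1 first.
  - move=> q q' t t01 Xq Xq' [Fs sE].
    have Fq := fF _ _ _ t01 Xq Xq' Fs; split=> //.
    (* The face condition concerns the first end point only; the second is reached by exchanging the
       ends and replacing [t] by [1 - t]. *)
    have Fq' : F q'.
      apply: (fF q' q (1 - t)) => //; first by lra.
      by rewrite (_ : segment _ _ _ = segment t q q')//;
        apply/funext => k; rewrite /segment subKr addrC.
    move: sE (le_s _ Fq) (le_s _ Fq') t01;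
      rewrite /segment !cE => sE h1 h2 /andP[t0 t1].
    by nra.
  (* The supremum is attained at the generalised limit of a maximising sequence. *)
  - have [nu nuoo] := exists_mean_at_oo R; have [nuP _] := nuoo.
    have /choice[p pP] n : exists p, F p /\ s - n.+1%:R^-1 < complex.Re (p j).
      have e0 : 0 < n.+1%:R^-1 :> R by rewrite invr_gt0 ltr0n.
      by have [_ [p Fp <-] h] := sup_adherent e0 (Fbound j); exists p.
    exists (fun k => cmean nu (fun n => p n k)); split.
      by apply: cF => // n; case: (pP n).
    have pb : cbfun (fun n => p n j).
      by exists (b j) => n; apply: bX; apply: FX; case: (pP n).
    have z : cmean nu (fun n => (complex.Re (p n j) - s)%:C%C) = 0.
      apply: (mean_at_oo_vanish (B := 1) nuoo) => n.
      have [Fpn sn] := pP n; have := le_s _ Fpn; rewrite sqmod_real mul1r.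
      have : n.+1%:R^-1 <= 1 :> R by rewrite invf_le1 ?ltr0n// ler1n.
      by move: sn; move: (complex.Re _) (_^-1) => u v *; nra.
    have {}z : nu (fun n => complex.Re (p n j) - s) = 0.
      exact: (congr1 (@complex.Re R) z).
    have := mean_lin nuP 1 (bfun_Re pb) (bfun_cst (- s)).
    under eq_fun do rewrite mul1r.
    by rewrite z (mean_cst nuP) mul1r => /esym/eqP; rewrite subr_eq0 => /eqP.
  - by move=> p [Fp _]; exact: FX.
  - move=> I nu P nuP PF; split; first by apply: cF => // i; case: (PF i).
    rewrite /= (_ : (fun i => _) = (fun=> s)) ?(mean_cst nuP)//.
    by apply/funext => i; case: (PF i).
have [p Fp] := F0; exists p; split; first exact: FX.
move=> q q' t t01 Xq Xq' qE; have Fq : F q by apply: (fF q q' t) => //;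
  rewrite qE.
apply: sepX; [exact: FX|exact: FX|move=> j _].
by have [s sP] := const j; rewrite !sP.
Qed.

End mean_convexity.

(** * Diagonal operators and the mean induced by a state *)

Section diagonal_operators.
Context (R : realType) (G : groupType).
Local Notation C := R[i].
Local Notation H := (ell2 R G).
Local Notation n2 x := (complex.Re (inner x x)).
Local Notation HH := (@ell2_hilbert R G).
Implicit Types (x y z : H) (S T : H -> H) (f h : G -> C).

(* Multiplication by [f]; the junk value outside bounded [f] is irrelevant. *)
Definition diag f x : H := insubd (0 : H) (fun g => f g * x g).

Lemma diagE f x g : cbfun f -> diag f x g = f g * x g.
Proof.
move=> [B fB]; rewrite /diag val_insubd ifT//; apply/square_summableP.
have B0 : 0 <= B := le_trans (sqmod_ge0 _) (fB 1%g).
suff : sm (fun g => sqmod (f g * x g)) by [].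
apply: sm_le (smZ (fun s => sqmod_ge0 (x s)) B0 (sm_ell2 x)) => s /=.
by rewrite sqmodM ler_wpM2r ?sqmod_ge0.
Qed.

Lemma bop_diag f : cbfun f -> bounded_operator (diag f).
Proof.
move=> bf; have [B fB] := bf; have B0 : 0 <= B :=
  le_trans (sqmod_ge0 _) (fB 1%g).
apply/bounded_operatorP; split.
  move=> a x y; apply: ell2_ext => g; rewrite ell2E !diagE// ell2E; ring.
exists B => // x; rewrite !Re_inner_self -psumZ//; last 2 first.
- by move=> g; exact: sqmod_ge0.
- exact: sm_ell2.
apply: psum_le => [g|g|]; first exact: sqmod_ge0.
  by rewrite diagE// sqmodM ler_wpM2r ?sqmod_ge0.
by apply: smZ => //; [move=> g; exact: sqmod_ge0|exact: sm_ell2].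
Qed.

Lemma diag_lin a f h : cbfun f -> cbfun h ->
  diag (fun g => a * f g + h g) = a *: diag f + diag h.
Proof.
move=> bf bh; have bfh : cbfun (fun g => a * f g + h g).
  by apply: cbfunD => //; exact: cbfunZ.
apply/funext => x; apply: ell2_ext => g; rewrite diagE//.
by rewrite -[(a *: _ + _) x]/(a *: diag f x + diag h x) ell2E !diagE//; ring.
Qed.

Lemma diag_cst a : diag (fun=> a) = a *: idfun.
Proof.
apply/funext => x; apply: ell2_ext => g; rewrite diagE//; exact: cbfun_cst.
Qed.

Lemma diagM f h : cbfun f -> cbfun h -> diag (fun g => f g * h g) =
  diag f \o diag h.
Proof.
move=> bf bh; apply/funext => x; apply: ell2_ext => g /=.
by rewrite !diagE// ?mulrA//; exact: cbfunM.
Qed.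

Lemma adjoint_diag f : cbfun f -> adjoint (diag f) =
  diag (fun g => conjc (f g)).
Proof.
move=> bf; apply: adjoint_eq => [|x y]; first exact: bop_diag.
rewrite /inner; congr csum; apply/funext => g.
by rewrite !diagE//; [rewrite conjcM conjcK mulrCA mulrA|exact: cbfunJ].
Qed.

Lemma diag_positive f : cbfun f -> (forall g, 0 <= f g) ->
  positive_operator (diag f).
Proof.
move=> bf f0; split=> [|x]; first exact: bop_diag.
have E g : diag f x g * conjc (x g) = (complex.Re (f g) * sqmod (x g))%:C%C.
  rewrite diagE// -mulrA [x g * _]mulrC mulJc.
  case/cge0P: (f0 g); move: (f g) (sqmod _) => u v ? u0.
  by apply: complexP; rewrite !cE u0; ring.
have p0 g : 0 <= complex.Re (f g) * sqmod (x g).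
  by rewrite mulr_ge0 ?sqmod_ge0//; case/cge0P: (f0 g).
rewrite /inner; under eq_fun do rewrite E.
have [s1 _] := inner_cs (diag f x) x.
rewrite csum_real//; first by apply/cge0P; split=> //; exact: psum_ge0.
case: s1 => s1 _; apply: sm_le s1 => g; rewrite E cRerC.
exact: ler_norm.
Qed.

Lemma lreg_diag s f : cbfun f ->
  lreg s^-1 \o diag f \o lreg s = diag (fun g => f (s * g)%g).
Proof.
move=> bf; have bf' : cbfun (fun g => f (s * g)%g).
  by case: bf => B fB; exists B => g; exact: fB.
apply/funext => x; apply: ell2_ext => g.
rewrite -[LHS]/(lreg s^-1 (diag f (lreg s x)) g) lregE !diagE// lregE.
by rewrite invgK mulKg.
Qed.

Section state_mean.
Variables (phi : (H -> H) -> C) (sphi : is_state phi).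

Definition diag_mean (f : G -> R) : R :=
  complex.Re (phi (diag (fun g => (f g)%:C%C))).

Lemma diag_real_state (f : G -> R) : bfun f ->
  phi (diag (fun g => (f g)%:C%C)) = (diag_mean f)%:C%C.
Proof.
move=> bf; apply: complexP => //; rewrite cImrC.
have [B fB] := bf; have bc := cbfun_real bf.
have [lin pos one] := sphi.
have bB : cbfun (fun _ : G => B%:C%C : C) by exact: cbfun_cst.
(* [B - f] is nonnegative, so its value is real; as [B] is real, so is the value at [f]. *)
have : 0 <= phi (diag (fun g => (-1) * (f g)%:C%C + B%:C%C)).
  apply: pos; apply: diag_positive; first by apply: cbfunD => //; exact: cbfunZ.
  move=> g; have := fB g; rewrite ler_norml => /andP[_ ?].
  by apply/cge0P; rewrite !cE; split; [lra|ring].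
rewrite diag_lin// lin; do ?exact: bop_diag.
rewrite diag_cst (stateZ sphi); last exact: bop_id.
rewrite one mulr1 => /cge0P[_].
by rewrite !cE; move: (phi _) => u; lra.
Qed.

Lemma diag_mean_is_mean : is_mean diag_mean.
Proof.
have [lin pos one] := sphi; split.
- move=> a f h bf bh; rewrite /diag_mean.
  rewrite (_ : (fun g => _) = (fun g => a%:C%C * (f g)%:C%C + (h g)%:C%C)).
    rewrite diag_lin; do ?exact: cbfun_real.
    rewrite lin; do ?[by apply: bop_diag; exact: cbfun_real].
    by move: (phi _) (phi _) => u v; rewrite !cE; ring.
  by apply/funext => g; apply: complexP; rewrite !cE; ring.
- move=> f bf f0; suff /cge0P[] : 0 <= phi (diag (fun g => (f g)%:C%C)) by [].
  apply: pos; apply: diag_positive => [|g]; first exact: cbfun_real.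
  by apply/cge0P; split; [exact: f0|].
- by rewrite /diag_mean diag_cst scale1r one.
Qed.

Lemma state_diag f : cbfun f -> phi (diag f) = cmean diag_mean f.
Proof.
move=> bf; have [bR bI] := (bfun_Re bf, bfun_Im bf).
have [i [i0 i1]] : exists i : C, complex.Re i = 0 /\ complex.Im i = 1.
  by exists (Complex 0 1).
have -> : f = fun g => i * (complex.Im (f g))%:C%C + (complex.Re (f g))%:C%C.
  by apply/funext => g; apply: complexP; rewrite !cE i0 i1; ring.
have cI := cbfun_real bI; have cR := cbfun_real bR.
have [lin _ _] := sphi.
rewrite diag_lin// lin; do ?exact: bop_diag.
rewrite (cmean_lin diag_mean_is_mean)// !diag_real_state//.
congr (_ * _ + _); apply: complexP; rewrite ?cRerC ?cImrC //=.
- by rewrite (mean0 diag_mean_is_mean).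
- by rewrite (mean0 diag_mean_is_mean).
Qed.

End state_mean.
End diagonal_operators.

(** * The action on states and extreme points of a minimal invariant set *)

Section state_action.
Context (R : realType) (G : groupType).
Local Notation C := R[i].
Local Notation H := (ell2 R G).
Local Notation n2 x := (complex.Re (inner x x)).
Local Notation HH := (@ell2_hilbert R G).
Local Notation d1 := (delta R (1%g : G)).
Local Notation functional := ((H -> H) -> C).
Implicit Types (x y z : H) (S T : H -> H) (phi psi : functional) (g h s : G).

Definition act g phi : functional := fun T => phi (lreg g^-1 \o T \o lreg g).

Lemma actM g h phi : act (g * h) phi = act g (act h phi).
Proof.
apply/funext => T; congr phi; apply/funext => x /=.
by rewrite invgM -!lreg_lreg.
Qed.

Lemma act1 phi : act 1 phi = phi.
Proof.
by apply/funext => T; congr phi; apply/funext => x /=; rewrite invg1 !lreg_1.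
Qed.

Lemma actK g phi : act g^-1 (act g phi) = phi.
Proof. by rewrite -actM mulVg act1. Qed.

Lemma actVK g phi : act g (act g^-1 phi) = phi.
Proof. by rewrite -actM mulgV act1. Qed.

Lemma bop_conj g T : bounded_operator T ->
  bounded_operator (lreg g^-1 \o T \o lreg g).
Proof.
by move=> bT; do 2?apply: bop_comp => //; exact: bop_lreg.
Qed.

Lemma bop_conjE g T : bounded_operator (lreg g^-1 \o T \o lreg g) ->
  bounded_operator T.
Proof.
move=> /(bop_conj g^-1); rewrite invgK.
suff -> : lreg g \o (lreg g^-1 \o T \o lreg g) \o lreg g^-1 = T by [].
by apply/funext => x /=; rewrite !lregVK.
Qed.

(* States, normalised to vanish at unbounded operators so that they are
   determined by their values at bounded ones. *)
Definition nstate : set functional :=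
  [set phi | is_state phi /\ forall T, ~ bounded_operator T -> phi T = 0].

Definition normalize phi : functional :=
  fun T => if `[< bounded_operator T >] then phi T else 0.

Lemma normalizeE phi T : bounded_operator T -> normalize phi T = phi T.
Proof. by move=> bT; rewrite /normalize asboolT. Qed.

Lemma normalize_nstate phi : is_state phi -> nstate (normalize phi).
Proof.
move=> [lin pos one]; split=> [|T nbT]; last by rewrite /normalize asboolF.
split=> [a S T bS bT|T pT|]; last by rewrite normalizeE//; exact: bop_id.
- by rewrite !normalizeE ?lin//; exact: bop_comb.
- by rewrite normalizeE ?pos//; case: pT.
Qed.

Lemma vector_state : is_state (fun T : H -> H => inner (T d1) d1).
Proof.
split=> [a S T bS bT|T [_ pT]|//]; first by rewrite -inner_linl.
- exact: pT.
- by rewrite inner_delta deltaE eqxx.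
Qed.

Lemma nstate_bound : exists b, uniformly_bounded b nstate.
Proof.
have /choice[b bP] T : exists b, forall phi, nstate phi -> sqmod (phi T) <= b.
  have [bT|nbT] := pselect (bounded_operator T); last first.
    by exists 0 => phi [_ /(_ _ nbT) ->]; rewrite sqmod0.
  have /bounded_operatorP[_ [B _ TB]] := bT.
  by exists B => phi [sphi _]; exact: state_sqmod sphi _ _ bT TB.
by exists b => phi T nphi; exact: bP.
Qed.

Lemma nstate_cbfun I (F : I -> functional) T : (forall i, nstate (F i)) ->
  cbfun (fun i => F i T).
Proof.
by move=> nF; have [b bP] := nstate_bound; exists (b T) => i; exact: bP.
Qed.

Lemma nstate_mean_convex : mean_convex nstate.
Proof.
move=> I nu F nuP nF; have cF T := nstate_cbfun T nF.
split; last first.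
  move=> T nbT; rewrite (_ : (fun i => _) = (fun=> 0)) ?(cmean_cst nuP)//.
  by apply/funext => i; case: (nF i) => _ ->.
split=> [a S T bS bT|T pT|].
- rewrite -(cmean_lin nuP)//; congr cmean; apply/funext => i.
  by case: (nF i) => -[-> ].
- by apply: (cmean_ge0 nuP) => // i; case: (nF i) => -[_ h _] _; exact: h.
- rewrite (_ : (fun i => _) = (fun=> 1)) ?(cmean_cst nuP)//.
  by apply/funext => i; case: (nF i) => -[].
Qed.

Definition act_invariant (X : set functional) := forall g phi, X phi ->
  X (act g phi).

Lemma nstate_act : act_invariant nstate.
Proof.
move=> g phi [[lin pos one] nphi]; split; last first.
  by move=> T nbT; apply: nphi => /bop_conjE.
split=> [a S T bS bT|T [bT pT]|].
- rewrite /act -lin; do ?exact: bop_conj.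
  by congr phi; apply/funext => x /=; exact: lreg_lin.
- apply: pos; split=> [|x /=]; first exact: bop_conj.
  by rewrite lreg_inner invgK.
- rewrite /act (_ : _ \o _ = idfun)//.
  by apply/funext => x /=; rewrite lregK.
Qed.

Lemma state_ext phi psi : nstate phi -> nstate psi ->
  (forall T, bounded_operator T -> complex.Re (phi T) = complex.Re (psi T)) ->
    phi = psi.
Proof.
move=> [sphi nphi] [spsi npsi] e; apply/funext => T.
have [bT|nbT] := pselect (bounded_operator T); last by rewrite nphi// npsi.
apply: complexP; first exact: e.
have [i [i0 i1]] : exists i : C, complex.Re i = 0 /\ complex.Im i = 1.
  by exists (Complex 0 1).
have := e _ (bop_Z i bT); rewrite (stateZ sphi)// (stateZ spsi)//.
by rewrite !cE i0 i1; move: (phi T) (psi T) => u v; lra.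
Qed.

Lemma act_segment g t phi psi :
  act g (segment t phi psi) = segment t (act g phi) (act g psi).
Proof. by []. Qed.

Lemma act_extreme (X : set functional) : act_invariant X ->
  act_invariant (extreme X).
Proof.
move=> iX g phi [Xphi ephi]; split=> [|q q' t t01 Xq Xq' qE]; first exact: iX.
rewrite -[LHS](actVK g); congr (act g _); apply: (ephi _ (act g^-1 q') t) => //.
- exact: iX.
- exact: iX.
- by rewrite -act_segment qE actK.
Qed.

Definition invariant_convex (X : set functional) :=
  [/\ X !=set0, mean_convex X & act_invariant X].

Lemma minimal_invariant_convex (X : set functional) :
  invariant_convex X -> exists2 Y, invariant_convex Y /\ Y `<=` X &
    forall Z, invariant_convex Z -> Z `<=` Y -> Z = Y.
Proof.
move=> iX; have [||Y iY minY] := @minimal_set _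
  [set Y | invariant_convex Y /\ Y `<=` X].
- by exists X; split.
- move=> F FP totF F0; split; last first.
    by have [Y FY] := F0 => phi /(_ _ FY); case: (FP _ FY) => _; apply.
  split.
  + by apply: chain_bigcap_neq0 => // Y FY; case: (FP _ FY) => -[].
  + by apply: mean_convex_bigcap => Y FY; case: (FP _ FY) => -[].
  + by move=> g phi Fphi Y FY; case: (FP _ FY) => -[_ _ h] _; apply: h;
    exact: Fphi.
- exists Y => // Z iZ ZY; apply: minY => //; split=> //.
  by apply: subset_trans ZY _; case: iY.
Qed.

Section singular_state.
Variables (K0 : set functional) (iK0 : invariant_convex K0).
Hypothesis minK0 : forall Z, invariant_convex Z -> Z `<=` K0 -> Z = K0.
Hypothesis nK0 : K0 `<=` nstate.
Variable psi : functional.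
Hypothesis epsi : extreme K0 psi.

Let orbit T : G -> C := fun s => act s psi T.

Lemma orbit_cbfun T : cbfun (orbit T).
Proof.
by apply: (@nstate_cbfun _ (fun s => act s psi)) => s; apply: nstate_act;
  apply: nK0; case: epsi.
Qed.

Definition orbit_diag T : H -> H := diag (orbit T).

Lemma orbit_diag_conj g T :
  lreg g^-1 \o orbit_diag T \o lreg g = orbit_diag (lreg g^-1 \o T \o lreg g).
Proof.
rewrite /orbit_diag lreg_diag; last exact: orbit_cbfun.
by congr diag; apply/funext => s; rewrite /orbit actM.
Qed.

(** Composing with the equivariant map [orbit_diag] sends [K0] into itself, because each resulting
    state is a mean of the orbit of [psi]. The image is again invariant and convex, so by minimality
    it is all of [K0] and contains [psi]. *)
Lemma orbit_barycentre :
  exists2 phi, K0 phi & forall T, phi (orbit_diag T) = psi T.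
Proof.
pose D phi : functional := fun T => phi (orbit_diag T).
have DK0 : [set D phi | phi in K0] `<=` K0.
  move=> _ [phi K0phi <-]; have [_ cK0 iK] := iK0.
  have [sphi _] := nK0 K0phi.
  have -> : D phi = fun T => cmean (diag_mean phi) (fun s => act s psi T).
    by apply/funext => T; rewrite /D state_diag//; exact: orbit_cbfun.
  apply: cK0 => [|s]; first exact: diag_mean_is_mean.
  by apply: iK; case: epsi.
have iD : invariant_convex [set D phi | phi in K0].
  have [[phi0 K0phi0] cK0 iK] := iK0; split.
  - by exists (D phi0), phi0.
  - move=> I nu F nuP FD.
    have /choice[Phi PhiP] i : exists phi, K0 phi /\ D phi = F i.
      by have [phi ? ?] := FD i; exists phi.
    exists (fun T => cmean nu (fun i => Phi i T)).
      by apply: cK0 => // i; case: (PhiP i).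
    apply/funext => T; rewrite /D; congr cmean; apply/funext => i.
    by case: (PhiP i) => _ <-.
  - move=> g _ [phi K0phi <-]; exists (act g phi); first exact: iK.
    by apply/funext => T; rewrite /D /act orbit_diag_conj.
have K0psi : K0 psi by case: epsi.
have := minK0 iD DK0 => E; rewrite -E in K0psi.
by have [phi K0phi <-] := K0psi; exists phi.
Qed.

Variables (phi : functional) (K0phi : K0 phi).
Hypothesis phiD : forall T, phi (orbit_diag T) = psi T.

Let nu := diag_mean phi.
Let sphi : is_state phi. Proof. by case: (nK0 K0phi). Qed.
Let nuP : is_mean nu. Proof. exact: diag_mean_is_mean. Qed.

Lemma orbit_mean T : cmean nu (orbit T) = psi T.
Proof. by rewrite -(state_diag sphi); [exact: phiD|exact: orbit_cbfun]. Qed.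

(** The bounds are symmetric under exchanging [f] and [1 - f] and keep both means away from 0, so
    that either function can serve as a density. *)
Lemma reweighted_mean (f : G -> R) : (forall s, 4^-1 <= f s <= 3%:R / 4%:R) ->
  [/\ bfun f, 0 < nu f < 1 & is_mean (fun u => nu (fun s => f s * u s) / nu f)].
Proof.
move=> fb.
have bf : bfun f by exists 1 => s; have := fb s; rewrite ler_norml; lra.
have f1 : 4^-1 <= nu f.
  rewrite -(mean_cst nuP 4^-1); apply: (mean_le nuP) => //;
    first exact: bfun_cst.
  by move=> s; case/andP: (fb s).
have f2 : nu f <= 3%:R / 4%:R.
  rewrite -(mean_cst nuP (3%:R / 4%:R)); apply: (mean_le nuP) => //;
    first exact: bfun_cst.
  by move=> s; case/andP: (fb s).
have f0 : 0 < nu f by lra.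
split=> //; first by rewrite f0; lra.
split=> [a u v bu bv|u bu u0|].
- have -> : (fun s => f s * (a * u s + v s)) =
  (fun s => a * (f s * u s) + f s * v s).
    by apply/funext => s; ring.
  by rewrite (mean_lin nuP); [ring|exact: bfunM|exact: bfunM].
- rewrite divr_ge0 ?(ltW f0)//; apply: (mean_ge0 nuP) => [|s];
  first exact: bfunM.
  by rewrite mulr_ge0//; have := fb s; lra.
- by under eq_fun do rewrite mulr1; rewrite divff// gt_eqF.
Qed.

(** The densities [f] and [1 - f] split the barycentre [psi] of the orbit into a proper convex
    combination of barycentres [q] and [q'] in [K0]; extremality forces [q = psi]. *)
Lemma extreme_mean_affine (f : G -> R) T :
  (forall s, 4^-1 <= f s <= 3%:R / 4%:R) ->
  cmean nu (fun s => (f s)%:C%C * orbit T s) = (nu f)%:C%C * psi T.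
Proof.
move=> fb; have [bf nf1 mf] := reweighted_mean fb.
have fb' s : 4^-1 <= 1 - f s <= 3%:R / 4%:R by have := fb s; lra.
have [bf' nf1' mf'] := reweighted_mean fb'.
have nf' : nu (fun s => 1 - f s) = 1 - nu f.
  have := mean_lin nuP (-1) bf (bfun_cst 1); rewrite (mean1 nuP) => h.
  by rewrite [RHS]addrC -mulN1r -h; congr nu; apply/funext => s; ring.
have [_ cK0 iK] := iK0; have [K0psi ext] := epsi.
have Ko s : K0 (act s psi) by exact: iK.
pose q T := cmean (fun u => nu (fun s => f s * u s) / nu f)
  (fun s => act s psi T).
pose q' T := cmean (fun u => nu (fun s => (1 - f s) * u s) / nu
  (fun s => 1 - f s))
  (fun s => act s psi T).
have wE (k : G -> R) T' : bfun k -> nu k != 0 ->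
    (nu k)%:C%C * cmean (fun u => nu (fun s => k s * u s) / nu k) (orbit T') =
    cmean nu (fun s => (k s)%:C%C * orbit T' s).
  move=> bk k0; apply: complexP; rewrite ?cReM ?cImM cRerC cImrC mul0r ?subr0
    ?addr0 /=.
    rewrite mulrC divfK//; congr nu; apply/funext => s.
    by rewrite cReM cRerC cImrC mul0r subr0.
  rewrite mulrC divfK//; congr nu; apply/funext => s.
  by rewrite cImM cRerC cImrC mul0r addr0.
have nf0 : nu f != 0 by rewrite gt_eqF//; case/andP: nf1.
have nf0' : nu (fun s => 1 - f s) != 0 by rewrite gt_eqF//; case/andP: nf1'.
have qpsi : q = psi.
  apply: (ext q q' (nu f)) => //.
  - exact: cK0.
  - exact: cK0.
  apply/funext => T'; rewrite /segment -nf' /q /q' -/(orbit T') !wE//.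
  rewrite -(cmeanD nuP).
  - rewrite -orbit_mean; congr cmean; apply/funext => s.
    by apply: complexP; rewrite !cE; ring.
  - by apply: cbfunM; [exact: cbfun_real|exact: orbit_cbfun].
  - by apply: cbfunM; [exact: cbfun_real|exact: orbit_cbfun].
by rewrite -wE// -[cmean _ (orbit T)]/(q T) qpsi.
Qed.

Lemma extreme_mean_mulr (h : G -> R) T : bfun h ->
  cmean nu (fun s => (h s)%:C%C * orbit T s) = (nu h)%:C%C * psi T.
Proof.
move=> [B hB]; have bh : bfun h by exists B.
(* Scaling by [c^-1] brings [h] into the interval of radius 1/4 about 0, and the shift by 1/2 makes
   it an admissible density. *)
pose c := 4%:R * (`|B| + 1).
have c0 : 0 < c by rewrite mulr_gt0// ltr_wpDl.
pose f s := c^-1 * h s + 2^-1.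
have fb s : 4^-1 <= f s <= 3%:R / 4%:R.
  have : `|c^-1 * h s| <= 4^-1.
    rewrite normrM ger0_norm ?invr_ge0 ?(ltW c0)// mulrC ler_pdivrMr//.
    rewrite /c mulrA mulVf ?mul1r//; apply: le_trans (hB s) _.
    by apply: le_trans (ler_norm B) _; rewrite lerDl.
  by rewrite ler_norml /f => /andP[? ?]; lra.
have nf : nu f = c^-1 * nu h + 2^-1.
  by rewrite (mean_lin nuP)//; [rewrite (mean_cst nuP)|exact: bfun_cst].
have := extreme_mean_affine T fb; rewrite nf.
have -> : (fun s => (f s)%:C%C * orbit T s) =
    (fun s => (c^-1)%:C%C * ((h s)%:C%C * orbit T s) + (2^-1)%:C%C * orbit T s).
  by apply/funext => s; apply: complexP; rewrite !cE /f; ring.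
have co := orbit_cbfun T; have ch := cbfun_real bh.
rewrite (cmean_lin nuP); [|exact: cbfunM|exact: cbfunZ].
rewrite (cmeanZ nuP)// orbit_mean => E.
have cc : (c^-1)%:C%C != 0 :> C.
  by apply/eqP => /(congr1 (@complex.Re R)) /eqP;
    rewrite cRerC cRe0 invr_eq0 gt_eqF.
apply: (mulfI cc); apply: (addIr ((2^-1)%:C%C * psi T)); rewrite E.
by apply: complexP; rewrite !cE; ring.
Qed.

Lemma extreme_mean_cmul (u : G -> C) T : cbfun u ->
  cmean nu (fun s => u s * orbit T s) = cmean nu u * psi T.
Proof.
move=> bu; have [bR bI] := (bfun_Re bu, bfun_Im bu); have co := orbit_cbfun T.
have [i [i0 i1]] : exists i : C, complex.Re i = 0 /\ complex.Im i = 1.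
  by exists (Complex 0 1).
have cI := cbfun_real bI; have cR := cbfun_real bR.
have uE : u = fun g => i * (complex.Im (u g))%:C%C + (complex.Re (u g))%:C%C.
  by apply/funext => g; apply: complexP; rewrite !cE i0 i1; ring.
have -> : (fun s => u s * orbit T s) =
  fun s => i * ((complex.Im (u s))%:C%C * orbit T s) +
    (complex.Re (u s))%:C%C * orbit T s.
  by apply/funext => s; rewrite {1}uE; ring.
rewrite (cmean_lin nuP); [|exact: cbfunM|exact: cbfunM].
rewrite !extreme_mean_mulr// mulrA -mulrDl; congr (_ * _).
rewrite [in RHS]uE (cmean_lin nuP)//; congr (_ * _ + _).
  by apply: complexP => //=; rewrite (mean0 nuP).
by apply: complexP => //=; rewrite (mean0 nuP).
Qed.

Let X T : H -> H := orbit_diag T - psi T *: idfun.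

Let X_diag T : X T = diag (fun s => orbit T s - psi T).
Proof.
have -> : (fun s => orbit T s - psi T) = fun s => 1 * orbit T s + - psi T.
  by apply/funext => s; rewrite mul1r.
rewrite diag_lin; [|exact: orbit_cbfun|exact: cbfun_cst].
by rewrite scale1r diag_cst scaleNr.
Qed.

Let orbit_sub_cbfun T : cbfun (fun s => orbit T s - psi T).
Proof. by apply: cbfunD; [exact: orbit_cbfun|exact: cbfun_cst]. Qed.

(** This vanishing of the variance, together with normality of [X T], puts [X T] in the left and
    right kernels of [phi], so [orbit_diag T] acts as the scalar [psi T] on either side. It is
    [extreme_mean_cmul] for the conjugate of [orbit T s - psi T]. *)
Let X_null T : phi (adjoint (X T) \o X T) = 0.
Proof.
have b1 := orbit_sub_cbfun T; have b2 := cbfunJ b1.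
rewrite X_diag adjoint_diag// -diagM// state_diag//; last exact: cbfunM.
pose u s := conjc (orbit T s - psi T).
have -> : (fun g => conjc (orbit T g - psi T) * (orbit T g - psi T)) =
    fun s => (- psi T) * u s + u s * orbit T s.
  by apply/funext => s; rewrite -/(u s); ring.
rewrite -/nu (cmean_lin nuP)//; last by apply: cbfunM => //; exact: orbit_cbfun.
by rewrite extreme_mean_cmul//; ring.
Qed.

Let X_normal T : X T \o adjoint (X T) = adjoint (X T) \o X T.
Proof.
have b1 := orbit_sub_cbfun T; have b2 := cbfunJ b1.
rewrite X_diag adjoint_diag// -!diagM//.
by congr diag; apply/funext => s; rewrite mulrC.
Qed.

Let bX T : bounded_operator (X T).
Proof. by rewrite X_diag; apply: bop_diag. Qed.

Let bD T : bounded_operator (orbit_diag T).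
Proof. by apply: bop_diag; exact: orbit_cbfun. Qed.

Lemma phi_diagr S T : bounded_operator S -> phi (S \o orbit_diag T) =
  psi T * phi S.
Proof.
move=> bS; have := state_null_comp sphi bS (bX T) (X_null T).
have -> : S \o X T = (S \o orbit_diag T) - psi T *: S.
  apply/funext => x /=; rewrite -[X T x]/(orbit_diag T x - psi T *: x).
  by rewrite (lin_B (bop_linear bS)) (lin_Z (bop_linear bS)).
rewrite (stateB sphi); [|exact: bop_comp|exact: bop_Z].
by rewrite (stateZ sphi)// => /eqP; rewrite subr_eq0 => /eqP.
Qed.

Lemma phi_diagl S T : bounded_operator S -> phi (orbit_diag T \o S) =
  psi T * phi S.
Proof.
move=> bS; have h : phi (X T \o adjoint (X T)) = 0 by rewrite X_normal.
have := state_null_compr sphi bS (bX T) h.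
have -> : X T \o S = (orbit_diag T \o S) - psi T *: S by [].
rewrite (stateB sphi); [|exact: bop_comp|exact: bop_Z].
by rewrite (stateZ sphi)// => /eqP; rewrite subr_eq0 => /eqP.
Qed.

(* Compare [a lreg g^-1 D_T] with [lreg g^-1 D_T a] using centrality at [a]. *)
Lemma central_vanish g a : act g psi <> psi -> bounded_operator a ->
  (forall T, bounded_operator T -> phi (T \o a) = phi (a \o T)) ->
  phi (a \o lreg g^-1) = 0.
Proof.
move=> gpsi ba cen.
have [T gT] : exists T, act g psi T <> psi T.
  apply: contrapT => h; apply: gpsi; apply/funext => T; apply: contrapT => hT.
  by apply: h; exists T.
pose T' := lreg g^-1 \o T \o lreg g.
have bl := @bop_lreg R G g^-1.
have e1 : phi (a \o (lreg g^-1 \o orbit_diag T)) = psi T * phi (a \o lreg g^-1).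
  by rewrite -phi_diagr//; exact: bop_comp.
have e2 : phi ((lreg g^-1 \o orbit_diag T) \o a) =
  psi T' * phi (a \o lreg g^-1).
  rewrite -(cen (lreg g^-1))// -phi_diagl; last exact: bop_comp.
  rewrite /T' -orbit_diag_conj; congr phi; apply/funext => x /=.
  by rewrite lregVK.
apply: (@complex_affine_eq0 _ (psi T) (psi T')).
  by rewrite -e1 -e2 cen//; exact: bop_comp.
by apply/eqP => E; apply: gT; rewrite E.
Qed.

End singular_state.
End state_action.

(** * The radical and maximality *)

Section amenable_radical_exists.
Context (R : realType) (G : groupType).
Local Notation C := R[i].
Local Notation H := (ell2 R G).
Local Notation functional := ((H -> H) -> C).
Implicit Types (T : H -> H) (phi psi : functional) (g s : G) (N K : set G)
  (X : set functional).

(** On diagonal operators [phi] gives a mean on all of the group. It is pushed forward to [N] along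
    the equivariant map [n], because the functions to be averaged are controlled on [N] only. *)
Lemma amenable_of_invariant_state N phi : group_closed (mem N) ->
  is_state phi ->
  (forall k, N k -> act k phi = phi) -> amenable_group R N.
Proof.
move=> gN sphi phiN.
(* [r] selects a representative of each right coset of [N]. *)
pose r s : G := xget 1%g [set t | N (s * t^-1)%g].
have rP s : N (s * (r s)^-1)%g.
  rewrite /r; case: xgetP => [t -> //|/(_ s)].
  by case; rewrite /= mulgV; exact: group1K.
have rM k s : N k -> r (k * s)%g = r s.
  move=> Nk; congr (xget 1%g _); apply/seteqP; split=> t /= Nt.
    have := groupMK gN (groupVK gN Nk) Nt.
    by rewrite !mulgA mulVg mul1g.
  by rewrite -mulgA; exact: groupMK.
pose n s := (s * (r s)^-1)%g.
have nM k s : N k -> n (k * s)%g = (k * n s)%g by move=> Nk;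
  rewrite /n rM// mulgA.
have bN (f : G -> R) : [bounded f h | h in N] -> bfun (fun s => f (n s)).
  move=> /pinfty_ex_gt0[B _ fB]; exists B => s; exact: fB (rP s).
have mm := diag_mean_is_mean sphi.
exists (fun f => diag_mean phi (fun s => f (n s))); split.
- by move=> a f1 f2 b1 b2; rewrite -(mean_lin mm)//; exact: bN.
- move=> f bf f0; apply: (mean_ge0 mm) => [|s]; first exact: bN.
  exact: f0 (rP s).
- exact: mean1 mm.
- move=> k f Nk /bN bf; have Nk' := groupVK gN Nk.
  rewrite /diag_mean -[in RHS](phiN _ Nk') /act invgK.
  have cf := cbfun_real bf; have := lreg_diag k^-1 cf; rewrite invgK => ->.
  congr (complex.Re (phi (diag _))); apply/funext => s.
  by rewrite nM.
Qed.

Definition pointwise_stabilizer X : set G :=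
  [set g | forall psi, X psi -> act g psi = psi].

Lemma pointwise_stabilizer_normal X : act_invariant X ->
  normal_subgroup (pointwise_stabilizer X).
Proof.
move=> iX; split=> [|g k Xk psi Xpsi].
  split; first by rewrite inE => psi _; exact: act1.
  move=> g k; rewrite !inE => Xg Xk psi Xpsi.
  by rewrite actM -{1}(Xk psi Xpsi) actK Xg.
by rewrite conjgE !actM Xk ?actK//; exact: iX.
Qed.

Lemma pointwise_stabilizer_amenable X : act_invariant X -> X !=set0 ->
  X `<=` @nstate R G -> normal_amenable R (pointwise_stabilizer X).
Proof.
move=> iX [psi Xpsi] nX; have nN := pointwise_stabilizer_normal iX.
split=> //; have [spsi _] := nX _ Xpsi.
by apply: (amenable_of_invariant_state nN.1 spsi) => k; apply.
Qed.

Lemma exists_nstate : @nstate R G !=set0.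
Proof. by exists (normalize (fun T => inner (T (delta R 1%g)) (delta R 1%g)));
  apply: normalize_nstate; exact: vector_state.
Qed.

(** The fixed point is the barycentre of the orbit of [psi] under an invariant mean of [K];
    [mean_convex] keeps it in [X]. *)
Lemma amenable_fixed_point K X psi : amenable_group R K -> mean_convex X ->
  act_invariant X -> X `<=` @nstate R G -> X psi ->
  exists2 phi, X phi & forall k, K k -> act k phi = phi.
Proof.
move=> [m mK] cX iX nX Xpsi; have mm := invariant_mean_is_mean mK.
exists (fun T => cmean m (fun s => act s psi T)); first by apply: cX => // s;
  exact: iX.
move=> k Kk; have [_ _ _ inv] := mK; apply/funext => T.
have co : cbfun (fun s => act s psi T).
  by apply: (@nstate_cbfun _ _ _ (fun s => act s psi)) => s; apply: nX;
    exact: iX.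
rewrite {1}/act.
transitivity (cmean m (fun s => act (k * s)%g psi T)).
  by congr cmean; apply/funext => s; rewrite actM.
have co' : cbfun (fun s => act (k * s)%g psi T).
  by have [B cB] := co; exists B => s; exact: cB.
rewrite /cmean; congr (_ +i* _)%C.
  rewrite -(inv k (fun s => complex.Re (act (k * s)%g psi T)))//.
    by congr m; apply/funext => s; rewrite mulVKg.
  by apply: bounded_on; exact: bfun_Re.
rewrite -(inv k (fun s => complex.Im (act (k * s)%g psi T)))//.
  by congr m; apply/funext => s; rewrite mulVKg.
by apply: bounded_on; exact: bfun_Im.
Qed.

Lemma Rad_is_amenable_radical : is_amenable_radical R (Rad R G).
Proof.
suff [N RN] : exists N : set G, is_amenable_radical R N.
  by rewrite /Rad; case: xgetP => [N' _ //|/(_ N)].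
have iS : invariant_convex (@nstate R G).
  by split; [exact: exists_nstate|exact: nstate_mean_convex|exact: nstate_act].
have [X [iX nX] minX] := minimal_invariant_convex iS; have [X0 cX aX] := iX.
exists (pointwise_stabilizer X); split;
  first exact: pointwise_stabilizer_amenable.
move=> K [[gK nK] amK].
pose Y := [set psi | X psi /\ forall k, K k -> act k psi = psi].
suff YX : Y = X by move=> k Kk psi; rewrite -YX => -[_]; apply.
apply: minX => [|psi []//]; split.
- have [psi Xpsi] := X0.
  by have [phi Xphi phiK] := amenable_fixed_point amK cX aX nX Xpsi; exists phi.
- move=> I nu F nuP YF; split; first by apply: cX => // i; case: (YF i).
  move=> k Kk; apply/funext => T; rewrite /act; congr cmean; apply/funext => i.
  by have [_ /(_ k Kk) E] := YF i; rewrite -[in RHS]E.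
- move=> g psi [Xpsi psiK]; split=> [|k Kk]; first exact: aX.
  have -> : act k (act g psi) = act g (act (k ^ g)%g psi).
    by rewrite -!actM conjgE mulVKg.
  by rewrite psiK//; exact: nK.
Qed.

End amenable_radical_exists.

(** * Support of an amenable invariant subalgebra *)

Section maximality.
Context (R : realType) (G : groupType).
Local Notation C := R[i].
Local Notation H := (ell2 R G).
Local Notation functional := ((H -> H) -> C).
Hypothesis countable_G : countable [set: G].
Variables (M : set (H -> H)).
Hypotheses (vM : von_neumann_subalgebra M (group_vN R G)) (iM : G_invariant M)
  (aM : amenable_vN M).

Let ML : M `<=` @left_operators R G.
Proof. by have [_ MG] := vM => T /MG; exact: group_vN_left. Qed.

Let Mb a : M a -> bounded_operator a.
Proof. by move=> /ML; exact: left_operators_bop. Qed.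

Let Mconj g a : M a -> M (lreg g \o a \o lreg g^-1).
Proof.
by move=> Ma; rewrite -(iM g); exists a => //; rewrite adjoint_lreg.
Qed.

Definition extended_hypertraces : set functional := [set phi | [/\ nstate phi,
  forall m T, M m -> bounded_operator T -> phi (T \o m) = phi (m \o T) &
  forall a X, M a -> left_operators X -> phi (a \o X) = trace0 (a \o X)]].

(** Nonemptiness is [trace_extending_hypertrace]. Under [act g] the operators are replaced by
    conjugates, which stay in [M] by [G_invariant] and in [left_operators]; the trace condition
    survives because the trace may be computed at [delta R g] as well. *)
Lemma extended_hypertraces_invariant_convex :
  invariant_convex extended_hypertraces.
Proof.
have [vNM _] := vM; split.
- have [phi [sphi cphi tphi]] := trace_extending_hypertrace countable_G vNM ML
  aM.
  exists (normalize phi); split; first exact: normalize_nstate.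
    move=> m T Mm bT; have bm := Mb Mm.
    by rewrite (normalizeE _ (bop_comp bT bm)) (normalizeE _ (bop_comp bm bT))
      cphi.
  move=> a X Ma LX.
  by rewrite (normalizeE _ (bop_comp (Mb Ma) (left_operators_bop LX))) tphi.
- move=> I nu F nuP KF; split.
  + by apply: nstate_mean_convex => // i; case: (KF i).
  + move=> m T Mm bT; congr cmean; apply/funext => i.
    by case: (KF i) => _ h _; exact: h.
  + move=> a X Ma LX; rewrite -[RHS](cmean_cst nuP); congr cmean;
    apply/funext => i.
    by case: (KF i) => _ _ h; exact: h.
- move=> g phi [nphi cphi tphi]; split; first exact: nstate_act.
  + move=> m T Mm bT; pose m' := lreg g^-1 \o m \o lreg g.
    have Mm' : M m' by have := Mconj g^-1 Mm; rewrite invgK.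
    have bT' := bop_conj g bT.
    have := cphi m' _ Mm' bT'; rewrite /act => E.
    rewrite (_ : _ \o _ = (lreg g^-1 \o T \o lreg g) \o m'); last first.
      by apply/funext => x /=; rewrite lregVK.
    rewrite E; congr phi; apply/funext => x; rewrite /m' /=.
    by rewrite lregVK.
  + move=> a X Ma LX; pose a' := lreg g^-1 \o a \o lreg g.
    have Ma' : M a' by have := Mconj g^-1 Ma; rewrite invgK.
    have LX' : left_operators (lreg g^-1 \o X \o lreg g).
      apply: left_operators_comp; last exact: left_lreg.
      by apply: left_operators_comp => //; exact: left_lreg.
    have := tphi a' _ Ma' LX'; rewrite /act => E.
    rewrite (_ : _ \o _ = a' \o (lreg g^-1 \o X \o lreg g)); last first.
      by apply/funext => x; rewrite /a' /= lregVK.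
    rewrite E /trace0 /a' /= lregVK lreg_inner invgK lreg_delta mulg1.
    have LaX := left_operators_comp (ML Ma) LX.
    exact: (trace0_left g LaX).
Qed.

Lemma amenable_invariant_supported a g : M a -> ~ Rad R G g ->
  a (delta R 1%g) g = 0.
Proof.
move=> Ma nRg.
have [K0 [iK0 K0E] minK0] :=
  minimal_invariant_convex extended_hypertraces_invariant_convex.
have nK0 : K0 `<=` @nstate R G by move=> phi /K0E[].
have [K00 cK0 aK0] := iK0; have [b bP] := nstate_bound R G.
have eK0 : extreme K0 !=set0.
  apply: (exists_extreme (b := b) (sep := @bounded_operator R G)) => //.
    by move=> phi T /nK0; exact: bP.
  by move=> phi psi /nK0 nphi /nK0 npsi; exact: state_ext.
have aE := act_extreme aK0.
have nE : extreme K0 `<=` @nstate R G by move=> phi [/nK0].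
have [_ RadP] := Rad_is_amenable_radical R G.
have := RadP _ (pointwise_stabilizer_amenable aE eK0 nE) g.
move=> /contra_not/(_ nRg) /existsNP[psi /not_implyP[epsi gpsi]].
have [phi K0phi phiD] := orbit_barycentre iK0 minK0 nK0 epsi.
have [_ cphi tphi] := K0E _ K0phi.
have := central_vanish iK0 nK0 epsi K0phi phiD gpsi (Mb Ma)
  (fun T bT => cphi a T Ma bT).
rewrite tphi//; last exact: left_lreg.
(* The trace of [a \o lreg g^-1] is the Fourier coefficient of [a] at [g]. *)
rewrite /trace0 /= lreg_delta mulg1 inner_delta left_deltaE ?invgK ?mul1g//.
exact: ML.
Qed.

End maximality.

Theorem theoremA (R : realType) (G : groupType)
    (countable_G : countable [set: G]) :
  [/\ von_neumann_subalgebra (subgroup_vN R (Rad R G)) (group_vN R G),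
      G_invariant (subgroup_vN R (Rad R G)),
      amenable_vN (subgroup_vN R (Rad R G)) &
      forall M : set (ell2 R G -> ell2 R G),
        von_neumann_subalgebra M (group_vN R G) -> G_invariant M ->
        amenable_vN M -> M `<=` subgroup_vN R (Rad R G)].
Proof.
have [[[gR nR] aR] _] := Rad_is_amenable_radical R G.
split.
- exact: subgroup_vN_subalgebra.
- exact: subgroup_vN_invariant.
- exact: subgroup_vN_amenable.
- move=> M vM iM aM T MT; rewrite subgroup_vN_bicommutant//.
  apply: left_supported_bicommutant => [|g nRg].
    by case: vM => _ /(_ _ MT); exact: group_vN_left.
  exact: amenable_invariant_supported countable_G _ vM iM aM _ _ MT nRg.
Qed.
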